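(* Let $\pi\colon E\to M$ be a fiber bundle with $\dim M=m$. There is a bijective correspondence between the set of orientable jet fields $\Psi\colon E\to J^1\pi$ (that is, the set of orientable Ehresmann connections $\nabla$ in $\pi\colon E\to M$) and the set of equivalence classes $\{\mathbf{X}\}\subset\mathfrak{X}^m(E)$ of locally decomposable and $\pi$-transverse $m$-multivector fields. They are characterized by the fact that $\mathcal{D}(\Psi)=\mathcal{D}(\mathbf{X})$. In addition, the orientable jet field $\Psi$ is integrable if, and only if, so is $\mathbf{X}$, for every $\mathbf{X}\in\{\mathbf{X}\}$.
   Context: All manifolds are real, second countable and $C^\infty$; maps and structures are $C^\infty$. $J^1\pi$ is the bundle of 1-jets of local sections of $\pi$, with projection $\pi^1\colon J^1\pi\to E$. A jet field is a global section $\Psi\colon E\to J^1\pi$ of $\pi^1$; its associated (horizontal) distribution $\mathcal{D}(\Psi)\subset\mathrm{T}E$ is $\mathcal{D}_y(\Psi)=\operatorname{Im}\mathrm{T}_{\pi(y)}\phi$ for any representative $\phi$ of $\Psi(y)$; it satisfies $\mathrm{T}E=\ker\mathrm{T}\pi\oplus\mathcal{D}(\Psi)$, and the corresponding Ehresmann connection $\nabla$ is the projection of $\mathrm{T}E$ onto $\mathcal{D}(\Psi)$ along $\ker\mathrm{T}\pi$. $\Psi$ (or $\nabla$) is orientable if $\mathcal{D}(\Psi)$ is an orientable distribution, i.e. $\Lambda^m\mathcal{D}(\Psi)$ has a non-vanishing global section. $\Psi$ is integrable if through every point $y\in E$ there passes a local section $\phi$ of $\pi$ with $\Psi\circ\phi=j^1\phi$,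 where $(j^1\phi)(x)$ is the 1-jet of $\phi$ at $x$. An $m$-multivector field $\mathbf{X}\in\mathfrak{X}^m(E)$ is a section of $\Lambda^m\mathrm{T}E$. It is locally decomposable if every $y\in E$ has an open neighbourhood $U_y$ with $X_1,\dots,X_m\in\mathfrak{X}(U_y)$ such that $\mathbf{X}|_{U_y}=X_1\wedge\dots\wedge X_m$. It is $\pi$-transverse if, at every $y\in E$ and for every $\beta\in\Omega^m(M)$ with $\beta(\pi(y))\neq0$, one has $(i(\mathbf{X})(\pi^*\beta))_y\neq0$, where $i$ denotes contraction. Two non-vanishing multivector fields $\mathbf{X},\mathbf{X}'$ are equivalent if $\mathbf{X}'=f\mathbf{X}$ for a non-vanishing $f\in C^\infty(E)$; $\{\mathbf{X}\}$ is the class of $\mathbf{X}$. For non-vanishing locally decomposable $\mathbf{X}$, $\mathcal{D}(\mathbf{X})$ is the rank-$m$ distribution locally spanned by $X_1,\dots,X_m$ (so that $\mathbf{X}$ is a section of $\Lambda^m\mathcal{D}(\mathbf{X})$), and $\mathbf{X}$ is integrable if $\mathcal{D}(\mathbf{X})$ is an integrable distribution. *)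

(* Defs.v *)
From HB Require Import structures.
From mathcomp Require Import all_boot all_order all_algebra.
From mathcomp Require Import boolp classical_sets functions reals.
From mathcomp Require Import topology normedtype derive.
Set Implicit Arguments.
Unset Strict Implicit.
Unset Printing Implicit Defensive.
Import Order.TTheory GRing.Theory Num.Theory.
Import numFieldNormedType.Exports.
Local Open Scope classical_set_scope.
Local Open Scope ring_scope.

(* Only used for open U; values of f outside U are irrelevant. *)
Fixpoint class_C (R : realType) (n : nat) (W : normedModType R) (r : nat)
    (U : set 'rV[R]_n) (f : 'rV[R]_n -> W) : Prop :=
  (forall x, U x -> {for x, continuous f}) /\
  (if r is r'.+1 then
     forall i : 'I_n,
       (forall x, U x -> derivable f x (delta_mx 0 i)) /\
       class_C r' U (fun x => 'D_(delta_mx 0 i) f x)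
   else True).

Definition smooth (R : realType) (n : nat) (W : normedModType R)
    (U : set 'rV[R]_n) (f : 'rV[R]_n -> W) : Prop :=
  forall r, class_C r U f.

Section Manifolds.
Context {R : realType}.

(* [cmap] is meaningful on [cdom] only, [cinv] on the image of [cdom] only. *)
Record chart (T : Type) (n : nat) := Chart {
  cdom : set T;
  cmap : T -> 'rV[R]_n;
  cinv : 'rV[R]_n -> T }.

Definition is_chart (T : topologicalType) n (c : chart T n) : Prop :=
  [/\ open (cdom c) /\ open (cmap c @` cdom c),
      (forall x, cdom c x -> cinv c (cmap c x) = x),
      (forall x, cdom c x -> {for x, continuous (cmap c)}) &
      (forall x, cdom c x -> {for cmap c x, continuous (cinv c)})].

Definition smooth_change (T : Type) n (c c' : chart T n) : Prop :=
  smooth (cmap c @` (cdom c `&` cdom c')) (cmap c' \o cinv c).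

(* As the preferred chart [chart_at x] is part of the data, the tangent space
   at x is the model space 'rV[R]_n : the row vector v stands for the tangent
   vector whose components in [chart_at x] are v. *)
Record charted (n : nat) := Charted {
  carrier :> topologicalType;
  atlas : set (chart carrier n);
  chart_at : carrier -> chart carrier n }.

Definition is_manifold n (A : charted n) : Prop :=
  [/\ hausdorff_space A /\ @second_countable A,
      (forall c, atlas (c := A) c -> is_chart c),
      (forall c c', atlas (c := A) c -> atlas c' -> smooth_change c c') &
      (forall x : A, atlas (chart_at x) /\ cdom (chart_at x) x)].

Record manifold (n : nat) := Manifold {
  mcharted :> charted n;
  manifoldP : is_manifold mcharted }.

Definition max_atlas n (A : charted n) : set (chart A n) :=
  [set c | is_chart c /\
    forall c', atlas c' -> smooth_change c c' /\ smooth_change c' c].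

Definition euclid (n : nat) : charted n :=
  @Charted n 'rV[R]_n [set Chart setT id id] (fun=> Chart setT id id).

Definition prod_chart (T S : Type) n p (c : chart T n) (d : chart S p) :
    chart (T * S) (n + p) :=
  Chart (cdom c `*` cdom d)
        (fun z => row_mx (cmap c z.1) (cmap d z.2))
        (fun v => (cinv c (lsubmx v), cinv d (rsubmx v))).

Definition prod_charted n p (A : charted n) (B : charted p) : charted (n + p) :=
  @Charted (n + p) (A * B)%type
    [set e | exists c d, [/\ atlas c, atlas d & e = prod_chart c d]]
    (fun z => prod_chart (chart_at z.1) (chart_at z.2)).

Definition smooth_in n (A : charted n) (W : normedModType R)
    (c : chart A n) (U : set A) (f : A -> W) : Prop :=
  smooth (cmap c @` (U `&` cdom c)) (f \o cinv c).

Definition smooth_fun n (A : charted n) (W : normedModType R)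
    (U : set A) (f : A -> W) : Prop :=
  forall c, atlas c -> smooth_in c U f.

Definition smooth_map n p (A : charted n) (B : charted p)
    (U : set A) (f : A -> B) : Prop :=
  (forall x, U x -> {for x, continuous f}) /\
  (forall c c', atlas c -> atlas c' ->
     smooth_in c (U `&` f @^-1` cdom c') (cmap c' \o f)).

(* T_x f, acting on row vectors by right multiplication. *)
Definition tangent n p (A : charted n) (B : charted p) (f : A -> B) (x : A) :
    'M[R]_(n, p) :=
  'J (cmap (chart_at (f x)) \o f \o cinv (chart_at x)) (cmap (chart_at x) x).

(* [tcoord c x] maps a tangent vector at x to its components in the chart c;
   [tframe c x] is the inverse map. *)
Definition tcoord n (A : charted n) (c : chart A n) (x : A) : 'M[R]_n :=
  'J (cmap c \o cinv (chart_at x)) (cmap (chart_at x) x).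
Definition tframe n (A : charted n) (c : chart A n) (x : A) : 'M[R]_n :=
  'J (cmap (chart_at x) \o cinv c) (cmap c x).

Definition smooth_vf n (A : charted n) (U : set A) (X : A -> 'rV[R]_n) : Prop :=
  forall c, atlas c -> smooth_in c U (fun x => X x *m tcoord c x).

Definition smooth_endo n (A : charted n) (N : A -> 'M[R]_n) : Prop :=
  forall c, atlas c ->
    smooth_in c setT (fun x => tframe c x *m N x *m tcoord c x).

End Manifolds.

Arguments charted R n : clear implicits.
Arguments manifold R n : clear implicits.
Arguments chart R T n : clear implicits.
Arguments atlas {R n} _.
Arguments chart_at {R n} _ _.
Arguments max_atlas {R n} _.
Arguments euclid R n : clear implicits.

(* An m-tuple of vectors is the matrix of its rows. *)
Definition alternating (R : realType) (m n : nat) (f : 'M[R]_(m, n) -> R^o) :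
    Prop :=
  (forall A i j, i != j -> row i A = row j A -> f A = 0) /\
  (forall A B C i b c,
     row i A = b *: row i B + c *: row i C ->
     row' i B = row' i A -> row' i C = row' i A ->
     f A = b * f B + c * f C).

Definition altpred (R : realType) m n : {pred 'M[R]_(m, n) -> R^o} :=
  fun f => `[< alternating f >].

Lemma altpred_submod (R : realType) m n : submod_closed (@altpred R m n).
Proof.
split=> [|a f g /asboolP[f1 f2] /asboolP[g1 g2]]; apply/asboolP; split.
- by [].
- by move=> A B C i b c *; rewrite /= !mulr0 addr0.
- move=> A i j ij Aij.
  have -> : (a *: f + g) A = a * f A + g A by [].
  by rewrite (f1 _ _ _ ij Aij) (g1 _ _ _ ij Aij) mulr0 addr0.
- move=> A B C i b c eA eB eC.
  have E M : (a *: f + g) M = a * f M + g M by [].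
  rewrite !E (f2 _ _ _ _ _ _ eA eB eC) (g2 _ _ _ _ _ _ eA eB eC).
  by rewrite !mulrDr addrACA !mulrA ![a * _]mulrC.
Qed.

HB.instance Definition _ (R : realType) m n :=
  GRing.isSubmodClosed.Build R _ (@altpred R m n) (@altpred_submod R m n).

(* The space Alt^m(R^n) of alternating m-forms on R^n. *)
Record altform (R : realType) (m n : nat) := AltForm {
  altfun :> 'M[R]_(m, n) -> R^o;
  altfunP : altfun \in @altpred R m n }.

HB.instance Definition _ (R : realType) m n :=
  [isSub for @altfun R m n].
HB.instance Definition _ (R : realType) m n :=
  [Choice of @altform R m n by <:].
HB.instance Definition _ (R : realType) m n :=
  [SubChoice_isSubLmodule of @altform R m n by <:].

Lemma alt_pull_subproof (R : realType) m n p (J : 'M[R]_(n, p))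
  (b : altform R m p) : (fun A : 'M[R]_(m, n) => b (A *m J)) \in @altpred R m n.
Proof.
have /asboolP[b1 b2] := altfunP b; apply/asboolP; split.
- by move=> A i j ij Aij; apply: (b1 _ _ _ ij); rewrite !row_mul Aij.
- move=> A B C i x y eA eB eC; apply: (b2 _ _ _ i).
  + by rewrite !row_mul eA mulmxDl -!scalemxAl.
  + apply/matrixP=> s t; rewrite !mxE; apply: eq_bigr => q _.
    by have /matrixP/(_ s q) := eB; rewrite !mxE => ->.
  + apply/matrixP=> s t; rewrite !mxE; apply: eq_bigr => q _.
    by have /matrixP/(_ s q) := eC; rewrite !mxE => ->.
Qed.

(* Pullback of an alternating form by the linear map v |-> v *m J. *)
Definition alt_pull (R : realType) m n p (J : 'M[R]_(n, p))
    (b : altform R m p) : altform R m n :=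
  AltForm (alt_pull_subproof J b).

(* Lambda^m(R^n), as the dual of Alt^m(R^n): by the universal property of the
   exterior power, Alt^m(V) is the dual of Lambda^m V, hence Lambda^m V is the
   dual of Alt^m(V) when V is finite-dimensional.  The full contraction i(w)b of
   an m-form b is then the evaluation w b, and v_1 /\ ... /\ v_m is the
   evaluation at (v_1, ..., v_m). *)
Definition mvector (R : realType) (m n : nat) : Type :=
  {linear altform R m n -> R^o}.

Section Bundles.
Context {R : realType}.

Definition smooth_mv m n (A : charted R n) (X : A -> mvector R m n) : Prop :=
  forall c, atlas A c -> forall b : altform R m n,
    smooth_in c setT (fun x => X x (alt_pull (tcoord c x) b)).

Definition smooth_form m n (A : charted R n) (b : A -> altform R m n) : Prop :=
  forall c, atlas A c -> forall V : 'M[R]_(m, n),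
    smooth_in c setT (fun x => b x (V *m tframe c x)).

Definition nonvanishing m n (A : charted R n) (X : A -> mvector R m n) : Prop :=
  forall x, exists b, X x b != 0.

(* Distributions are given pointwise by matrices, of which only the row space
   matters. *)
Definition distribution n (A : charted R n) := A -> 'M[R]_n.

Definition eq_dist n (A : charted R n) (D D' : distribution A) : Prop :=
  forall x, (D x == D' x)%MS.

(* w lies in (the image in Lambda^m R^n of) Lambda^m D, which is spanned by the
   v_1 /\ ... /\ v_m with v_i in D. *)
Definition in_exterior m n (D : 'M[R]_n) (w : mvector R m n) : Prop :=
  exists N (a : 'I_N -> R) (V : 'I_N -> 'M[R]_(m, n)),
    (forall j, (V j <= D)%MS) /\
    (forall b : altform R m n, w b = \sum_(j < N) a j * b (V j)).

(* For a distribution of rank m. *)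
Definition orientable m n (A : charted R n) (D : distribution A) : Prop :=
  exists X : A -> mvector R m n,
    [/\ smooth_mv X, nonvanishing X & forall x, in_exterior (D x) (X x)].

(* For a distribution of rank m: through every point passes an integral
   manifold, given by a parametrization j by an open subset of R^m (the equality
   of ranks makes j an immersion). *)
Definition integrable_dist m n (A : charted R n) (D : distribution A) : Prop :=
  forall y : A, exists (V : set (euclid R m)) (j : euclid R m -> A),
    [/\ open V, {in V &, injective j}, smooth_map V j,
        (exists2 z, V z & j z = y) &
        (forall z, V z -> (tangent j z == D (j z))%MS)].

(* X = X_1 /\ ... /\ X_m on U. *)
Definition decomposition m n (A : charted R n) (X : A -> mvector R m n)
    (U : set A) (Y : 'I_m -> A -> 'rV[R]_n) : Prop :=
  [/\ open U, (forall i, smooth_vf U (Y i)) &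
      (forall x, U x -> forall b, X x b = b (\matrix_(i < m) Y i x))].

Definition locally_decomposable m n (A : charted R n) (X : A -> mvector R m n) :
    Prop :=
  forall x, exists2 U : set A, U x & exists Y, decomposition X U Y.

(* D(X), for X non-vanishing and locally decomposable; the row space does not
   depend on the decomposition chosen by [xget]. *)
Definition mv_dist m n (A : charted R n) (X : A -> mvector R m n) :
    distribution A :=
  fun x => <<xget (0 : 'M[R]_(m, n))
    [set V | exists U Y,
       [/\ U x, decomposition X U Y & V = \matrix_(i < m) Y i x]]>>%MS.

Definition integrable_mv m n (A : charted R n) (X : A -> mvector R m n) : Prop :=
  integrable_dist m (mv_dist X).

Definition mv_equiv m n (A : charted R n) (X X' : A -> mvector R m n) : Prop :=
  [/\ nonvanishing X, nonvanishing X' &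
      exists f : A -> R^o,
        [/\ smooth_fun setT f, (forall x, f x != 0) &
            (forall x b, X' x b = f x * X x b)]].

Section FiberBundle.
Context {m k : nat} (M : manifold R m) (E : manifold R (m + k)).

Definition fiber_bundle (F : manifold R k) (pr : E -> M) : Prop :=
  [/\ smooth_map setT pr, set_surj setT setT pr &
    forall x0 : M, exists (U : set M) (t : E -> F) (s : M * F -> E),
      [/\ open U /\ U x0,
          smooth_map (pr @^-1` U) t,
          @smooth_map R _ _ (prod_charted M F) E (U `*` setT) s,
          (forall y, U (pr y) -> s (pr y, t y) = y) &
          (forall x f, U x -> pr (s (x, f)) = x /\ t (s (x, f)) = f)]].

Variable pr : E -> M.

Record local_section := LocalSection {
  sdom : set M;
  smap :> M -> E;
  sdom_open : open sdom;
  smap_smooth : smooth_map sdom smap;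
  smapK : forall x, sdom x -> pr (smap x) = x }.

Definition same_jet (x : M) (phi psi : local_section) : Prop :=
  [/\ sdom phi x, sdom psi x, phi x = psi x & tangent phi x = tangent psi x].

(* The total space J^1 pr: a base point and a class of local sections. *)
Record jet1 := Jet1 {
  jsource : M;
  jclass : set local_section;
  jclassP : exists2 phi : local_section,
    sdom phi jsource & jclass = same_jet jsource phi }.

Definition jet_of (phi : local_section) (x : M) (hx : sdom phi x) : jet1 :=
  @Jet1 x (same_jet x phi) (ex_intro2 _ _ phi hx erefl).

Definition jrep (j : jet1) : local_section := projT1 (cid2 (jclassP j)).

(* The projection pr^1 : J^1 pr -> E. *)
Definition jtarget (j : jet1) : E := jrep j (jsource j).

Definition adapted (c : chart R E (m + k)) (d : chart R M m) : Prop :=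
  [/\ max_atlas E c, max_atlas M d &
      forall y, cdom c y -> cdom d (pr y) /\ lsubmx (cmap c y) = cmap d (pr y)].

(* The derivative coordinates y^A_i of the jet j in the chart (x^i, y^A, y^A_i)
   of J^1 pr induced by the adapted charts c = (x^i, y^A) and d = (x^i). *)
Definition jet_coord (c : chart R E (m + k)) (d : chart R M m) (j : jet1) :
    'M[R]_(m, k) :=
  rsubmx ('J (cmap c \o jrep j \o cinv d) (cmap d (jsource j))).

(* A smooth global section of pr^1.  Over the domain of c the coordinates x^i
   and y^A of Psi are those of the identity, so only y^A_i has to be tested. *)
Definition jet_field (Psi : E -> jet1) : Prop :=
  (forall y, jtarget (Psi y) = y) /\
  (forall c d, adapted c d -> smooth_in c setT (fun y => jet_coord c d (Psi y))).

Definition jet_dist (Psi : E -> jet1) : distribution E :=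
  fun y => <<tangent (jrep (Psi y)) (pr y)>>%MS.

Definition orientable_jet_field (Psi : E -> jet1) : Prop :=
  jet_field Psi /\ orientable m (jet_dist Psi).

Definition integrable_jet_field (Psi : E -> jet1) : Prop :=
  forall y, exists phi : local_section,
    [/\ sdom phi (pr y), phi (pr y) = y &
        forall x (hx : sdom phi x), Psi (phi x) = jet_of hx].

(* An Ehresmann connection as a smooth field of projections of TE (acting on
   row vectors) whose kernel is the vertical bundle. *)
Definition ehresmann_connection (N : E -> 'M[R]_(m + k)) : Prop :=
  [/\ smooth_endo N, (forall y, N y *m N y = N y) &
      (forall y, (kermx (N y) == kermx (tangent pr y))%MS)].

Definition orientable_connection (N : E -> 'M[R]_(m + k)) : Prop :=
  ehresmann_connection N /\ orientable m (N : distribution E).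

(* The projection onto D(Psi) along the vertical bundle. *)
Definition connection_of (Psi : E -> jet1) : E -> 'M[R]_(m + k) :=
  fun y => proj_mx (jet_dist Psi y) (kermx (tangent pr y)).

Definition transverse (X : E -> mvector R m (m + k)) : Prop :=
  forall (y : E) (b : M -> altform R m m),
    smooth_form b -> b (pr y) != 0 ->
    X y (alt_pull (tangent pr y) (b (pr y))) != 0.

(* Locally decomposable, transverse m-multivector fields. *)
Definition ldt_field (X : E -> mvector R m (m + k)) : Prop :=
  [/\ smooth_mv X, locally_decomposable X & transverse X].

Definition mv_class (X : E -> mvector R m (m + k)) :
    set (E -> mvector R m (m + k)) :=
  [set X' | ldt_field X' /\ mv_equiv X X'].

End FiberBundle.
End Bundles.

(* Main.v *)
Require Import Defs.
From HB Require Import structures.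
From mathcomp Require Import all_boot all_order all_algebra.
From mathcomp Require Import fingroup perm boolp classical_sets functions reals.
From mathcomp Require Import interval_inference topology normedtype derive.
From mathcomp Require Import landau sequences realfun exp.
From mathcomp Require Import ring lra.
Set Implicit Arguments.
Unset Strict Implicit.
Unset Printing Implicit Defensive.
Import Order.TTheory GRing.Theory Num.Theory.
Import numFieldNormedType.Exports.
Local Open Scope classical_set_scope.
Local Open Scope ring_scope.

(** Jet fields, connections and classes of transverse multivector fields are three
    encodings of the same object: a smooth distribution [D] on [E] that is
    complementary to the vertical bundle. In adapted charts [(x, u)], where the
    projection is [(x, u) |-> x], such a distribution has a unique basis of the
    form [d/dx_i + sum_a S_ia d/du_a], that is, it is the row space of
    [hor S = (1 | S)] for a smooth matrix [S]; this is [horizontal].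

    - A jet field with values [Psi y] has the derivative coordinates of [Psi] as
      matrix [S] ([jet_field_horizontal]). Conversely, given [D], the value at [y]
      is the jet of the section which is affine with slope [S y] in the charts
      ([horizontal_jet_field]). A jet is recovered from the span of its tangent,
      because this tangent is a right inverse of the derivative of the projection
      ([jet_ext]).

    - A connection is the projection onto [D] along the vertical bundle; in
      adapted charts it is the block matrix with rows [(1 | S)] and [0]
      ([horizontal_connection], [connection_horizontal]).

    - A decomposable multivector [X_1 /\ ... /\ X_m] determines the span of the
      [X_i], and it is determined by this span up to a factor: the forms
      [V |-> det (V P)] tell apart any two spaces of dimension [m]
      ([alt_separate]), and [b (B V) = det B * b V] for every alternating form [b]
      ([alt_mulmx]). Transversality says that the pulled back forms do not vanish,
      i.e. that the span is complementary to the vertical bundle; since only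
      global forms are tested, bump functions are needed ([bump_form]). If the
      [X_i] have matrix [(A | B)] in adapted charts, then [S = A^-1 B]
      ([ldt_horizontal]).

    A transverse multivector field is itself an orientation of its distribution.
    Conversely an orientation of [D] is a non-vanishing multiple of the exterior
    product of any local frame of [D], hence is locally decomposable
    ([orientable_ldt]). Two transverse decomposable fields are equivalent if and
    only if they have the same distribution ([ldt_equiv]). So the correspondence
    sends [Psi] to the set of all fields [X] with the same distribution.

    Integrability of [X] is by definition that of its distribution. An integral
    section of [Psi], read in a chart of [M], is an integral manifold. Conversely,
    an integral manifold projects to [M] with invertible derivative, and composing
    it with a local inverse of this projection gives an integral section
    ([jet_integrable]).

    The first parts develop what this uses of calculus in several variables, with
    smoothness defined by iterated partial derivatives: the chain rule, smooth
    bump functions and the inverse function theorem. *)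

(** * Functions of class C^r on open subsets of R^n *)

Lemma near_eq_continuous (T S : topologicalType) (f g : T -> S) x :
  {near x, f =1 g} -> {for x, continuous f} -> {for x, continuous g}.
Proof.
move=> fg cf; rewrite /prop_for /continuous_at -(nbhs_singleton fg).
exact: cvg_trans (near_eq_cvg fg) cf.
Qed.

Section ClassC.
Context {R : realType} {n : nat}.
Implicit Types (W : normedModType R) (U V : set 'rV[R]_n) (r : nat).

Lemma open_near (T : topologicalType) (U : set T) x :
  open U -> U x -> \forall y \near x, U y.
Proof. by move=> oU Ux; exact: open_nbhs_nbhs. Qed.

Lemma class_C_eq W r U (f g : 'rV[R]_n -> W) :
  open U -> (forall x, U x -> f x = g x) -> class_C r U f -> class_C r U g.
Proof.
move=> oU; elim: r f g => [|r IH] f g fg /= [cf Hf].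
  split=> // x Ux; apply: (near_eq_continuous _ (cf x Ux)).
  by apply: filterS (open_near oU Ux).
have nfg x : U x -> {near x, f =1 g}.
  by move=> Ux; apply: filterS (open_near oU Ux).
split=> [x Ux|i]; first exact: near_eq_continuous (nfg x Ux) (cf x Ux).
have [df Cf] := Hf i; split=> [x Ux|].
  exact: near_eq_derivable (nfg x Ux) (df x Ux).
apply: IH Cf => x Ux; apply: near_eq_derive; exact: nfg.
Qed.

Lemma class_C_sub W r U V (f : 'rV[R]_n -> W) :
  V `<=` U -> class_C r U f -> class_C r V f.
Proof.
move=> VU; elim: r f => [|r IH] f /= [cf Hf]; split=> //; first by move=> x /VU /cf.
  by move=> x /VU /cf.
by move=> i; have [df Cf] := Hf i; split; [move=> x /VU /df | exact: IH].
Qed.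

(** [class_C] only constrains [f], its partial derivatives and so on at the points
    of [U], so it can be checked point by point; hence it is a local property. *)
Lemma class_C_pt W r U (f : 'rV[R]_n -> W) :
  (forall x, U x -> class_C r [set x] f) -> class_C r U f.
Proof.
elim: r f => [|r IH] f H /=; split=> //; first by move=> x Ux; exact: (H x Ux).1.
  by move=> x Ux; exact: (H x Ux).1.
move=> i; split=> [x Ux|]; first exact: ((H x Ux).2 i).1.
by apply: IH => x Ux; exact: ((H x Ux).2 i).2.
Qed.

Lemma class_C_local W r U (f : 'rV[R]_n -> W) :
  (forall x, U x -> exists2 V, V x & class_C r V f) -> class_C r U f.
Proof.
move=> H; apply: class_C_pt => x /H[V Vx]; apply: class_C_sub.
by move=> _ ->.
Qed.

Lemma class_CW W r U (f : 'rV[R]_n -> W) : class_C r.+1 U f -> class_C r U f.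
Proof.
elim: r f => [|r IH] f /= [cf Hf]; split=> // i.
by have [df Cf] := Hf i; split=> //; exact: IH.
Qed.

Lemma class_C_le W r s U (f : 'rV[R]_n -> W) :
  (r <= s)%N -> class_C s U f -> class_C r U f.
Proof.
move=> /subnKC <-; elim: (s - r)%N => [|k IH]; first by rewrite addn0.
by rewrite addnS => /class_CW.
Qed.

Lemma class_C_continuous W r U (f : 'rV[R]_n -> W) x :
  class_C r U f -> U x -> {for x, continuous f}.
Proof. by case: r => [|r] [cf _] /cf. Qed.

Lemma class_C_cst W r U (a : W) : class_C r U (cst a).
Proof.
elim: r a => [|r IH] a /=; split=> //; try by move=> x _; exact: cst_continuous.
move=> i; split=> [x _|]; first exact: derivable_cst.
rewrite (_ : (fun x => _) = cst 0) //.
by apply/funext => x; rewrite derive_cst.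
Qed.

Lemma class_C_add W r U (f g : 'rV[R]_n -> W) : open U ->
  class_C r U f -> class_C r U g -> class_C r U (fun x => f x + g x).
Proof.
move=> oU; elim: r f g => [|r IH] f g /= [cf Hf] [cg Hg]; split=> //.
- by move=> x Ux; apply: continuousD; [exact: cf|exact: cg].
- by move=> x Ux; apply: continuousD; [exact: cf|exact: cg].
move=> i; have [df Cf] := Hf i; have [dg Cg] := Hg i; split=> [x Ux|].
  by apply: derivableD; [exact: df|exact: dg].
apply: class_C_eq (IH _ _ Cf Cg) => // x Ux.
by rewrite -deriveD; [|exact: df|exact: dg].
Qed.

Implicit Types f g : 'rV[R]_n -> R^o.

Lemma class_C_mul r U f g : open U ->
  class_C r U f -> class_C r U g -> class_C r U (fun x => f x * g x : R^o).
Proof.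
move=> oU; elim: r f g => [|r IH] f g Cf Cg /=.
all: have [cf Hf] := Cf; have [cg Hg] := Cg; split=> //.
- by move=> x Ux; apply: (@continuousM R _ f g); [exact: cf|exact: cg].
- by move=> x Ux; apply: (@continuousM R _ f g); [exact: cf|exact: cg].
move=> i; have [df Df] := Hf i; have [dg Dg] := Hg i; split=> [x Ux|].
  by apply: (@derivableM R _ f g); [exact: df|exact: dg].
have := class_C_add oU (IH _ _ (class_CW Cf) Dg) (IH _ _ (class_CW Cg) Df).
apply: class_C_eq => // x Ux.
by rewrite (@deriveM R _ f g); [|exact: df|exact: dg].
Qed.

Lemma class_C_inv r U f : open U -> (forall x, U x -> f x != 0) ->
  class_C r U f -> class_C r U (fun x => (f x)^-1 : R^o).
Proof.
move=> oU f0; elim: r => [|r IH] Cf /=; have [cf Hf] := Cf; split=> //.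
- by move=> x Ux; apply: (@continuousV R _ f); [exact: f0|exact: cf].
- by move=> x Ux; apply: (@continuousV R _ f); [exact: f0|exact: cf].
move=> i; have [df Df] := Hf i; split=> [x Ux|].
  by apply: (@derivableV R _ f); [exact: f0|exact: df].
have CV := IH (class_CW Cf).
have := class_C_mul oU (class_C_mul oU (class_C_cst r U (-1 : R^o)) Df)
  (class_C_mul oU CV CV).
apply: class_C_eq => // x Ux.
rewrite (@deriveV R _ f); [|exact: f0|exact: df].
rewrite /cst /= mulN1r mulNr /GRing.scale /= mulNr mulrC; congr (- (_ * _)).
by rewrite expr2 invfM.
Qed.

Lemma class_C_sum (I : Type) (s : seq I) (P : pred I) (f : I -> 'rV[R]_n -> R^o) r U :
  open U -> (forall i, class_C r U (f i)) ->
  class_C r U (fun x => \sum_(i <- s | P i) f i x).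
Proof.
move=> oU Cf; elim: s => [|i s IH].
  by under eq_fun do rewrite big_nil; exact: class_C_cst.
under eq_fun do rewrite big_cons.
by case: (P i) => //; apply: class_C_add.
Qed.

Lemma class_C_coord r U j : class_C r U (fun x => x 0 j : R^o).
Proof.
have D (x v : 'rV[R]_n) : is_derive x v (fun x : 'rV[R]_n => x 0 j : R^o) (v 0 j).
  have dx : differentiable (fun x : 'rV[R]_n => x 0 j : R^o) x.
    exact: differentiable_coord.
  apply: DeriveDef; first exact: diff_derivable.
  have := derive_mx (@derivable_id R _ x v).
  by rewrite derive_id => /matrixP/(_ 0 j); rewrite mxE => ->.
case: r => [|r] /=; split=> //; try by move=> x _; exact: coord_continuous.
move=> i; split=> [x _|]; first by have [] := D x (delta_mx 0 i).
rewrite (_ : (fun x => _) = cst ((delta_mx 0 i : 'rV[R]_n) 0 j)).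
  exact: class_C_cst.
by apply/funext => x; have [_ ->] := D x (delta_mx 0 i).
Qed.

End ClassC.

Lemma continuous_mx (R : realType) (T : topologicalType) p q
    (f : T -> 'M[R]_(p, q)) x :
  {for x, continuous f} <->
  forall i j, {for x, continuous (fun y => f y i j : R^o)}.
Proof.
split=> [cf i j|cf].
  apply: (@continuous_comp _ _ _ f (fun M : 'M[R]_(p, q) => M i j)) => //.
  exact: coord_continuous.
apply/cvgrPdist_lt => e e0.
have H : \forall y \near x, forall ij : 'I_p * 'I_q,
    `|f x ij.1 ij.2 - f y ij.1 ij.2| < e.
  apply: filter_forall => -[i j] /=.
  by have /cvgrPdist_lt/(_ _ e0) := cf i j.
apply: filterS H => y H.
rewrite [ltLHS]/Num.Def.normr /= mx_normrE; apply/bigmax_ltP; split=> // ij _.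
by rewrite !mxE; exact: H.
Qed.

(** Limits of matrices are taken entrywise. This reduces all maps below to
    scalar ones. *)
Lemma class_C_mx (R : realType) n p q r (U : set 'rV[R]_n)
    (f : 'rV[R]_n -> 'M[R]_(p, q)) : open U ->
  class_C r U f <-> forall i j, class_C r U (fun x => f x i j : R^o).
Proof.
move=> oU; elim: r f => [|r IH] f; split=> /=.
- by move=> [cf _] i j; split=> // x /cf /continuous_mx.
- by move=> cf; split=> // x Ux; apply/continuous_mx => i j; exact: (cf i j).1.
- move=> [cf Hf] i j; split=> [x /cf /continuous_mx //|a].
  have [df Df] := Hf a; split=> [x /df /derivable_mxP //|].
  apply: class_C_eq (((IH _).1 Df) i j) => // x Ux.
  by rewrite derive_mx ?mxE //; exact: df.
- move=> Hf; split=> [x Ux|a].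
    by apply/continuous_mx => i j; exact: (Hf i j).1.
  have df x : U x -> derivable f x (delta_mx 0 a).
    by move=> Ux; apply/derivable_mxP => i j; exact: ((Hf i j).2 a).1.
  split=> //; apply/IH => i j; apply: class_C_eq ((Hf i j).2 a).2 => // x Ux.
  by rewrite derive_mx ?mxE //; exact: df.
Qed.

(** * The chain rule *)

Lemma mx_norm_coord (R : realType) p q (A : 'M[R]_(p, q)) i j : `|A i j| <= `|A|.
Proof.
rewrite [leRHS]/Num.Def.normr /= mx_normrE.
exact: (le_bigmax _ (fun ij => `|A ij.1 ij.2|) (i, j)).
Qed.

Lemma mx_norm_le (R : realType) p q (A : 'M[R]_(p, q)) e :
  0 <= e -> (forall i j, `|A i j| <= e) -> `|A| <= e.
Proof.
move=> e0 Ae; rewrite [leLHS]/Num.Def.normr /= mx_normrE.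
by apply: bigmax_le => // ij _; exact: Ae.
Qed.

Lemma mx_norm_lt (R : realType) p q (A : 'M[R]_(p, q)) e :
  0 < e -> (forall i j, `|A i j| < e) -> `|A| < e.
Proof.
move=> e0 Ae; rewrite [ltLHS]/Num.Def.normr /= mx_normrE.
by apply/bigmax_ltP; split => // ij _; exact: Ae.
Qed.

Section Lipschitz.
Context {R : realType} {n : nat}.
Implicit Types (h f g : 'rV[R]_n -> R^o) (c x y : 'rV[R]_n).

Lemma derivable_line h x v t :
  derivable h (x + t *: v) v ->
  @is_derive R R^o R^o t 1 (fun s : R => h (x + s *: v)) ('D_v h (x + t *: v)).
Proof.
move=> dh.
have E : (fun s : R => s^-1 *:
      (((fun s : R => h (x + s *: v) : R^o) \o shift t) (s *: 1) - h (x + t *: v))) =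
    (fun s => s^-1 *: ((h \o shift (x + t *: v)) (s *: v) - h (x + t *: v))).
  apply/funext => s /=; congr (_ *: (h _ - _)).
  by rewrite [s%:A]mulr1 scalerDl addrCA.
by apply: DeriveDef; rewrite /derivable /derive E.
Qed.

(** The mean value theorem along a line. *)
Lemma lipschitz_line h x v a (e : R) :
  (forall t, 0 <= t <= a \/ a <= t <= 0 -> derivable h (x + t *: v) v /\
     `|'D_v h (x + t *: v)| <= e) ->
  `|h (x + a *: v) - h x| <= e * `|a|.
Proof.
move=> H.
pose phi (s : R) : R^o := h (x + s *: v).
have main (u w : R) : u <= w ->
    (forall t, u <= t <= w -> 0 <= t <= a \/ a <= t <= 0) ->
    `|phi w - phi u| <= e * (w - u).
  move=> uw tw.
  have D (t : R) : u <= t <= w -> @is_derive R R^o R^o t 1 phi ('D_v h (x + t *: v)).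
    by move=> /tw/H[dh _]; exact: derivable_line.
  have [||t tin ->] := @MVT_segment R phi (fun t => 'D_v h (x + t *: v)) u w uw.
  - by move=> t; rewrite in_itv /= => /andP[/ltW ut /ltW tw']; apply/D/andP.
  - apply: continuous_in_subspaceT => t; rewrite inE /= in_itv /= => /D[dt _].
    exact/differentiable_continuous/derivable1_diffP.
  - have := tin; rewrite in_itv /= => /tw/H[_ te].
    by rewrite normrM (ger0_norm (_ : 0 <= w - u)) ?subr_ge0// ler_wpM2r ?subr_ge0.
have phi0 : phi 0 = h x by rewrite /phi scale0r addr0.
rewrite -[h (_ + _)]/(phi a) -phi0.
have [a0|a0] := leP 0 a.
  have := main 0 a a0; rewrite subr0 (ger0_norm a0).
  by apply => t ?; left.
have := main a 0 (ltW a0); rewrite sub0r distrC (ltr0_norm a0).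
by apply => t ?; right.
Qed.

(** Moving one coordinate at a time stays inside a ball, because balls are
    cubes for the maximum norm. *)
Lemma lipschitz_ball h c (r e : R) x y :
  (forall u, ball c r u -> forall i : 'I_n,
     derivable h u (delta_mx 0 i) /\ `|'D_(delta_mx 0 i) h u| <= e) ->
  ball c r x -> ball c r y -> `|h y - h x| <= n%:R * e * `|y - x|.
Proof.
move=> H cx cy.
have r0 : 0 < r by rewrite -ball_normE in cx; exact: le_lt_trans cx.
have inball u : ball c r u <-> forall j, `|c 0 j - u 0 j| < r.
  rewrite -ball_normE /ball_ /=; split=> [cu j|cu].
    by have := mx_norm_coord (c - u) 0 j; rewrite !mxE => /le_lt_trans; apply.
  by apply: mx_norm_lt => // i j; rewrite !mxE (ord1 i).
pose z (k : nat) : 'rV[R]_n := \row_j (if (j < k)%N then y 0 j else x 0 j).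
have z0 : z 0%N = x by apply/rowP => j; rewrite mxE.
have zn : z n = y by apply/rowP => j; rewrite mxE ltn_ord.
have zS (k : 'I_n) : z k.+1 = z k + (y 0 k - x 0 k) *: delta_mx 0 k.
  apply/rowP => j; rewrite !mxE eqxx /= ltnS leq_eqVlt.
  have [->|jk] := eqVneq j k; first by rewrite ltnn eqxx mulr1 addrC subrK.
  by rewrite (inj_eq val_inj) (negPf jk) /= mulr0 addr0.
rewrite -zn -z0 -(telescope_sumr (fun k => h (z k))) // big_mkord.
apply: (le_trans (ler_norm_sum _ _ _)).
have -> : n%:R * e * `|z n - z 0%N| = \sum_(k < n) e * `|z n - z 0%N|.
  by rewrite sumr_const card_ord -mulrA mulr_natl.
apply: ler_sum => k _.
have -> : h (z k.+1) - h (z k) =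
    h (z k + (y 0 k - x 0 k) *: delta_mx 0 k) - h (z k) by rewrite zS.
have e0 : 0 <= e by have [_] := H x cx k; apply: le_trans.
have yxk : `|y 0 k - x 0 k| <= `|z n - z 0%N|.
  by rewrite zn z0; have := mx_norm_coord (y - x) 0 k; rewrite !mxE.
apply: le_trans (ler_wpM2l e0 yxk).
have X := (inball x).1 cx; have Y := (inball y).1 cy.
apply: lipschitz_line => t ta; apply: H; apply/inball => j; rewrite !mxE eqxx /=.
have [->|jk] := eqVneq j k; last first.
  by rewrite mulr0 addr0; case: ifP.
rewrite ltnn mulr1; move: (X k) (Y k); rewrite !ltr_norml => /andP[X1 X2] /andP[Y1 Y2].
by apply/andP; case: ta => /andP[t1 t2]; split; lra.
Qed.

(** The only candidate for the differential, built from the partial derivatives. *)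
Definition grad h x (v : 'rV[R]_n) : R^o := \sum_(i < n) v 0 i * 'D_(delta_mx 0 i) h x.

Lemma grad_linear h x : linear (grad h x).
Proof.
move=> a u v; rewrite /grad scaler_sumr -big_split; apply: eq_bigr => i _ /=.
by rewrite !mxE mulrDl -mulrA.
Qed.

Lemma grad_class_C h x r U : open U -> class_C r U (grad h x).
Proof.
move=> oU; apply: class_C_sum => // i; apply: class_C_mul => //.
  exact: class_C_coord.
exact: class_C_cst.
Qed.

Lemma derive_grad h x u i :
  is_derive u (delta_mx 0 i) (grad h x) ('D_(delta_mx 0 i) h x).
Proof.
have E : (fun t : R =>
    t^-1 *: ((grad h x \o shift u) (t *: delta_mx 0 i) - grad h x u)) =
    fun t : R => t^-1 * t * 'D_(delta_mx 0 i) h x.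
  apply/funext => t /=; rewrite grad_linear addrK scalerA; congr (_ * _).
  rewrite /grad (bigD1 i) //= big1 ?addr0 => [|j ji]; rewrite mxE eqxx /=.
    by rewrite eqxx mul1r.
  by rewrite (negPf ji) mul0r.
have L : t^-1 * t * 'D_(delta_mx 0 i) h x @[t --> (0 : R)^'] -->
    ('D_(delta_mx 0 i) h x : R^o).
  apply: cvg_near_cst; near=> t; rewrite mulVf ?mul1r //.
  by near: t; exact: nbhs_dnbhs_neq.
apply: DeriveDef; rewrite /derivable /derive E; last exact: cvg_lim L.
by apply/cvg_ex; eexists; exact: L.
Unshelve. all: by end_near. Qed.

(** Partial derivatives that are continuous at a point control increments
    between any two nearby points, not only increments from that point; this is
    what both differentiability and the inverse function theorem rest on. *)
Lemma strict_grad U h c (e : R) : open U -> class_C 1 U h -> U c -> 0 < e ->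
  exists2 r : R, 0 < r & ball c r `<=` U /\ forall x y, ball c r x -> ball c r y ->
    `|h y - h x - grad h c (y - x)| <= e * `|y - x|.
Proof.
move=> oU [_ Ch] Uc e0.
(* [lipschitz_ball] loses a factor [n], which may be 0. *)
pose e' := e / n.+1%:R.
have e'0 : 0 < e' by rewrite divr_gt0.
have H : \forall u \near c, forall i : 'I_n,
    `|'D_(delta_mx 0 i) h c - 'D_(delta_mx 0 i) h u| < e'.
  have K (i : 'I_n) : \forall u \near c,
      `|'D_(delta_mx 0 i) h c - 'D_(delta_mx 0 i) h u| < e'.
    have cD := (Ch i).2.1 c Uc.
    by have /cvgrPdist_lt/(_ _ e'0) := cD.
  exact: (filter_forall _ K).
have {}H := @filterI _ _ (nbhs_filter c) _ _ (open_near oU Uc) H.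
have [r /= r0 rH] := (nbhs_ballP c _).1 H.
exists r => //; split=> [u /rH[]//|x y cx cy].
(* The partial derivatives of [k] vanish at [c], hence are small nearby. *)
pose k u := h u - grad h c u.
have -> : h y - h x - grad h c (y - x) = k y - k x.
  have -> : grad h c (y - x) = grad h c y - grad h c x.
    by rewrite -scaleN1r addrC grad_linear scaleN1r addrC.
  by rewrite /k !opprD !opprK addrACA.
have ek : n%:R * e' <= e.
  rewrite /e' mulrCA ger_pMr // ler_pdivrMr // mul1r ler_nat //.
apply: le_trans (ler_wpM2r (normr_ge0 _) ek).
apply: (lipschitz_ball _ cx cy) => u cu i.
have [Uu Hu] := rH u cu.
have dh : derivable h u (delta_mx 0 i) by exact: (Ch i).1.
have [dg eg] := derive_grad h c u i.
split; first exact: (@derivableB _ _ _ h (grad h c)).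
by rewrite (@deriveB _ _ _ h (grad h c)) // eg distrC ltW.
Qed.

Lemma class_C1_diff U h x : open U -> class_C 1 U h -> U x ->
  differentiable h x /\ forall v, 'd h x v = grad h x v.
Proof.
move=> oU Ch Ux.
pose L : {linear 'rV[R]_n -> R^o} :=
  HB.pack (grad h x) (GRing.isLinear.Build R _ _ _ (grad h x) (grad_linear h x)).
have cL : continuous L.
  by move=> v; apply: (class_C_continuous (grad_class_C h x 0 openT)).
pose V : normedModType R := 'rV[R]_n; pose W : normedModType R := R^o.
have E : (h : V -> W) \o shift x = (cst (h x) : V -> W) + (L : V -> W) +o_ (0 : V) id.
  apply/eqaddoP => e e0.
  have [r r0 [_ H]] := strict_grad oU Ch Ux e0.
  have B : nbhs (0 : V) (ball (0 : V) r) by exact: nbhsx_ballx.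
  apply: filterS B => v Bv.
  have := H x (v + x); rewrite addrK -addrA -opprD; apply; first exact: ballxx.
  move: Bv; rewrite -!ball_normE /ball_ /= opprD addrCA subrr addr0.
  by rewrite sub0r.
have dL := diff_unique cL E.
split; last by move=> v; rewrite dL.
by apply/diff_locallyP; rewrite dL; split.
Qed.

End Lipschitz.

Lemma differentiable_rV (R : realType) n p (f : 'rV[R]_n -> 'rV[R]_p) x :
  (forall j, differentiable (fun y => f y 0 j : R^o) x) -> differentiable f x.
Proof.
move=> df.
have -> : f = \sum_(j < p) fun y => (f y 0 j : R) *: (delta_mx 0 j : 'rV[R]_p).
  by apply/funext => y; rewrite fct_sumE; exact: row_sum_delta.
apply: differentiable_sum => j; exact: (differentiableZl _ (df j)).
Qed.

Lemma class_C1_diff_rV (R : realType) n p (U : set 'rV[R]_n)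
    (f : 'rV[R]_n -> 'rV[R]_p) x :
  open U -> class_C 1 U f -> U x -> differentiable f x.
Proof.
move=> oU /(class_C_mx _ _ oU) Cf Ux; apply: differentiable_rV => j.
by case: (class_C1_diff oU (Cf 0 j) Ux).
Qed.

(** By the chain rule the partial derivatives of [g \o f] are sums of products
    of those of [f] with those of [g] composed with [f], to which the induction
    hypothesis applies. *)
Lemma class_C_comp (R : realType) n p r (U : set 'rV[R]_n) (V : set 'rV[R]_p)
    (f : 'rV[R]_n -> 'rV[R]_p) (g : 'rV[R]_p -> R^o) :
  open U -> open V -> (forall x, U x -> V (f x)) ->
  class_C r U f -> class_C r V g -> class_C r U (g \o f).
Proof.
move=> oU oV UV; elim: r g => [|r IH] g Cf Cg.
all: have cgf x : U x -> {for x, continuous (g \o f)} by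
  move=> Ux; apply: continuous_comp;
  [exact: class_C_continuous Cf _|exact: class_C_continuous Cg (UV _ Ux)].
  by split.
split=> // i.
have E x : U x -> is_derive x (delta_mx 0 i) (g \o f)
    (grad g (f x) ('D_(delta_mx 0 i) f x)).
  move=> Ux.
  have df : differentiable f x by apply: class_C1_diff_rV (class_C_le _ Cf) Ux.
  have [dg eg] : differentiable g (f x) /\ forall v, 'd g (f x) v = grad g (f x) v.
    by apply: class_C1_diff (class_C_le _ Cg) (UV _ Ux).
  have dgf := differentiable_comp df dg.
  apply: DeriveDef; first exact: diff_derivable.
  by rewrite deriveE // diff_comp //= eg deriveE.
split=> [x Ux|]; first by have [] := E x Ux.
apply: (@class_C_eq _ _ _ _ _ (fun x =>
    \sum_(j < p) ('D_(delta_mx 0 i) f x) 0 j * 'D_(delta_mx 0 j) g (f x))) => //.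
  by move=> x Ux; have [_ ->] := E x Ux.
apply: class_C_sum => // j; apply: class_C_mul => //.
  by have /(class_C_mx _ _ oU) := (Cf.2 i).2; apply.
apply: (IH (fun y => 'D_(delta_mx 0 j) g y)); first exact: class_CW.
exact: (Cg.2 j).2.
Qed.

(** * Smooth germs *)

Lemma near_open (T : topologicalType) (P : set T) x :
  (\forall y \near x, P y) -> exists V, [/\ open V, V x & forall y, V y -> P y].
Proof. by rewrite /prop_near1 nbhsE => -[V [oV Vx] VP]; exists V. Qed.

Lemma near_and (T : topologicalType) (P Q : set T) (x : T) :
  (\forall y \near x, P y) -> (\forall y \near x, Q y) ->
  \forall y \near x, P y /\ Q y.
Proof. by move=> HP HQ; exact: filterI. Qed.

Lemma near_sub (T : topologicalType) (P Q : set T) (x : T) :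
  (\forall y \near x, P y) -> (forall y, P y -> Q y) -> \forall y \near x, Q y.
Proof. by move=> HP PQ; exact: filterS HP. Qed.

Section SmoothAt.
Context {R : realType}.

(** Smoothness of the germ at [x]: this form needs no bookkeeping of domains when
    functions are combined or charts are changed. *)
Definition smooth_at n (W : normedModType R) (x : 'rV[R]_n) (f : 'rV[R]_n -> W) :=
  exists U, [/\ open U, U x & smooth U f].

Lemma smooth_smooth_at n (W : normedModType R) U (f : 'rV[R]_n -> W) x :
  open U -> smooth U f -> U x -> smooth_at x f.
Proof. by exists U. Qed.

Lemma smooth_at_smooth n (W : normedModType R) (U : set 'rV[R]_n) (f : 'rV[R]_n -> W) :
  (forall x, U x -> smooth_at x f) -> smooth U f.
Proof.
move=> H r; apply: class_C_local => x /H[V [_ Vx sV]].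
by exists V => //; exact: sV.
Qed.

Lemma smooth_at_eq n (W : normedModType R) x (f g : 'rV[R]_n -> W) :
  {near x, f =1 g} -> smooth_at x f -> smooth_at x g.
Proof.
move=> /near_open[V [oV Vx Vfg]] [U [oU Ux sU]].
have oUV : open (U `&` V) by exact: openI.
exists (U `&` V); split=> // r; apply: (@class_C_eq _ _ _ _ _ f) => // [y [_ /Vfg]//|].
by apply: class_C_sub (sU r) => y [].
Qed.

Lemma smooth_at_near n (W : normedModType R) x (f : 'rV[R]_n -> W) :
  smooth_at x f -> \forall y \near x, smooth_at y f.
Proof.
by case=> U [oU Ux sU]; apply: filterS (open_near oU Ux) => y Uy; exists U.
Qed.

Lemma smooth_at_continuous n (W : normedModType R) x (f : 'rV[R]_n -> W) :
  smooth_at x f -> {for x, continuous f}.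
Proof. by case=> U [oU Ux /(_ 0%N)[]] => /(_ x Ux). Qed.

Lemma smooth_at_cst n (W : normedModType R) (x : 'rV[R]_n) (a : W) :
  smooth_at x (fun _ => a).
Proof. by exists setT; split=> // [|r]; [exact: openT|exact: class_C_cst]. Qed.

Lemma smooth_at_mx n p q (x : 'rV[R]_n) (f : 'rV[R]_n -> 'M[R]_(p, q)) :
  smooth_at x f <-> forall i j, smooth_at x (fun y => f y i j : R^o).
Proof.
split=> [[U [oU Ux sU]] i j|H].
  by exists U; split=> // r; have /(class_C_mx _ _ oU) := sU r; apply.
pose V i j := projT1 (cid (H i j)).
have VP i j := projT2 (cid (H i j)).
exists (interior [set y | forall i j, V i j y]); split; first exact: open_interior.
  suff : \forall y \near x, forall ij : 'I_p * 'I_q, V ij.1 ij.2 y.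
    by move=> /filterS; apply => y Hy i j; exact: (Hy (i, j)).
  have K (ij : 'I_p * 'I_q) : \forall y \near x, V ij.1 ij.2 y.
    by have [oV Vx _] := VP ij.1 ij.2; exact: open_near.
  exact: (filter_forall _ K).
move=> r; apply/class_C_mx; first exact: open_interior.
move=> i j; have [_ _ /(_ r)] := VP i j; apply: class_C_sub => y /interior_subset.
exact.
Qed.

Section Scalar.
Context {n : nat} (x : 'rV[R]_n).
Implicit Types f g : 'rV[R]_n -> R^o.

Lemma smooth_at_add f g :
  smooth_at x f -> smooth_at x g -> smooth_at x (fun y => f y + g y : R^o).
Proof.
move=> [U [oU Ux sU]] [V [oV Vx sV]]; have oUV := openI oU oV.
exists (U `&` V); split=> // r; apply: class_C_add => //.
  by apply: class_C_sub (sU r) => y [].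
by apply: class_C_sub (sV r) => y [].
Qed.

Lemma smooth_at_mul f g :
  smooth_at x f -> smooth_at x g -> smooth_at x (fun y => f y * g y : R^o).
Proof.
move=> [U [oU Ux sU]] [V [oV Vx sV]]; have oUV := openI oU oV.
exists (U `&` V); split=> // r; apply: class_C_mul => //.
  by apply: class_C_sub (sU r) => y [].
by apply: class_C_sub (sV r) => y [].
Qed.

Lemma smooth_at_inv f : f x != 0 ->
  smooth_at x f -> smooth_at x (fun y => (f y)^-1 : R^o).
Proof.
move=> fx0 sf; have cf := smooth_at_continuous sf.
have : \forall y \near x, f y != 0.
  by apply: (cf [set z | z != 0]); exact: (open_near (@open_neq R 0) fx0).
move=> /near_open[V [oV Vx Vf]].
have [U [oU Ux sU]] := sf; have oUV := openI oU oV.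
exists (U `&` V); split=> // r; apply: class_C_inv => // [y [_ /Vf]//|].
by apply: class_C_sub (sU r) => y [].
Qed.

Lemma smooth_at_sum (I : Type) (s : seq I) (P : pred I) (f : I -> 'rV[R]_n -> R^o) :
  (forall i, smooth_at x (f i)) ->
  smooth_at x (fun y => \sum_(i <- s | P i) f i y : R^o).
Proof.
move=> sf; elim: s => [|i s IH].
  by under eq_fun do rewrite big_nil; exact: smooth_at_cst.
under eq_fun do rewrite big_cons.
by case: (P i) => //; apply: smooth_at_add.
Qed.

Lemma smooth_at_prod (I : Type) (s : seq I) (P : pred I) (f : I -> 'rV[R]_n -> R^o) :
  (forall i, smooth_at x (f i)) ->
  smooth_at x (fun y => \prod_(i <- s | P i) f i y : R^o).
Proof.
move=> sf; elim: s => [|i s IH].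
  by under eq_fun do rewrite big_nil; exact: smooth_at_cst.
under eq_fun do rewrite big_cons.
by case: (P i) => //; apply: smooth_at_mul.
Qed.

Lemma smooth_at_coord j : smooth_at x (fun y => y 0 j : R^o).
Proof. by exists setT; split=> // [|r]; [exact: openT|exact: class_C_coord]. Qed.

Lemma smooth_at_id : smooth_at x id.
Proof. by apply/smooth_at_mx => i j; rewrite ord1; exact: smooth_at_coord. Qed.

End Scalar.

Section Matrix.
Context {n : nat} (x : 'rV[R]_n).

Lemma smooth_at_mulmx p q s (f : 'rV[R]_n -> 'M[R]_(p, q))
    (g : 'rV[R]_n -> 'M[R]_(q, s)) :
  smooth_at x f -> smooth_at x g -> smooth_at x (fun y => f y *m g y).
Proof.
move=> /smooth_at_mx sf /smooth_at_mx sg; apply/smooth_at_mx => i j.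
under eq_fun do rewrite mxE.
by apply: smooth_at_sum => k; exact: smooth_at_mul.
Qed.

Lemma smooth_at_addmx p q (f g : 'rV[R]_n -> 'M[R]_(p, q)) :
  smooth_at x f -> smooth_at x g -> smooth_at x (fun y => f y + g y).
Proof.
move=> /smooth_at_mx sf /smooth_at_mx sg; apply/smooth_at_mx => i j.
under eq_fun do rewrite mxE.
exact: smooth_at_add.
Qed.

Lemma smooth_at_row_mx p q s (f : 'rV[R]_n -> 'M[R]_(p, q))
    (g : 'rV[R]_n -> 'M[R]_(p, s)) :
  smooth_at x f -> smooth_at x g -> smooth_at x (fun y => row_mx (f y) (g y)).
Proof.
move=> /smooth_at_mx sf /smooth_at_mx sg; apply/smooth_at_mx => i j.
under eq_fun do rewrite mxE.
by case: (fintype.split j) => k.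
Qed.

Lemma smooth_at_lsubmx p q s (f : 'rV[R]_n -> 'M[R]_(p, q + s)) :
  smooth_at x f -> smooth_at x (fun y => lsubmx (f y)).
Proof.
move=> /smooth_at_mx sf; apply/smooth_at_mx => i j.
by under eq_fun do rewrite mxE.
Qed.

Lemma smooth_at_rsubmx p q s (f : 'rV[R]_n -> 'M[R]_(p, q + s)) :
  smooth_at x f -> smooth_at x (fun y => rsubmx (f y)).
Proof.
move=> /smooth_at_mx sf; apply/smooth_at_mx => i j.
by under eq_fun do rewrite mxE.
Qed.

Lemma smooth_at_det p (f : 'rV[R]_n -> 'M[R]_p) :
  smooth_at x f -> smooth_at x (fun y => \det (f y) : R^o).
Proof.
move=> /smooth_at_mx sf; apply: smooth_at_sum => s; apply: smooth_at_mul.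
  exact: smooth_at_cst.
by apply: smooth_at_prod => i; exact: sf.
Qed.

Lemma smooth_at_unitmx p (f : 'rV[R]_n -> 'M[R]_p) :
  smooth_at x f -> f x \in unitmx -> \forall y \near x, f y \in unitmx.
Proof.
move=> /smooth_at_det /smooth_at_continuous cf; rewrite unitmxE unitfE => fx.
have : \forall y \near x, \det (f y) != 0.
  by apply: (cf [set z | z != 0]); exact: (open_near (@open_neq R 0) fx).
by apply: filterS => y; rewrite unitmxE unitfE.
Qed.

(** By Cramer's rule. *)
Lemma smooth_at_invmx p (f : 'rV[R]_n -> 'M[R]_p) :
  smooth_at x f -> f x \in unitmx -> smooth_at x (fun y => invmx (f y)).
Proof.
move=> sf ufx.
have nf := smooth_at_unitmx sf ufx.
apply: (@smooth_at_eq _ _ _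
  (fun y => \matrix_(i, j) ((\det (f y))^-1 * cofactor (f y) j i))).
  apply: filterS nf => y uy; apply/matrixP => i j.
  by rewrite /invmx uy !mxE.
apply/smooth_at_mx => i j; under eq_fun do rewrite mxE.
apply: smooth_at_mul.
  apply: smooth_at_inv; first by rewrite -unitfE -unitmxE.
  exact: smooth_at_det.
apply: smooth_at_mul; first exact: smooth_at_cst.
apply: smooth_at_det.
apply/smooth_at_mx => a b; under eq_fun do rewrite !mxE.
by have /smooth_at_mx := sf; apply.
Qed.

End Matrix.

Lemma smooth_at_comp n p q s (x : 'rV[R]_n) (f : 'rV[R]_n -> 'rV[R]_p)
    (g : 'rV[R]_p -> 'M[R]_(q, s)) :
  smooth_at x f -> smooth_at (f x) g -> smooth_at x (g \o f).
Proof.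
move=> sf sg; have cf := smooth_at_continuous sf.
have [U [oU Ux sU]] := sf; have [V [oV Vx sV]] := sg.
have /(@near_open _ (fun y => V (f y)))[U' [oU' U'x U'V]] := cf V (open_near oV Vx).
have oUU := openI oU oU'.
exists (U `&` U'); split=> // r; apply/class_C_mx => // i j.
have Cg : class_C r V (fun y => g y i j : R^o).
  by have /(class_C_mx _ _ oV) := sV r; apply.
apply: (class_C_comp oUU oV _ _ Cg) => [y [_ /U'V]//|].
by apply: class_C_sub (sU r) => y [].
Qed.

Lemma smooth_at_differentiable n p (x : 'rV[R]_n) (f : 'rV[R]_n -> 'rV[R]_p) :
  smooth_at x f -> differentiable f x.
Proof. by case=> U [oU Ux sU]; exact: class_C1_diff_rV (sU 1%N) Ux. Qed.

Lemma jacobianE n p (x : 'rV[R]_n) (f : 'rV[R]_n -> 'rV[R]_p) i j :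
  differentiable f x -> 'J f x i j = 'D_(delta_mx 0 i) f x 0 j.
Proof. by move=> df; rewrite deriveEjacobian // -rowE [RHS]mxE. Qed.

Lemma class_C_jacobian n p r (U : set 'rV[R]_n) (f : 'rV[R]_n -> 'rV[R]_p) :
  open U -> class_C r.+1 U f -> class_C r U (fun y => 'J f y).
Proof.
move=> oU Cf; apply/class_C_mx => // i j.
have := (Cf.2 i).2; move=> /(class_C_mx _ _ oU)/(_ 0 j).
apply: class_C_eq => // y Uy; rewrite jacobianE //.
by apply: class_C1_diff_rV (class_C_le _ Cf) Uy.
Qed.

Lemma smooth_at_jacobian n p (x : 'rV[R]_n) (f : 'rV[R]_n -> 'rV[R]_p) :
  smooth_at x f -> smooth_at x (fun y => 'J f y).
Proof.
by case=> U [oU Ux sU]; exists U; split=> // r; apply: class_C_jacobian.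
Qed.

Lemma jacobian_comp n p q (x : 'rV[R]_n) (f : 'rV[R]_n -> 'rV[R]_p)
    (g : 'rV[R]_p -> 'rV[R]_q) :
  smooth_at x f -> smooth_at (f x) g -> 'J (g \o f) x = 'J f x *m 'J g (f x).
Proof.
move=> /smooth_at_differentiable df /smooth_at_differentiable dg.
have dgf := differentiable_comp df dg.
apply/row_matrixP => i; rewrite !rowE mulmxA.
rewrite -(deriveEjacobian _ dgf) -(deriveEjacobian _ df) -(deriveEjacobian _ dg).
by rewrite (deriveE _ dgf) (deriveE _ df) (deriveE _ dg) (diff_comp df dg).
Qed.

Lemma jacobian_eq n p (x : 'rV[R]_n) (f g : 'rV[R]_n -> 'rV[R]_p) :
  smooth_at x f -> {near x, f =1 g} -> 'J f x = 'J g x.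
Proof.
move=> sf fg; have sg := smooth_at_eq fg sf.
apply/matrixP => i j.
apply: etrans (jacobianE i j (smooth_at_differentiable sf)) _.
apply: etrans _ (esym (jacobianE i j (smooth_at_differentiable sg))).
by rewrite (near_eq_derive _ fg).
Qed.

Lemma jacobian_id n (x : 'rV[R]_n) : 'J id x = 1%:M.
Proof.
apply/row_matrixP => i; rewrite !rowE mulmx1.
rewrite -(deriveEjacobian _ (smooth_at_differentiable (smooth_at_id x))).
by rewrite derive_id.
Qed.

Lemma jacobian_affine n p (A : 'M[R]_(n, p)) b (x : 'rV[R]_n) :
  smooth_at x (fun v => b + v *m A) /\ 'J (fun v => b + v *m A) x = A.
Proof.
have s : smooth_at x (fun v => b + v *m A).
  apply: smooth_at_addmx; first exact: smooth_at_cst.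
  by apply: smooth_at_mulmx; [exact: smooth_at_id|exact: smooth_at_cst].
split=> //; apply/row_matrixP => i.
rewrite !rowE -(deriveEjacobian _ (smooth_at_differentiable s)).
apply/cvg_lim => //; apply: cvg_near_cst; near=> t.
rewrite /= mulmxDl addrCA [in LHS]addrK -scalemxAl scalerA mulVf ?scale1r //.
by near: t; exact: nbhs_dnbhs_neq.
Unshelve. all: by end_near. Qed.

End SmoothAt.

(** * The inverse function theorem *)

HB.instance Definition _ (R : realType) (m n : nat) := Complete.on 'M[R]_(m, n).

Lemma continuous_dist (R : realType) (T : topologicalType) (V : normedModType R)
    (f : T -> V) (x : T) :
  (forall e : R, 0 < e -> \forall y \near x, `|f x - f y| < e) ->
  {for x, continuous f}.
Proof. by move=> H; apply/cvgrPdist_lt. Qed.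

Section Inverse.
Context {R : realType}.

Lemma mulmx_norm n p (u : 'rV[R]_n) (B : 'M[R]_(n, p)) :
  `|u *m B| <= n%:R * `|B| * `|u|.
Proof.
apply: mx_norm_le => [|i j]; first by rewrite !mulr_ge0.
rewrite mxE (le_trans (ler_norm_sum _ _ _))//.
have -> : n%:R * `|B| * `|u| = \sum_(k < n) `|u| * `|B|.
  by rewrite sumr_const card_ord -mulrA mulr_natl mulrC.
apply: ler_sum => k _; rewrite normrM ler_pM //; exact: mx_norm_coord.
Qed.

Lemma strict_jacobian n p (f : 'rV[R]_n -> 'rV[R]_p) c (e : R) :
  smooth_at c f -> 0 < e ->
  exists2 r : R, 0 < r & forall x y, ball c r x -> ball c r y ->
    `|f y - f x - (y - x) *m 'J f c| <= e * `|y - x|.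
Proof.
move=> sf e0; have df := smooth_at_differentiable sf.
have [U [oU Uc /(_ 1%N) Cf]] := sf.
have H (j : 'I_p) : \forall r \near (0 : R)^'+, forall x y, ball c r x -> ball c r y ->
    `|(f y - f x - (y - x) *m 'J f c) 0 j| <= e * `|y - x|.
  have Cj : class_C 1 U (fun y => f y 0 j : R^o).
    by have /(class_C_mx _ _ oU) := Cf; apply.
  have [r r0 [_ H]] := strict_grad oU Cj Uc e0.
  near=> s => x y cx cy.
  have sr : s <= r by near: s; exact: nbhs_right_le.
  have := H x y (le_ball sr cx) (le_ball sr cy).
  rewrite !mxE; congr (`|_ + (- _)| <= _).
  apply: eq_bigr => i _; congr (_ * _).
  apply: etrans _ (esym (jacobianE i j df)).
  have dfi : derivable f c (delta_mx 0 i) by exact: diff_derivable.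
  by rewrite (derive_mx dfi) mxE.
have H' := filter_forall _ H.
have [r [Hr r0]] : exists r : R, (forall j x y, ball c r x -> ball c r y ->
    `|(f y - f x - (y - x) *m 'J f c) 0 j| <= e * `|y - x|) /\ 0 < r.
  near (0 : R)^'+ => r; exists r; split; last by near: r; exact: nbhs_right_gt.
  by near: r; exact: H'.
exists r => // x y cx cy.
apply: mx_norm_le => [|i j]; first by rewrite mulr_ge0 // ltW.
by rewrite (ord1 i); exact: Hr.
Unshelve. all: by end_near. Qed.

(** The Newton-type map [T] below is a contraction of a small closed ball for
    every target value near [f v0], so each such value has exactly one preimage
    in that ball. *)
Theorem local_right_inverse_continuous n (f : 'rV[R]_n -> 'rV[R]_n) v0 :
  smooth_at v0 f -> 'J f v0 \in unitmx ->
  forall U, open U -> U v0 ->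
  exists (g : 'rV[R]_n -> 'rV[R]_n) W (C : R),
    [/\ open W, W (f v0), g (f v0) = v0,
       (forall w, W w -> U (g w) /\ f (g w) = w) &
       (forall w w', W w -> W w' -> `|g w - g w'| <= C * `|w - w'|)].
Proof.
move=> sf uA U oU Uv0.
set A := 'J f v0 in uA.
pose B := invmx A.
(* A bound for the operator norm of [B]; adding 1 keeps it positive. *)
pose C : R := n%:R * `|B| + 1.
have C0 : 0 < C by rewrite ltr_wpDl // mulr_ge0.
have BC (u : 'rV[R]_n) : `|u *m B| <= C * `|u|.
  by rewrite (le_trans (mulmx_norm u B)) // ler_wpM2r // lerDl.
have e0 : 0 < (2 * C)^-1 by rewrite invr_gt0 mulr_gt0.
have [r0 r00 Hr0] := strict_jacobian sf e0.
have [r1 /= r10 Hr1] := (nbhs_ballP v0 U).1 (open_near oU Uv0).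
pose r := Num.min r0 r1 / 2.
have r_gt0 : 0 < r by rewrite divr_gt0 // lt_min r00.
pose K := [set v : 'rV[R]_n | `|v - v0| <= r].
have rm : r < Num.min r0 r1.
  by rewrite /r; have : 0 < Num.min r0 r1; [rewrite lt_min r00|lra].
have Kball v : K v -> ball v0 r0 v /\ U v.
  rewrite /K /= -ball_normE => Kv; split.
    by rewrite /ball_ /= distrC (le_lt_trans Kv) // (lt_le_trans rm) // ge_min lexx.
  apply: Hr1; rewrite -ball_normE /ball_ /= distrC (le_lt_trans Kv) //.
  by rewrite (lt_le_trans rm) // ge_min lexx orbT.
(* Up to the linear change of coordinates [B], [f] is the identity plus a map of
   Lipschitz constant 1/2. *)
have half x y : K x -> K y ->
    `|(f y - f x) *m B - (y - x)| <= 2^-1 * `|y - x|.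
  move=> /Kball[cx _] /Kball[cy _].
  have -> : (f y - f x) *m B - (y - x) = (f y - f x - (y - x) *m A) *m B.
    by rewrite [RHS]mulmxBl -mulmxA mulmxV // mulmx1.
  rewrite (le_trans (BC _)) // (le_trans (ler_wpM2l (ltW C0) (Hr0 _ _ cx cy))) //.
  by rewrite invfM mulrA mulrCA divff ?gt_eqF // mulr1.
have Kv0 : K v0 by rewrite /K /= subrr normr0 ltW.
have lip x y : K x -> K y -> `|y - x| <= 2 * C * `|f y - f x|.
  move=> Kx Ky.
  have := half x y Kx Ky; have := BC (f y - f x).
  have := ler_normB ((f y - f x) *m B) ((f y - f x) *m B - (y - x)).
  rewrite opprB addrCA subrr addr0; lra.
pose W := ball (f v0) (r / (2 * C)).
have main w : W w -> exists2 p, K p & f p = w.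
  rewrite /W -ball_normE /ball_ /= => Ww.
  pose T v := v - (f v - w) *m B.
  have TT x y : T y - T x = - ((f y - f x) *m B - (y - x)).
    have Z (a b c z t : 'rV[R]_n) : t - (a - c) - (z - (b - c)) = - (a - b - (t - z)).
      by apply/rowP => i; rewrite !mxE; ring.
    by rewrite /T !mulmxBl Z.
  have TK : set_fun K K T.
    move=> v Kv; rewrite /K /=.
    have -> : T v - v0 = (T v - T v0) + (w - f v0) *m B.
      have Z (a b c : 'rV[R]_n) : a - b = a - (b - c) - c.
        by apply/rowP => i; rewrite !mxE; ring.
      have -> : w - f v0 = - (f v0 - w) by rewrite opprB.
      by rewrite mulNmx; exact: Z.
    rewrite (le_trans (ler_normD _ _)) // TT normrN.
    have h1 := half v0 v Kv0 Kv; have h2 := BC (w - f v0).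
    rewrite distrC in Ww; have h3 : C * `|w - f v0| <= r / 2.
      rewrite -ler_pdivlMl // (le_trans (ltW Ww)) // invfM mulrCA; lra.
    move: Kv; rewrite /K /=; lra.
  pose TF : {fun K >-> K} := HB.pack T (isFun.Build _ _ K K T TK).
  have ctr : is_contraction TF.
    exists (2^-1)%:nng; split; first by rewrite /=; lra.
    move=> [x y] [/= Kx Ky].
    by rewrite -[_ - _]/(T x - T y) TT normrN; exact: half.
  have cK : closed K.
    have -> : K = closed_ball v0 r; last exact: closed_ball_closed.
    rewrite closed_ballE //; apply/seteqP.
    by split=> v; rewrite /K /closed_ball_ /= distrC.
  have [p Kp pT] := banach_fixed_point ctr cK (ex_intro _ v0 Kv0).
  exists p => //.
  have : (f p - w) *m B = 0.
    move: pT; rewrite -[TF p]/(T p) /T => /esym/eqP.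
    by rewrite addrC -subr_eq0 addrK oppr_eq0 => /eqP.
  move=> /(congr1 (mulmx^~ A)); rewrite mul0mx -mulmxA mulVmx // mulmx1.
  by move=> /eqP; rewrite subr_eq0 => /eqP.
pose g w := xget v0 [set p | K p /\ f p = w].
have gP w : W w -> K (g w) /\ f (g w) = w.
  move=> /main[p Kp fp].
  by apply: (xgetPex v0 (P := [set p | K p /\ f p = w])); exists p.
have Wv0 : W (f v0) by apply: ballxx; rewrite divr_gt0 // mulr_gt0.
exists g, W, (2 * C); split=> //.
- exact: ball_open.
- have [Kg fg] := gP _ Wv0; apply/eqP; rewrite -subr_eq0 -normr_le0.
  by rewrite (le_trans (lip _ _ Kv0 Kg)) // fg subrr normr0 mulr0.
- by move=> w /gP[/Kball[]].
- by move=> w w' /gP[Kg fg] /gP[Kg' fg']; rewrite (le_trans (lip _ _ Kg' Kg)) // fg fg'.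
Qed.

(** The derivative of [g] at [w] is the inverse of the Jacobian of [f] at [g w].
    So if [g] is of class C^r then so is its derivative, and [g] is of class
    C^(r+1). *)
Theorem local_right_inverse n (f : 'rV[R]_n -> 'rV[R]_n) v0 :
  smooth_at v0 f -> 'J f v0 \in unitmx ->
  exists g : 'rV[R]_n -> 'rV[R]_n,
    [/\ smooth_at (f v0) g, g (f v0) = v0 & \forall w \near f v0, f (g w) = w].
Proof.
move=> sf uA.
have := near_and (smooth_at_near sf) (smooth_at_unitmx (smooth_at_jacobian sf) uA).
move=> /near_open[U [oU Uv0 HU]].
have [g [W [C0 [oW Wv0 gv0 fg lip0]]]] := local_right_inverse_continuous sf uA oU Uv0.
exists g; split=> //; last by apply: filterS (open_near oW Wv0) => w /fg[].
pose C := `|C0| + 1; have C_gt0 : 0 < C by rewrite ltr_wpDl.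
have lip w w' : W w -> W w' -> `|g w - g w'| <= C * `|w - w'|.
  move=> Ww Ww'; apply: le_trans (lip0 _ _ Ww Ww') _.
  by rewrite ler_wpM2r // /C ler_wpDr // ler_norm.
have cg w : W w -> {for w, continuous g}.
  move=> Ww; apply: continuous_dist => e e0.
  have B : nbhs w (ball w (e / C)) by apply: nbhsx_ballx; rewrite divr_gt0.
  apply: (near_sub (near_and (open_near oW Ww) B)) => u [Wu].
  rewrite -ball_normE /ball_ /= => wu; apply: le_lt_trans (lip _ _ Ww Wu) _.
  by rewrite mulrC -ltr_pdivlMr.
have dg w v : W w -> is_derive w v g (v *m invmx ('J f (g w))).
  move=> Ww; have [Uw fgw] := fg w Ww; have [sfw uw] := HU _ Uw.
  set Bp := invmx _; pose D := n%:R * `|Bp| + 1.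
  have D0 : 0 < D by rewrite ltr_wpDl // mulr_ge0.
  have BD (u : 'rV[R]_n) : `|u *m Bp| <= D * `|u|.
    by rewrite (le_trans (mulmx_norm u Bp)) // ler_wpM2r // lerDl.
  have v1 : 0 < `|v| + 1 by rewrite ltr_wpDl.
  suff L : (fun h : R => h^-1 *: ((g \o shift w) (h *: v) - g w)) @ 0^' --> v *m Bp.
    by apply: DeriveDef; [apply/cvg_ex; eexists; exact: L|exact: cvg_lim L].
  apply/cvgrPdist_le => e e0.
  (* The error of the linear approximation of [f] is multiplied by at most [D]
     by [Bp], and [q - g w] is at most [C * |h v|]. *)
  pose e1 := e / (D * C * (`|v| + 1)).
  have e10 : 0 < e1 by rewrite divr_gt0 // !mulr_gt0.
  have [r r0 Hr] := strict_jacobian sfw e10.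
  have [s /= s0 Hs] := (nbhs_ballP w W).1 (open_near oW Ww).
  near=> h.
  have h0 : h != 0 by near: h; exact: nbhs_dnbhs_neq.
  have hs : `|h| < Num.min s (r / C) / (`|v| + 1).
    near: h; apply: dnbhs0_lt; rewrite divr_gt0 // lt_min s0 divr_gt0 //.
  have hv : `|h *: v| < Num.min s (r / C).
    rewrite normrZ (le_lt_trans (_ : _ <= `|h| * (`|v| + 1))) ?ler_wpM2l ?lerDl //.
    by rewrite -ltr_pdivlMr.
  have Whw : W (h *: v + w).
    apply: Hs; rewrite -ball_normE /ball_ /= opprD addrCA subrr addr0 normrN.
    by rewrite (lt_le_trans hv) // ge_min lexx.
  set q := g (h *: v + w).
  have qp : `|q - g w| <= C * `|h *: v|.
    by rewrite (le_trans (lip _ _ Whw Ww)) // addrK.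
  have bq : ball (g w) r q.
    rewrite -ball_normE /ball_ /= distrC (le_lt_trans qp) // mulrC -ltr_pdivlMr //.
    by rewrite (lt_le_trans hv) // ge_min lexx orbT.
  have := Hr (g w) q (ballxx _ r0) bq.
  rewrite fgw (fg _ Whw).2 addrK => est.
  have -> : v *m Bp - h^-1 *: ((g \o shift w) (h *: v) - g w) =
      h^-1 *: ((h *: v - (q - g w) *m 'J f (g w)) *m Bp).
    rewrite [X in _ = _ *: X](_ : _ = h *: (v *m Bp) - (q - g w)).
      by rewrite [RHS]scalerBr scalerA mulVf // scale1r.
    by rewrite [LHS]mulmxBl -mulmxA mulmxV // mulmx1 -scalemxAl.
  rewrite normrZ normfV ler_pdivrMl ?normr_gt0 //.
  rewrite (le_trans (BD _)) // (le_trans (ler_wpM2l (ltW D0) est)) //.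
  rewrite (le_trans (ler_wpM2l (ltW D0) (ler_wpM2l (ltW e10) qp))) // normrZ.
  rewrite (le_trans (_ : _ <= D * (e1 * (C * (`|h| * (`|v| + 1)))))) //.
    by rewrite !ler_wpM2l ?lerDl // ltW.
  rewrite /e1 [leLHS](_ : _ = `|h| * e) //.
  by field; rewrite !gt_eqF.
exists W; split=> //; elim=> [|r IH] /=; split=> //.
move=> i; split=> [w Ww|]; first by have [] := dg w (delta_mx 0 i) Ww.
apply: (@class_C_eq _ _ _ _ _ (fun w => delta_mx 0 i *m invmx ('J f (g w)))) => //.
  by move=> w Ww; have [_ ->] := dg w (delta_mx 0 i) Ww.
apply/class_C_mx => // a j.
have sI : smooth U (fun p => invmx ('J f p)).
  apply: smooth_at_smooth => p /HU[sp up].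
  by apply: smooth_at_invmx => //; exact: smooth_at_jacobian.
have Cij : class_C r U (fun p => invmx ('J f p) i j : R^o).
  by have /(class_C_mx _ _ oU) := sI r; apply.
apply: class_C_eq (class_C_comp oW oU (fun w Ww => (fg w Ww).1) IH Cij) => // w Ww /=.
by rewrite (ord1 a) -rowE mxE.
Unshelve. all: by end_near. Qed.

End Inverse.

(** * Smooth bump functions *)

Section Bump.
Context {R : realType}.
Implicit Types p : {poly R}.

(** The flat functions [p(1/x) exp(-1/x)], extended by 0. They are indexed by all
    polynomials [p] so that the family is stable under differentiation. *)
Definition flat p (x : R) : R^o := if 0 < x then p.[x^-1] * expR (- x^-1) else 0.

(** The exponential dominates each monomial by one more power of [y], which is
    what makes [flat p] differentiable at 0. *)
Lemma poly_expR_bound p :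
  exists2 C : R, 0 <= C & forall y, 1 <= y -> `|p.[y] * expR (- y)| <= C / y.
Proof.
exists (\sum_(i < size p) `|p`_i| * (i.+1)`!%:R) => [|y y1].
  by apply: sumr_ge0 => i _; rewrite mulr_ge0.
have y0 : 0 < y by rewrite (lt_le_trans _ y1).
rewrite normrM (ger0_norm (expR_ge0 _)) horner_coef mulr_suml.
apply: le_trans (_ : _ <= (\sum_(i < size p) `|p`_i * y ^+ i|) * expR (- y)) _.
  by rewrite ler_wpM2r ?expR_ge0 // ler_norm_sum.
rewrite mulr_suml; apply: ler_sum => i _.
rewrite normrM -!mulrA; apply: ler_wpM2l => //.
rewrite (ger0_norm (exprn_ge0 _ (ltW y0))).
have := @expR_ge1Dxn R y i (ltW y0).
rewrite expRN ler_pdivrMr ?expR_gt0 // mulrAC ler_pdivlMr // -exprSr => H.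
rewrite mulrC -ler_pdivrMr ?ltr0n ?fact_gt0 //.
by apply: le_trans H; rewrite lerDr.
Qed.

Lemma flat_bound p :
  exists2 C : R, 0 <= C & forall x, `|x| <= 1 -> `|flat p x| <= C * `|x|.
Proof.
have [C C0 H] := poly_expR_bound p; exists C => // x x1; rewrite /flat.
case: ifPn => [x0|_]; last by rewrite normr0 mulr_ge0.
rewrite (ger0_norm (ltW x0)) in x1 *.
by rewrite -[x in leRHS]invrK H // invf_ge1.
Qed.

Lemma flat_derive p (x : R) : is_derive x 1 (flat p) (flat ('X^2 * (p - p^`())) x).
Proof.
have [x0|x0|x0] := ltgtP x 0.
- apply: (@near_eq_is_derive _ R^o R^o (cst 0)).
    near=> y; rewrite /flat ltNge ltW //.
    by near: y; exact: lt_nbhsl.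
  rewrite /flat ltNge (ltW x0) /=; exact: is_derive_cst.
- apply: (@near_eq_is_derive _ R^o R^o (fun y => p.[y^-1] * expR (- y^-1))).
    near=> y; rewrite /flat ifT //.
    by near: y; exact: lt_nbhsr.
  have xn0 : x != 0 by rewrite gt_eqF.
  have dV : is_derive x 1 (fun y : R => y^-1 : R) (- x ^- 2).
    have := @derivableV R R^o id x 1 xn0 (@derivable_id _ _ _ _).
    move=> d; apply: DeriveDef => //; rewrite (@deriveV R R^o id) // derive_id.
    by rewrite /GRing.scale /= mulr1.
  have dp : is_derive x 1 (fun y : R => p.[y^-1]) (p^`().[x^-1] * - x ^- 2).
    exact: (@is_derive1_comp R (horner p)).
  have dN : is_derive x 1 (fun y : R => - y^-1 : R) (x ^- 2).
    rewrite -[x ^- 2]opprK; exact: is_deriveN.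
  have de : is_derive x 1 (fun y : R => expR (- y^-1)) (expR (- x^-1) * x ^- 2).
    exact: (@is_derive1_comp R expR (fun y => - y^-1)).
  have D := @is_deriveM R R^o (fun y : R => p.[y^-1]) (fun y : R => expR (- y^-1)) x 1
    _ _ dp de.
  apply: (is_derive_eq D).
  have alg (a b c d : R) : a * (c * d) + c * (b * - d) = d * (a - b) * c by ring.
  by rewrite /flat x0 !hornerE exprVn; exact: alg.
- rewrite x0.
  (* The difference quotients of [flat p] at 0 are the values of [flat (p * 'X)]. *)
  have [C C0 H] := flat_bound (p * 'X).
  have E : {near (0 : R)^', flat (p * 'X) =1
      fun h : R => h^-1 *: ((flat p \o shift 0) (h *: (1 : R)) - flat p 0)}.
    near=> h.
    rewrite /= addr0 [h *: 1]mulr1 {3}/flat ltxx subr0 /flat.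
    case: ifP => h0; last by rewrite scaler0.
    by rewrite hornerMX mulrAC mulrC.
  have L : (fun h : R => h^-1 *: ((flat p \o shift 0) (h *: (1 : R)) - flat p 0)) @ 0^'
      --> (0 : R^o).
    apply: cvg_trans (near_eq_cvg E) _.
    apply/cvgrPdist_le => e e0; near=> h.
    rewrite sub0r normrN (le_trans (H _ _)) //.
      near: h; apply: dnbhs0_le => //.
    rewrite (le_trans (_ : _ <= (C + 1) * `|h|)) ?ler_wpM2r ?lerDl //.
    rewrite -ler_pdivlMl ?ltr_wpDl // mulrC.
    by near: h; apply: dnbhs0_le; rewrite divr_gt0 // ltr_wpDl.
  rewrite {2}/flat ltxx.
  by apply: DeriveDef; [apply/cvg_ex; exists 0|exact: cvg_lim L].
Unshelve. all: by end_near. Qed.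

Lemma is_derive_comp1 n (f : 'rV[R]_n -> R^o) (g : R -> R^o) (x v : 'rV[R]_n) (d : R) :
  derivable f x v -> is_derive (f x : R) 1 g d ->
  is_derive x v (g \o f) (d * 'D_v f x).
Proof.
move=> df dg.
pose phi (h : R) : R^o := f (h *: v + x).
have dphi := (derivable1P f x v).1 df; rewrite -/phi in dphi.
have phi0 : phi 0 = f x by rewrite /phi scale0r add0r.
have D : is_derive (0 : R) 1 (g \o phi) (d * 'D_1 phi 0).
  by apply: is_derive1_comp; [rewrite phi0|exact: derivableP].
have [dgf egf] := D.
have E (k : 'rV[R]_n -> R^o) :
    'D_1 (fun h : R => k (h *: v + x) : R^o) 0 = 'D_v k x.
  have E0 : (fun h : R => h^-1 *: (((fun h : R => k (h *: v + x) : R^o) \o shift 0)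
      (h *: 1) - k (0 *: v + x))) = fun h => h^-1 *: ((k \o shift x) (h *: v) - k x).
    by apply/funext => h /=; rewrite addr0 scale0r add0r [h%:A]mulr1.
  by rewrite /derive E0.
apply: DeriveDef; first by apply/(derivable1P (g \o f) x v); exact: dgf.
by rewrite -(E (g \o f)) -(E f) -egf.
Qed.

Lemma flat_class_C n p r (U : set 'rV[R]_n) (f : 'rV[R]_n -> R^o) : open U ->
  class_C r U f -> class_C r U (flat p \o f).
Proof.
have cp s q x : class_C s U f -> U x -> {for x, continuous (flat q \o f)}.
  move=> Cf Ux; apply: (@continuous_comp _ _ _ f (flat q)).
    exact: class_C_continuous Cf Ux.
  have [d _] := flat_derive q (f x).
  exact/differentiable_continuous/derivable1_diffP.
move=> oU; elim: r p => [|r IH] p Cf /=.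
  by split=> // x; exact: cp Cf.
split=> [x|i]; first exact: cp Cf.
have D x : U x -> is_derive x (delta_mx 0 i) (flat p \o f)
    (flat ('X^2 * (p - p^`())) (f x) * 'D_(delta_mx 0 i) f x).
  by move=> Ux; apply: is_derive_comp1; [exact: (Cf.2 i).1|exact: flat_derive].
split=> [x Ux|]; first by have [] := D x Ux.
apply: class_C_eq (class_C_mul oU (IH ('X^2 * (p - p^`())) (class_CW Cf))
  (Cf.2 i).2) => //.
by move=> x Ux /=; have [_ ->] := D x Ux.
Qed.

(** A product over the coordinates of functions that are positive exactly when
    that coordinate is at distance less than [r] from the one of [c]. *)
Lemma bump n (c : 'rV[R]_n) r : 0 < r ->
  exists b : 'rV[R]_n -> R^o,
    [/\ forall x, smooth_at x b, b c != 0 & forall x, b x != 0 -> `|x - c| <= r].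
Proof.
move=> r0.
pose b (x : 'rV[R]_n) : R^o :=
  \prod_(i < n) flat 1 (r ^+ 2 + (-1) * ((x 0 i - c 0 i) * (x 0 i - c 0 i))).
exists b; split.
- move=> x; apply: smooth_at_prod => i; exists setT; split=> //; first exact: openT.
  have C1 s : class_C s setT (fun x : 'rV[R]_n => x 0 i - c 0 i : R^o).
    apply: class_C_add openT _ _; first exact: class_C_coord.
    exact: class_C_cst.
  move=> s.
  apply: (@flat_class_C n 1 s setT (fun x : 'rV[R]_n =>
    r ^+ 2 + (-1) * ((x 0 i - c 0 i) * (x 0 i - c 0 i)))).
    exact: openT.
  apply: class_C_add openT (class_C_cst _ _ _) _.
  apply: class_C_mul openT (class_C_cst _ _ _) _.
  exact: class_C_mul openT _ _.
- apply/prodf_neq0 => i _; rewrite subrr mulr0 mulr0 addr0 /flat exprn_gt0 //.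
  by rewrite hornerE mul1r gt_eqF // expR_gt0.
- move=> x /prodf_neq0 bx; apply: mx_norm_le => [|a i]; first exact: ltW.
  rewrite (ord1 a) !mxE; have := bx i isT; rewrite /flat.
  case: ifPn; last by rewrite eqxx.
  rewrite mulN1r subr_gt0 -expr2 => /ltW h _.
  rewrite -(real_normK (num_real _)) in h.
  by rewrite ler_pXn2r ?nnegrE ?(ltW r0) in h.
Qed.

End Bump.

(** * Maps between manifolds in charts *)

Section Charts.
Context {R : realType}.

(** Calculus in charts is done for smooth atlases, so that it applies by a direct
    check to the Euclidean parameter space of integral manifolds and to the
    product of the base and the fiber. *)
Definition smooth_atlas n (A : charted R n) :=
  [/\ forall c, atlas A c -> is_chart c,
      forall c c', atlas A c -> atlas A c' -> smooth_change c c' &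
      forall x : A, atlas A (chart_at A x) /\ cdom (chart_at A x) x].

Lemma manifold_atlas n (M : manifold R n) : smooth_atlas M.
Proof. by have [_ H1 H2 H3] := manifoldP M. Qed.

Lemma euclid_atlas n : smooth_atlas (euclid R n).
Proof.
split.
- move=> c ->; split=> [|//|x _|x _]; [|exact: cvg_id|exact: cvg_id].
  split; first exact: openT.
  have -> : cmap (Chart setT id id : chart R (euclid R n) n) @` setT = setT.
    by apply/seteqP; split=> // v _; exists v.
  exact: openT.
- move=> c c' -> ->; rewrite /smooth_change /=.
  apply: (@smooth_at_smooth R n 'rV[R]_n) => x _.
  exact: smooth_at_id.
- by [].
Qed.

Section OneChart.
Context {n : nat} {A : topologicalType} {c : chart R A n} (hc : is_chart c).

Lemma cinvK x : cdom c x -> cinv c (cmap c x) = x.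
Proof. by case: hc => _ + _ _; apply. Qed.

Lemma near_cdom x : cdom c x -> \forall y \near x, cdom c y.
Proof. by case: hc => -[oc _] _ _ _; exact: open_near. Qed.

Lemma near_image x : cdom c x ->
  \forall v \near cmap c x, cdom c (cinv c v) /\ cmap c (cinv c v) = v.
Proof.
move=> cx; case: hc => -[_ oc] K _ _.
have : (cmap c @` cdom c) (cmap c x) by exists x.
move=> Hx; apply: (near_sub (open_near oc Hx)) => v [y cy <-].
by rewrite K.
Qed.

Lemma near_cinv (P : set A) x : cdom c x ->
  (\forall y \near x, P y) -> \forall v \near cmap c x, P (cinv c v).
Proof. by move=> cx HP; case: hc => _ K _ /(_ x cx); apply; rewrite K. Qed.

Lemma near_cmap (P : set 'rV[R]_n) x : cdom c x ->
  (\forall v \near cmap c x, P v) -> \forall y \near x, P (cmap c y).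
Proof. by move=> cx HP; case: hc => _ _ /(_ x cx) + _; apply. Qed.

Lemma open_cmap (U : set A) : open U -> open (cmap c @` (U `&` cdom c)).
Proof.
move=> oU; rewrite openE => _ [x [Ux cx] <-].
apply: (near_sub (near_and (near_image cx) (near_cinv cx (open_near oU Ux)))).
by move=> v [[cv E] Uv]; exists (cinv c v).
Qed.

End OneChart.

Section OneManifold.
Context {n : nat} {A : charted R n} (hA : smooth_atlas A).
Implicit Types c : chart R A n.

Lemma atlas_max c : atlas A c -> max_atlas A c.
Proof.
by case: hA => H1 H2 _ ac; split=> [|c' ac']; [exact: H1|split; exact: H2].
Qed.

Lemma max_chart c : max_atlas A c -> is_chart c.
Proof. by case. Qed.

Lemma chart_at_max (x : A) : max_atlas A (chart_at A x).
Proof. by apply: atlas_max; case: hA => _ _ /(_ x)[]. Qed.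

Lemma chart_at_dom (x : A) : cdom (chart_at A x) x.
Proof. by case: hA => _ _ /(_ x)[]. Qed.

Lemma smooth_change_at c c' x : is_chart c -> is_chart c' -> smooth_change c c' ->
  cdom c x -> cdom c' x -> smooth_at (cmap c x) (cmap c' \o cinv c).
Proof.
move=> hc [[oc' _] _ _ _] s cx c'x; apply: smooth_smooth_at s _.
  by rewrite setIC; exact: (open_cmap hc).
by exists x.
Qed.

(** Two charts of the maximal atlas are compared through a chart of the atlas
    itself around the given point. *)
Lemma change_smooth c c' x : max_atlas A c -> max_atlas A c' ->
  cdom c x -> cdom c' x -> smooth_at (cmap c x) (cmap c' \o cinv c).
Proof.
move=> [hc mc] [hc' mc'] cx c'x.
have ax := chart_at_dom x.
have aa : atlas A (chart_at A x) by case: hA => _ _ /(_ x)[].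
set a := chart_at A x in ax aa.
have ha : is_chart a by exact: (max_chart (atlas_max aa)).
have s1 := smooth_change_at hc ha (mc a aa).1 cx ax.
have s2 : smooth_at ((cmap a \o cinv c) (cmap c x)) (cmap c' \o cinv a).
  rewrite /= (cinvK hc cx); exact: smooth_change_at ha hc' (mc' a aa).2 ax c'x.
apply: smooth_at_eq (smooth_at_comp s1 s2).
apply: near_sub (near_cinv hc cx (near_cdom ha ax)) _ => v /= av.
by rewrite (cinvK ha av).
Qed.

(** Smoothness near [x] in every chart of the maximal atlas; by [change_chart] one
    chart is enough. *)
Definition sfun_at (W : normedModType R) (f : A -> W) (x : A) :=
  forall c, max_atlas A c -> cdom c x -> smooth_at (cmap c x) (f \o cinv c).

Lemma smooth_inP (W : normedModType R) c (U : set A) (f : A -> W) :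
  is_chart c -> open U ->
  smooth_in c U f <-> forall x, U x -> cdom c x -> smooth_at (cmap c x) (f \o cinv c).
Proof.
move=> hc oU; split=> [s x Ux cx|H].
  by apply: smooth_smooth_at s _; [exact: open_cmap|exists x].
by apply: smooth_at_smooth => _ [x [Ux cx] <-]; exact: H.
Qed.

Lemma change_chart p q c c' x (f : A -> 'M[R]_(p, q)) :
  max_atlas A c -> max_atlas A c' -> cdom c x -> cdom c' x ->
  smooth_at (cmap c x) (f \o cinv c) -> smooth_at (cmap c' x) (f \o cinv c').
Proof.
move=> mc mc' cx c'x sf.
have s1 := change_smooth mc' mc c'x cx.
have hc := max_chart mc; have hc' := max_chart mc'.
have s2 : smooth_at ((cmap c \o cinv c') (cmap c' x)) (f \o cinv c).
  by rewrite /= (cinvK hc' c'x).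
apply: smooth_at_eq (smooth_at_comp s1 s2).
apply: near_sub (near_cinv hc' c'x (near_cdom hc cx)) _ => v /= cv.
by rewrite (cinvK hc cv).
Qed.

Lemma sfun_atI p q c x (f : A -> 'M[R]_(p, q)) :
  max_atlas A c -> cdom c x -> smooth_at (cmap c x) (f \o cinv c) -> sfun_at f x.
Proof. by move=> mc cx sf c' mc' c'x; exact: change_chart mc mc' cx c'x sf. Qed.

Lemma smooth_at_scalar (m : nat) (v : 'rV[R]_m) (f : 'rV[R]_m -> R^o) :
  smooth_at v f <-> smooth_at v (fun u => (f u)%:M : 'M[R]_1).
Proof.
split=> [sf|/smooth_at_mx/(_ 0 0)]; last by under eq_fun do rewrite mxE eqxx.
apply/smooth_at_mx => i j; under eq_fun do rewrite !ord1 mxE eqxx.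
exact: sf.
Qed.

Lemma sfun_at_scalar (f : A -> R^o) x :
  sfun_at f x <-> sfun_at (fun y => (f y)%:M : 'M[R]_1) x.
Proof.
by split=> sf c mc cx; have := sf c mc cx; rewrite smooth_at_scalar.
Qed.

Lemma sfun_at_eq (W : normedModType R) (f g : A -> W) x :
  {near x, f =1 g} -> sfun_at f x -> sfun_at g x.
Proof.
move=> fg sf c mc cx; apply: smooth_at_eq (sf c mc cx).
exact: (near_cinv (max_chart mc) cx fg).
Qed.

Lemma sfun_at_continuous (W : normedModType R) (f : A -> W) x :
  sfun_at f x -> {for x, continuous f}.
Proof.
move=> sf; have mc := chart_at_max x; have cx := chart_at_dom x.
have hc := max_chart mc; have sc := smooth_at_continuous (sf _ mc cx).
have [_ _ cc _] := hc.
have K : {near x, (f \o cinv (chart_at A x)) \o cmap (chart_at A x) =1 f}.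
  by apply: near_sub (near_cdom hc cx) _ => y cy /=; rewrite (cinvK hc cy).
apply: near_eq_continuous K _.
exact: (continuous_comp (cc x cx) sc).
Qed.

Lemma sfun_at_unitmx p (f : A -> 'M[R]_p) x : sfun_at f x -> f x \in unitmx ->
  \forall y \near x, f y \in unitmx.
Proof.
move=> sf ux; have mc := chart_at_max x; have cx := chart_at_dom x.
have hc := max_chart mc.
have := smooth_at_unitmx (sf _ mc cx); rewrite /= (cinvK hc cx) => /(_ ux).
move=> /(near_cmap hc cx) H.
apply: (near_sub (near_and H (near_cdom hc cx))) => y [].
by move=> + cy; rewrite (cinvK hc cy).
Qed.

Section Operations.
Variable x : A.

Lemma sfun_at_cst (W : normedModType R) (a : W) : sfun_at (fun _ => a) x.
Proof. move=> c _ _; exact: smooth_at_cst. Qed.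

Lemma sfun_at_mulmx p q s (f : A -> 'M[R]_(p, q)) (g : A -> 'M[R]_(q, s)) :
  sfun_at f x -> sfun_at g x -> sfun_at (fun y => f y *m g y) x.
Proof.
move=> sf sg c mc cx.
exact: (smooth_at_mulmx (sf c mc cx) (sg c mc cx)).
Qed.

Lemma sfun_at_lsubmx p q s (f : A -> 'M[R]_(p, q + s)) :
  sfun_at f x -> sfun_at (fun y => lsubmx (f y)) x.
Proof. move=> sf c mc cx; exact: (smooth_at_lsubmx (sf c mc cx)). Qed.

Lemma sfun_at_rsubmx p q s (f : A -> 'M[R]_(p, q + s)) :
  sfun_at f x -> sfun_at (fun y => rsubmx (f y)) x.
Proof. move=> sf c mc cx; exact: (smooth_at_rsubmx (sf c mc cx)). Qed.

Lemma sfun_at_row_mx p q s (f : A -> 'M[R]_(p, q)) (g : A -> 'M[R]_(p, s)) :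
  sfun_at f x -> sfun_at g x -> sfun_at (fun y => row_mx (f y) (g y)) x.
Proof. move=> sf sg c mc cx; exact: (smooth_at_row_mx (sf c mc cx) (sg c mc cx)). Qed.

Lemma sfun_at_invmx p (f : A -> 'M[R]_p) :
  sfun_at f x -> f x \in unitmx -> sfun_at (fun y => invmx (f y)) x.
Proof.
move=> sf ux c mc cx; apply: (smooth_at_invmx (sf c mc cx)).
by rewrite /= (cinvK (max_chart mc) cx).
Qed.

Lemma sfun_at_det p (f : A -> 'M[R]_p) :
  sfun_at f x -> sfun_at (fun y => \det (f y) : R^o) x.
Proof. move=> sf c mc cx; exact: (smooth_at_det (sf c mc cx)). Qed.

Lemma sfun_at_mul (f g : A -> R^o) :
  sfun_at f x -> sfun_at g x -> sfun_at (fun y => f y * g y : R^o) x.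
Proof. move=> sf sg c mc cx; exact: (smooth_at_mul (sf c mc cx) (sg c mc cx)). Qed.

Lemma sfun_at_inv (f : A -> R^o) : f x != 0 ->
  sfun_at f x -> sfun_at (fun y => (f y)^-1 : R^o) x.
Proof.
move=> f0 sf c mc cx; apply: (smooth_at_inv _ (sf c mc cx)).
by rewrite /= (cinvK (max_chart mc) cx).
Qed.

End Operations.

End OneManifold.
End Charts.

(** * Smooth maps and their derivatives in charts *)

Section Maps.
Context {R : realType}.

(** Continuity ensures that the local representatives of [f] near [x] do not
    involve the values of the charts of [B] outside their domains. *)
Definition smap_at n p (A : charted R n) (B : charted R p) (f : A -> B) (x : A) :=
  {for x, continuous f} /\
  forall c c', max_atlas A c -> max_atlas B c' -> cdom c x -> cdom c' (f x) ->
    smooth_at (cmap c x) (cmap c' \o f \o cinv c).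

Definition jac n p (A : charted R n) (B : charted R p) (c : chart R A n)
    (c' : chart R B p) (f : A -> B) (x : A) : 'M[R]_(n, p) :=
  'J (cmap c' \o f \o cinv c) (cmap c x).

Lemma jac_smooth n p (A : charted R n) (B : charted R p) (hA : smooth_atlas A)
    c c' (f : A -> B) x :
  max_atlas A c -> max_atlas B c' -> cdom c x -> cdom c' (f x) -> smap_at f x ->
  sfun_at (jac c c' f) x.
Proof.
move=> mc mc' cx c'x [_ sf]; have hc := max_chart mc.
apply: (sfun_atI hA mc cx).
apply: smooth_at_eq (smooth_at_jacobian (sf c c' mc mc' cx c'x)).
by apply: near_sub (near_image hc cx) _ => v [_ E]; rewrite /jac /= E.
Qed.

Lemma smap_at_id n (A : charted R n) (hA : smooth_atlas A) x :
  smap_at (id : A -> A) x.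
Proof.
by split=> [|c c' mc mc' cx c'x]; [exact: cvg_id|exact: (change_smooth hA)].
Qed.

(** Near [x] the representative of a composite is the composite of the
    representatives; independence of charts and the chain rule follow. *)
Lemma near_rep_comp n (A : charted R n) (T : topologicalType) S p (c : chart R A n)
    (c' : chart R T p) (f : A -> T) (g : T -> S) x :
  is_chart c -> is_chart c' -> cdom c x -> cdom c' (f x) -> {for x, continuous f} ->
  \forall v \near cmap c x,
    (g \o cinv c' \o (cmap c' \o f \o cinv c)) v = (g \o f \o cinv c) v.
Proof.
move=> hc hc' cx c'x cf.
have K := near_cinv (P := fun y => cdom c' (f y)) hc cx (cf _ (near_cdom hc' c'x)).
apply: near_sub K _ => v /= c'v.
by rewrite (cinvK hc').
Qed.

Lemma smap_atI n p (A : charted R n) (B : charted R p) (hA : smooth_atlas A)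
    (hB : smooth_atlas B) c c' (f : A -> B) x :
  {for x, continuous f} -> max_atlas A c -> max_atlas B c' -> cdom c x ->
  cdom c' (f x) -> smooth_at (cmap c x) (cmap c' \o f \o cinv c) -> smap_at f x.
Proof.
move=> cf mc mc' cx c'x sf; split=> // d d' md md' dx d'x.
have hc := max_chart mc; have hd := max_chart md; have hc' := max_chart mc'.
apply: (change_chart hA mc md cx dx (f := cmap d' \o f)).
have s2 : smooth_at ((cmap c' \o f \o cinv c) (cmap c x)) (cmap d' \o cinv c').
  by rewrite /= (cinvK hc cx); exact: (change_smooth hB).
apply: smooth_at_eq (smooth_at_comp sf s2).
exact: (near_rep_comp (cmap d') hc hc' cx c'x cf).
Qed.

Section Compose.
Context {n p q : nat} {A : charted R n} {B : charted R p} {C : charted R q}.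
Hypotheses (hA : smooth_atlas A) (hB : smooth_atlas B) (hC : smooth_atlas C).
Variables (f : A -> B) (g : B -> C) (x : A).
Hypotheses (sf : smap_at f x) (sg : smap_at g (f x)).

Lemma smap_at_comp : smap_at (g \o f) x.
Proof.
have [cf Hf] := sf; have [cg Hg] := sg.
split=> [|c c' mc mc' cx c'x]; first exact: (continuous_comp cf cg).
have mb := chart_at_max hB (f x); have bx := chart_at_dom hB (f x).
have hc := max_chart mc; have hb := max_chart mb.
have s2 : smooth_at ((cmap (chart_at B (f x)) \o f \o cinv c) (cmap c x))
    (cmap c' \o g \o cinv (chart_at B (f x))).
  by rewrite /= (cinvK hc cx); exact: Hg.
apply: smooth_at_eq (smooth_at_comp (Hf _ _ mc mb cx bx) s2).
exact: (near_rep_comp (cmap c' \o g) hc hb cx bx cf).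
Qed.

Lemma jac_comp (a : chart R A n) (b : chart R B p) (c : chart R C q) :
  max_atlas A a -> max_atlas B b -> max_atlas C c ->
  cdom a x -> cdom b (f x) -> cdom c (g (f x)) ->
  jac a c (g \o f) x = jac a b f x *m jac b c g (f x).
Proof.
move=> ma mb mc ax bx cx; have [cf Hf] := sf; have [cg Hg] := sg.
have ha := max_chart ma; have hb := max_chart mb.
have E : (cmap b \o f \o cinv a) (cmap a x) = cmap b (f x) by rewrite /= (cinvK ha).
have s1 := Hf _ _ ma mb ax bx.
have s2 : smooth_at ((cmap b \o f \o cinv a) (cmap a x)) (cmap c \o g \o cinv b).
  by rewrite E; exact: Hg.
rewrite /jac -E -(jacobian_comp s1 s2); apply: esym.
apply: (jacobian_eq (smooth_at_comp s1 s2)).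
exact: (near_rep_comp (cmap c \o g) ha hb ax bx cf).
Qed.

End Compose.

Section Germs.
Context {n p : nat} {A : charted R n} {B : charted R p}.
Hypotheses (hA : smooth_atlas A) (hB : smooth_atlas B).
Implicit Types (f g : A -> B).

Lemma jac_eq f g x c c' : max_atlas A c -> max_atlas B c' -> cdom c x ->
  cdom c' (f x) -> {near x, f =1 g} -> smap_at f x -> jac c c' f x = jac c c' g x.
Proof.
move=> mc mc' cx c'x fg [_ Hf].
apply: (jacobian_eq (Hf c c' mc mc' cx c'x)).
by apply: near_sub (near_cinv (max_chart mc) cx fg) _ => v /= ->.
Qed.

Lemma jac_id x c : max_atlas A c -> cdom c x -> jac c c id x = 1%:M.
Proof.
move=> mc cx; rewrite -(jacobian_id (cmap c x)) /jac.
apply: (jacobian_eq (change_smooth hA mc mc cx cx)).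
by apply: near_sub (near_image (max_chart mc) cx) _ => v /= [].
Qed.

Lemma jac_change_unit x c c' : max_atlas A c -> max_atlas A c' -> cdom c x ->
  cdom c' x -> jac c c' id x *m jac c' c id x = 1%:M.
Proof.
move=> mc mc' cx c'x.
by rewrite -(jac_comp (smap_at_id hA x) (smap_at_id hA x)) //; exact: jac_id.
Qed.

Lemma smooth_mapP (U : set A) f : open U ->
  smooth_map U f <-> forall x, U x -> smap_at f x.
Proof.
move=> oU; split=> [[cf Hf] x Ux|H].
  have mc := chart_at_max hA x; have cx := chart_at_dom hA x.
  have mc' := chart_at_max hB (f x); have c'x := chart_at_dom hB (f x).
  have ac : atlas A (chart_at A x) by case: hA => _ _ /(_ x)[].
  have ac' : atlas B (chart_at B (f x)) by case: hB => _ _ /(_ (f x))[].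
  apply: (smap_atI hA hB (cf x Ux) mc mc' cx c'x).
  apply: (smooth_smooth_at _ (Hf _ _ ac ac')); last by exists x.
  have hc := max_chart mc; apply: (open_cmap hc).
  rewrite openE => y [Uy c'y].
  exact: (near_and (open_near oU Uy) (cf y Uy _ (near_cdom (max_chart mc') c'y))).
split=> [x /H[]//|c c' ac ac'].
apply: smooth_at_smooth => _ [x [[Ux c'x] cx] <-].
by have [_] := H x Ux; apply => //; exact: atlas_max.
Qed.

End Germs.

End Maps.

(** * Alternating forms and decomposable multivectors *)

Section Alternating.
Context {R : realType}.

Lemma altformP m n (b : altform R m n) : alternating b.
Proof. exact/asboolP/altfunP. Qed.

Definition setrow m n (A : 'M[R]_(m, n)) i (u : 'rV[R]_n) : 'M[R]_(m, n) :=
  \matrix_k (if k == i then u else row k A).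

Lemma row_setrow m n (A : 'M[R]_(m, n)) i u k :
  row k (setrow A i u) = if k == i then u else row k A.
Proof. by rewrite rowK. Qed.

Lemma setrow_row m n (A : 'M[R]_(m, n)) i : setrow A i (row i A) = A.
Proof. by apply/row_matrixP => k; rewrite row_setrow; case: eqP => // ->. Qed.

Lemma row'_setrow m n (A : 'M[R]_(m, n)) i u v :
  row' i (setrow A i u) = row' i (setrow A i v).
Proof.
apply/matrixP => k l; rewrite !mxE eq_sym (negPf (neq_lift i k)).
by rewrite !mxE.
Qed.

Lemma alt_linear m n (b : altform R m n) A i x u y v :
  b (setrow A i (x *: u + y *: v)) = x * b (setrow A i u) + y * b (setrow A i v).
Proof.
have [_ H] := altformP b; apply: (H _ _ _ i); last 2 first.
- exact: row'_setrow.
- exact: row'_setrow.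
by rewrite !row_setrow eqxx.
Qed.

(** As a function of the row [i] alone, [b] is linear. *)
Lemma alt_setrow0 m n (b : altform R m n) (A : 'M[R]_(m, n)) i :
  (forall j, b (setrow A i (delta_mx 0 j)) = 0) -> b A = 0.
Proof.
move=> H; rewrite -(setrow_row A i) (row_sum_delta (row i A)).
have L x u y v : b (setrow A i u) = 0 -> b (setrow A i v) = 0 ->
    b (setrow A i (x *: u + y *: v)) = 0.
  by move=> u0 v0; rewrite alt_linear u0 v0 !mulr0 addr0.
have z : b (setrow A i 0) = 0.
  by have := alt_linear b A i 0 0 0 0; rewrite !scale0r addr0 !mul0r addr0.
elim/big_ind: _ => // [u v u0 v0|j _].
  by have := L 1 u 1 v u0 v0; rewrite !scale1r.
by have := L (row i A 0 j) (delta_mx 0 j) 0 0 (H j) z; rewrite scale0r addr0.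
Qed.

(** A form is determined by its values on tuples of basis vectors: the rows are
    reduced to basis vectors one after the other. *)
Lemma alt_basis0 m n (b : altform R m n) :
  (forall f : 'I_m -> 'I_n, b (\matrix_i delta_mx 0 (f i)) = 0) ->
  forall A, b A = 0.
Proof.
move=> H A.
suff P k : (k <= m)%N -> forall A : 'M[R]_(m, n),
    (forall i : 'I_m, (k <= i)%N -> exists j, row i A = delta_mx 0 j) -> b A = 0.
  by apply: (P m) => // i; rewrite leqNgt ltn_ord.
elim: k => [|k IH] km {}A HA.
  have [f Hf] : exists f : 'I_m -> 'I_n, forall i, row i A = delta_mx 0 (f i).
    by exists (fun i => projT1 (cid (HA i isT))) => i; case: cid.
  by rewrite -[RHS](H f); congr (b _); apply/row_matrixP => i; rewrite Hf rowK.
apply: (@alt_setrow0 _ _ b A (Ordinal km)) => j; apply: IH; first exact: ltnW.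
move=> i ki; rewrite row_setrow; case: eqP => [_|/eqP ik]; first by exists j.
apply: HA; rewrite ltn_neqAle ki andbT; apply: contra ik => /eqP ik.
by apply/eqP/val_inj.
Qed.

(** Expand the value of [b] when the rows [i] and [j] are both replaced by their
    sum. *)
Lemma alt_swap m n (b : altform R m n) (A : 'M[R]_(m, n)) i j : i != j ->
  b (xrow i j A) = - b A.
Proof.
move=> ij; pose M u v := setrow (setrow A i u) j v.
have E u v : b (M u v) = b (setrow (setrow A j v) i u).
  congr (b _); apply/row_matrixP => k; rewrite !row_setrow.
  by case: (eqVneq k j) => // ->; rewrite eq_sym (negPf ij).
have D u : b (M u u) = 0.
  have [H _] := altformP b; apply: (H _ _ _ ij).
  by rewrite !row_setrow eqxx (negPf ij) eqxx.
have L1 u u' v : b (M (u + u') v) = b (M u v) + b (M u' v).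
  have := alt_linear b (setrow A j v) i 1 u 1 u'.
  by rewrite !scale1r !mul1r -!E.
have L2 u v v' : b (M u (v + v')) = b (M u v) + b (M u v').
  have := alt_linear b (setrow A i u) j 1 v 1 v'.
  by rewrite !scale1r !mul1r.
have EA : A = M (row i A) (row j A).
  by apply/row_matrixP => k; rewrite !row_setrow;
    case: (eqVneq k j) => [->//|_]; case: (eqVneq k i) => [->|].
have EX : xrow i j A = M (row j A) (row i A).
  apply/row_matrixP => k; rewrite !row_setrow.
  have -> : row k (xrow i j A) = row (tperm i j k) A by apply/rowP => l; rewrite !mxE.
  by case: tpermP => [->|->|/eqP/negPf -> /eqP/negPf ->//];
    rewrite ?eqxx ?(negPf ij).
rewrite EX [in RHS]EA; apply/eqP; rewrite -addr_eq0 addrC.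
by have := D (row i A + row j A); rewrite L1 !L2 !D add0r addr0 => ->.
Qed.

Lemma alt_perm m (b : altform R m m) s : b 1%:M = 0 -> b (perm_mx s) = 0.
Proof.
move=> b1; have [ts -> dts] := prod_tpermP s.
elim: ts dts => [_|[i j] ts IH /= /andP[ij dts]].
  by rewrite big_nil perm_mx1.
rewrite big_cons perm_mxM /= -/(tperm_mx i j) -xrowE.
by rewrite alt_swap // IH // oppr0.
Qed.

Lemma det_alternating m : (fun A : 'M[R]_m => \det A : R^o) \in @altpred R m m.
Proof.
apply/asboolP; split=> [A i j ij Aij|A B C i x y]; last exact: determinant_multilinear.
by apply: (determinant_alternate ij) => k; have /rowP/(_ k) := Aij; rewrite !mxE.
Qed.

(** These forms separate decomposable multivectors. *)
Definition detform m n (P : 'M[R]_(n, m)) : altform R m n :=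
  alt_pull P (AltForm (det_alternating m)).

Lemma detformE m n (P : 'M[R]_(n, m)) A : detform P A = \det (A *m P).
Proof. by []. Qed.

(** The difference of the two sides is an alternating form that vanishes on the
    identity matrix, hence on all permutation matrices, hence everywhere. *)
Lemma alt_det m (b : altform R m m) A : b A = \det A * b 1%:M.
Proof.
pose d : altform R m m := AltForm (det_alternating m).
pose D : altform R m m := b - b 1%:M *: d.
have DE B : D B = b B - b 1%:M * \det B by [].
have D1 : D 1%:M = 0 by rewrite DE det1 mulr1 subrr.
suff : D A = 0 by rewrite DE mulrC => /eqP; rewrite subr_eq0 => /eqP.
apply: alt_basis0 => f.
case: (boolP (injectiveb f)) => [/injectiveP fi|/injectivePn[i [j ij fij]]].
  rewrite -[RHS](alt_perm (perm fi) D1); congr (D _).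
  by apply/matrixP => i j; rewrite !mxE eqxx /= permE eq_sym.
by have [H _] := altformP D; apply: (H _ _ _ ij); rewrite !rowK fij.
Qed.

Lemma alt_mulmx m n (b : altform R m n) (B : 'M[R]_m) (V : 'M[R]_(m, n)) :
  b (B *m V) = \det B * b V.
Proof. by have := alt_det (alt_pull V b) B; rewrite /= mul1mx. Qed.

(** If the rows of [V] are dependent, [V = B *m V] for some singular [B]. *)
Lemma alt_row_free m n (b : altform R m n) (V : 'M[R]_(m, n)) :
  b V != 0 -> row_free V.
Proof.
apply: contraR => nfV.
have [u u0 uV] : exists2 u : 'rV[R]_m, u != 0 & u *m V = 0.
  have : kermx V != 0 by rewrite kermx_eq0.
  move=> /rowV0Pn[u]; rewrite sub_kermx => /eqP uV u0; by exists u.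
have [i ui] : exists i, u 0 i != 0.
  by move: u0 => /rV0Pn[i]; exists i.
(* [B] subtracts from the row [i] a multiple of the vanishing combination
   [u *m V], chosen so that [u *m B = 0]. *)
pose B : 'M[R]_m := 1%:M - (u 0 i)^-1 *: (delta_mx i 0 *m u).
have BV : B *m V = V.
  by rewrite mulmxBl mul1mx -scalemxAl -mulmxA uV mulmx0 scaler0 subr0.
have uB : u *m B = 0.
  rewrite mulmxBr mulmx1 -scalemxAr mulmxA -colE (mx11_scalar (col i u)) !mxE.
  by rewrite mul_scalar_mx scalerA mulVf // scale1r subrr.
have : \det B = 0.
  apply/eqP/det0P; by exists u.
by rewrite -BV alt_mulmx => ->; rewrite mul0r.
Qed.

Lemma detform_inv m n (V : 'M[R]_(m, n)) : row_free V -> detform (pinvmx V) V = 1.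
Proof. by move=> fV; rewrite detformE mulmxVp ?det1. Qed.

(** If some vector [p] of the dual annihilates [V] but not [V'], the matrix [P]
    below satisfies [V' *m P = 1] and makes [V *m P] singular. *)
Lemma alt_separate m n (V V' : 'M[R]_(m, n)) : row_free V' ->
  (forall b : altform R m n, b V = 0 -> b V' = 0) -> (V' <= V)%MS.
Proof.
move=> fV' H; apply/negPn/negP => nVV'.
pose C := cokermx V.
have VC : V *m C = 0 by exact: mulmx_coker.
have : V' *m C != 0 by rewrite -submxE.
move=> /matrix0Pn[i [j Cij]].
pose p := col j C.
have Vp : V *m p = 0 by rewrite /p colE mulmxA VC mul0mx.
pose q := V' *m p.
have qi : q i 0 != 0 by rewrite /q /p colE mulmxA -colE mxE.
pose r : 'rV[R]_m := (q i 0)^-1 *: delta_mx 0 i.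
have rq : r *m q = 1%:M.
  rewrite /r -scalemxAl -rowE (mx11_scalar (row i q)) [X in X%:M]mxE scale_scalar_mx.
  by rewrite mulVf.
pose P0 := pinvmx V'.
have V'P0 : V' *m P0 = 1%:M by exact: mulmxVp.
pose P := P0 + (p - P0 *m q) *m r.
have V'P : V' *m P = 1%:M.
  by rewrite mulmxDr V'P0 mulmxA mulmxBr mulmxA V'P0 mul1mx subrr mul0mx addr0.
have Pq : P *m q = p.
  by rewrite mulmxDl -mulmxA rq mulmx1 addrC subrK.
have : detform P V = 0.
  apply/eqP; rewrite detformE -det_tr; apply/det0P; exists q^T.
    by apply: contraNneq qi => q0; rewrite -[q]trmxK q0 !mxE.
  by rewrite -trmx_mul -mulmxA Pq Vp trmx0.
by move=> /H/eqP; rewrite detformE V'P det1 oner_eq0.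
Qed.

End Alternating.

(** * Adapted charts *)

Section Product.
Context {R : realType}.

Lemma continuous_pair (T S S' : topologicalType) (f : T -> S) (g : T -> S') x :
  {for x, continuous f} -> {for x, continuous g} ->
  {for x, continuous (fun y => (f y, g y))}.
Proof. by move=> cf cg; exact: cvg_pair. Qed.

Lemma continuous_row_mx (T : topologicalType) p q s (f : T -> 'M[R]_(p, q))
    (g : T -> 'M[R]_(p, s)) x : {for x, continuous f} -> {for x, continuous g} ->
  {for x, continuous (fun y => row_mx (f y) (g y))}.
Proof.
move=> /continuous_mx cf /continuous_mx cg; apply/continuous_mx => i j.
case Ej: (fintype.split j) => [l|l].
  rewrite (_ : (fun y => _) = fun y => f y i l) //.
  by apply/funext => y; rewrite mxE Ej.
rewrite (_ : (fun y => _) = fun y => g y i l) //.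
by apply/funext => y; rewrite mxE Ej.
Qed.

Lemma near_prod (T S : topologicalType) (P : set T) (Q : set S) (z : T * S) :
  (\forall x \near z.1, P x) -> (\forall y \near z.2, Q y) ->
  \forall w \near z, P w.1 /\ Q w.2.
Proof. by move=> HP HQ; exists (P, Q). Qed.

Lemma near_fst (T S : topologicalType) (P : set T) (z : T * S) :
  (\forall x \near z.1, P x) -> \forall w \near z, P w.1.
Proof.
move=> HP; have HT : \forall y \near z.2, [set: S] y by exact: filterT.
exact: near_sub (near_prod HP HT) (fun w => @proj1 _ _).
Qed.

Lemma prod_chart_is_chart (T S : topologicalType) n p (c : chart R T n)
    (d : chart R S p) : is_chart c -> is_chart d -> is_chart (prod_chart c d).
Proof.
move=> hc hd; have [[oc ic] Kc cc vc] := hc; have [[od jd] Kd cd vd] := hd.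
have sl (v : 'rV[R]_(n + p)) : {for v, continuous (fun u : 'rV[R]_(n + p) => lsubmx u)}.
  exact: smooth_at_continuous (smooth_at_lsubmx (smooth_at_id v)).
have sr (v : 'rV[R]_(n + p)) : {for v, continuous (fun u : 'rV[R]_(n + p) => rsubmx u)}.
  exact: smooth_at_continuous (smooth_at_rsubmx (smooth_at_id v)).
split.
- split.
    rewrite openE => z [z1 z2].
    exact: (near_prod (near_cdom hc z1) (near_cdom hd z2)).
  rewrite openE => _ [z [z1 z2] <-].
  have H1 : \forall v \near cmap (prod_chart c d) z,
      cdom c (cinv c (lsubmx v)) /\ cmap c (cinv c (lsubmx v)) = lsubmx v.
    have X : \forall w \near lsubmx (cmap (prod_chart c d) z),
        cdom c (cinv c w) /\ cmap c (cinv c w) = w.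
      by rewrite /= row_mxKl; exact: near_image.
    exact: (sl _ _ X).
  have H2 : \forall v \near cmap (prod_chart c d) z,
      cdom d (cinv d (rsubmx v)) /\ cmap d (cinv d (rsubmx v)) = rsubmx v.
    have X : \forall w \near rsubmx (cmap (prod_chart c d) z),
        cdom d (cinv d w) /\ cmap d (cinv d w) = w.
      by rewrite /= row_mxKr; exact: near_image.
    exact: (sr _ _ X).
  apply: (near_sub (near_and H1 H2)) => v [[v1 E1] [v2 E2]].
  exists (cinv c (lsubmx v), cinv d (rsubmx v)) => //=.
  by rewrite E1 E2 hsubmxK.
- by move=> z [z1 z2] /=; rewrite row_mxKl row_mxKr Kc // Kd //; case: (z).
- move=> z [z1 z2]; apply: continuous_row_mx.
    by apply: (@continuous_comp _ _ _ fst (cmap c)); [exact: cvg_fst|exact: cc].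
  by apply: (@continuous_comp _ _ _ snd (cmap d)); [exact: cvg_snd|exact: cd].
- move=> z [z1 z2] /=; apply: continuous_pair.
    apply: (@continuous_comp _ _ _ (fun u : 'rV[R]_(n + p) => lsubmx u) (cinv c)).
      exact: sl.
    by rewrite row_mxKl; exact: vc.
  apply: (@continuous_comp _ _ _ (fun u : 'rV[R]_(n + p) => rsubmx u) (cinv d)).
    exact: sr.
  by rewrite row_mxKr; exact: vd.
Qed.

(** The axioms on trivializations are stated for the product atlas, so it has to
    be one for the calculus of smooth maps to apply to them. *)
Lemma prod_atlas n p (A : charted R n) (B : charted R p) :
  smooth_atlas A -> smooth_atlas B -> smooth_atlas (prod_charted A B).
Proof.
move=> hA hB; have [A1 A2 A3] := hA; have [B1 B2 B3] := hB; split.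
- move=> _ [c [d [ac bd ->]]]; apply: prod_chart_is_chart; [exact: A1|exact: B1].
- move=> _ _ [c [d [ac bd ->]]] [c' [d' [ac' bd' ->]]].
  apply: smooth_at_smooth => _ [z [[z1 z2] [z1' z2']] <-] /=.
  apply: smooth_at_row_mx.
    apply: (@smooth_at_comp _ _ _ _ _ _ (fun v : 'rV[R]_(n + p) => lsubmx v)
      (cmap c' \o cinv c)); first exact: smooth_at_lsubmx (smooth_at_id _).
    by rewrite row_mxKl; apply: (change_smooth hA) => //; exact: atlas_max.
  apply: (@smooth_at_comp _ _ _ _ _ _ (fun v : 'rV[R]_(n + p) => rsubmx v)
    (cmap d' \o cinv d)); first exact: smooth_at_rsubmx (smooth_at_id _).
  by rewrite row_mxKr; apply: (change_smooth hB) => //; exact: atlas_max.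
- move=> z; have [a1 d1] := A3 z.1; have [a2 d2] := B3 z.2; split=> //.
  by exists (chart_at A z.1), (chart_at B z.2).
Qed.

End Product.

Section Adapted.
Context {R : realType} {m k : nat} {M : manifold R m} {E : manifold R (m + k)}.
Context {F : manifold R k} {pr : E -> M} (hpr : fiber_bundle F pr).
Let hM := manifold_atlas M.
Let hE := manifold_atlas E.
Let hF := manifold_atlas F.

Lemma pr_smooth y : smap_at pr y.
Proof. by have [/(smooth_mapP hE hM _ openT) H _ _] := hpr; exact: H. Qed.

(** A local trivialization carries a product chart to an adapted chart. *)
Lemma adapted_chart y : exists c d, adapted pr c d /\ cdom c y.
Proof.
have hP := prod_atlas hM hF.
have [_ _ /(_ (pr y))[U [t [s [[oU Uy] st ss K1 K2]]]]] := hpr.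
have cpr z : {for z, continuous pr} by case: (pr_smooth z).
have oV : open (pr @^-1` U).
  by rewrite openE => z Uz; exact: cpr _ (open_near oU Uz).
have {}st z : U (pr z) -> smap_at t z by move/(smooth_mapP hE hF _ oV): st => /(_ z).
have oW : open (U `*` [set: F]).
  rewrite openE => z [z1 _].
  by apply: near_sub (near_fst (open_near oU z1)) _.
have {}ss z : U z.1 -> @smap_at R _ _ (prod_charted M F) E s z.
  by move/(smooth_mapP hP hE _ oW): ss => /(_ z) H Uz; exact: H.
pose d := chart_at M (pr y); pose e := chart_at F (t y).
have md : max_atlas M d by exact: chart_at_max.
have me : max_atlas F e by exact: chart_at_max.
have hd := max_chart md; have he := max_chart me.
pose c0 := prod_chart d e.
have m0 : max_atlas (prod_charted M F) c0.
  apply: (atlas_max hP); exists d, e; split=> //.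
    by case: hM => _ _ /(_ (pr y))[].
  by case: hF => _ _ /(_ (t y))[].
have h0 : is_chart c0 by exact: prod_chart_is_chart.
pose prt z := (pr z, t z).
have cprt z : U (pr z) -> {for z, continuous prt}.
  by move=> Uz; apply: continuous_pair; [exact: cpr|case: (st z Uz)].
pose c : chart R E (m + k) :=
  Chart [set z | U (pr z) /\ cdom c0 (prt z)] (cmap c0 \o prt) (s \o cinv c0).
have hc : is_chart c.
  split.
  - split.
      rewrite openE => z [Uz cz].
      exact: (near_and (cpr z _ (open_near oU Uz)) (cprt z Uz _ (near_cdom h0 cz))).
    rewrite openE => _ [z [Uz cz] <-].
    have H1 := near_image h0 cz.
    have H2 := near_cinv h0 cz (near_fst (z := prt z) (open_near oU Uz)).
    apply: (near_sub (near_and H1 H2)) => v [[cv Ev] Uv].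
    exists (s (cinv c0 v)); last first.
      by rewrite /= /prt; have [-> ->] := K2 _ (cinv c0 v).2 Uv; exact: Ev.
    by rewrite /= /prt; have [-> ->] := K2 _ (cinv c0 v).2 Uv; split=> //; exact: cv.
  - by move=> z [Uz cz]; exact: etrans (congr1 s (cinvK h0 cz)) (K1 z Uz).
  - move=> z [Uz cz]; apply: (@continuous_comp _ _ _ prt (cmap c0)); first exact: cprt.
    by have [_ _ C _] := h0; exact: C.
  - move=> z [Uz cz]; apply: (@continuous_comp _ _ _ (cinv c0) s).
      by have [_ _ _ C] := h0; exact: (C _ cz).
    have -> : cinv c0 (cmap c z) = prt z by exact: (cinvK h0 cz).
    by case: (ss (prt z) Uz).
exists c, d; split; last first.
  by split=> //; split; exact: chart_at_dom.
split=> //.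
- split=> // c' ac'; have mc' := atlas_max hE ac'; split.
    apply: smooth_at_smooth => _ [z [[Uz cz] c'z] <-].
    have [_ H] := ss (prt z) Uz.
    by apply: H => //; rewrite K1.
  apply: smooth_at_smooth => _ [z [c'z [Uz [dz ez]]] <-].
  apply: (smooth_at_row_mx (f := cmap d \o pr \o cinv c')).
    by have [_ H] := pr_smooth z; exact: H.
  by have [_ H] := st z Uz; exact: (H c' e).
- by move=> z [Uz [dz ez]]; split=> //=; rewrite row_mxKl.
Qed.

End Adapted.

(** * Jets of sections and horizontal distributions *)

Section Horizontal.
Context {R : realType} {m k : nat}.

(** In adapted charts [hor S] is the tangent of a section with partial
    derivatives [S], and [ver] is the derivative of the projection. *)
Definition hor (S : 'M[R]_(m, k)) : 'M[R]_(m, m + k) := row_mx 1%:M S.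
Definition ver : 'M[R]_(m + k, m) := col_mx 1%:M 0.

Lemma mulmx_ver q (A : 'M[R]_(q, m + k)) : A *m ver = lsubmx A.
Proof. by rewrite -[A in LHS]hsubmxK mul_row_col mulmx1 mulmx0 addr0. Qed.

Lemma hor_ver S : hor S *m ver = 1%:M.
Proof. by rewrite mulmx_ver row_mxKl. Qed.

(** Right inverses of the projection [K] amount to complements of its kernel: if
    [T = B *m T'], then multiplying by [K] gives [B = 1]. *)
Lemma section_span n (T T' : 'M[R]_(m, n)) (K : 'M[R]_(n, m)) :
  T *m K = 1%:M -> T' *m K = 1%:M -> (T <= T')%MS -> T = T'.
Proof.
move=> TK T'K /submxP[B TB].
by move: TK; rewrite {1}TB -mulmxA T'K mulmx1 => B1; rewrite TB B1 mul1mx.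
Qed.

Lemma hor_inj S S' : (hor S <= hor S')%MS -> S = S'.
Proof.
move=> /(section_span (hor_ver S) (hor_ver S')) /(congr1 (fun A => rsubmx A)).
by rewrite !row_mxKr.
Qed.

End Horizontal.
Arguments ver {R m k}.

Section Frames.
Context {R : realType} {n : nat} {A : charted R n} (hA : smooth_atlas A).

Lemma tcoord_tframe (c : chart R A n) x : max_atlas A c -> cdom c x ->
  tcoord c x *m tframe c x = 1%:M.
Proof.
move=> mc cx; apply: (jac_change_unit hA (chart_at_max hA x) mc) => //.
exact: chart_at_dom.
Qed.

Lemma tframe_tcoord (c : chart R A n) x : max_atlas A c -> cdom c x ->
  tframe c x *m tcoord c x = 1%:M.
Proof.
move=> mc cx; apply: (jac_change_unit hA mc (chart_at_max hA x)) => //.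
exact: chart_at_dom.
Qed.

Lemma tcoord_unit (c : chart R A n) x : max_atlas A c -> cdom c x ->
  tcoord c x \in unitmx.
Proof. by move=> mc cx; have [u _] := mulmx1_unit (tcoord_tframe mc cx); exact: u. Qed.

Lemma tframe_unit (c : chart R A n) x : max_atlas A c -> cdom c x ->
  tframe c x \in unitmx.
Proof. by move=> mc cx; have [u _] := mulmx1_unit (tframe_tcoord mc cx); exact: u. Qed.

Lemma tcoord_chart_at x : tcoord (chart_at A x) x = 1%:M.
Proof. exact: (jac_id hA (chart_at_max hA x) (chart_at_dom hA x)). Qed.

Lemma tframe_tcoord_change (c c' : chart R A n) x : max_atlas A c ->
  max_atlas A c' -> cdom c x -> cdom c' x ->
  tframe c x *m tcoord c' x = jac c c' id x.
Proof.
move=> mc mc' cx c'x; have mx := chart_at_max hA x; have dx := chart_at_dom hA x.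
exact: esym (jac_comp (smap_at_id hA x) (smap_at_id hA x) mc mx mc' cx dx c'x).
Qed.

Lemma change_sfun (c c' : chart R A n) x : max_atlas A c ->
  max_atlas A c' -> cdom c x -> cdom c' x ->
  sfun_at (fun y => tframe c y *m tcoord c' y) x.
Proof.
move=> mc mc' cx c'x; have hc := max_chart mc; have hc' := max_chart mc'.
apply: (sfun_at_eq _ (jac_smooth hA mc mc' cx c'x (smap_at_id hA x))).
apply: near_sub (near_and (near_cdom hc cx) (near_cdom hc' c'x)) _ => y [cy c'y].
by rewrite tframe_tcoord_change.
Qed.

(** [tangent] uses the preferred charts of [x] and [f x], which jump as [x] moves;
    smoothness arguments need charts that stay fixed. *)
Lemma tangent_chart p (B : charted R p) (hB : smooth_atlas B) (c : chart R A n)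
    (c' : chart R B p) (f : A -> B) x :
  max_atlas A c -> max_atlas B c' -> cdom c x -> cdom c' (f x) -> smap_at f x ->
  tangent f x = tcoord c x *m jac c c' f x *m tframe c' (f x).
Proof.
move=> mc mc' cx c'x sf.
have mx := chart_at_max hA x; have dx := chart_at_dom hA x.
have my := chart_at_max hB (f x); have dy := chart_at_dom hB (f x).
have -> : tangent f x = jac (chart_at A x) (chart_at B (f x)) (id \o f) x by [].
rewrite (jac_comp sf (smap_at_id hB (f x)) mx mc' my dx c'x dy); congr (_ *m _).
exact: (jac_comp (smap_at_id hA x) sf mx mc mc' dx cx c'x).
Qed.

End Frames.

Section Jets.
Context {R : realType} {m k : nat} {M : manifold R m} {E : manifold R (m + k)}.
Context {F : manifold R k} {pr : E -> M} (hpr : fiber_bundle F pr).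
Let hM := manifold_atlas M.
Let hE := manifold_atlas E.

Lemma adapted_dom c d y : adapted pr c d -> cdom c y -> cdom d (pr y).
Proof. by case=> _ _ H /H[]. Qed.

Lemma jac_pr c d y : adapted pr c d -> cdom c y -> jac c d pr y = ver.
Proof.
move=> [mc md H] cy; have [s J] := jacobian_affine ver 0 (cmap c y).
rewrite -[RHS]J; apply: esym; apply: (jacobian_eq s).
apply: near_sub (near_image (max_chart mc) cy) _ => v [cv Ev] /=.
by rewrite add0r mulmx_ver; have [_ <-] := H _ cv; rewrite Ev.
Qed.

Lemma tangent_pr c d y : adapted pr c d -> cdom c y ->
  tangent pr y = tcoord c y *m ver *m tframe d (pr y).
Proof.
move=> ad cy; have [mc md _] := ad.
by rewrite -(jac_pr ad cy) (tangent_chart hE hM mc md cy (adapted_dom ad cy)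
  (pr_smooth hpr y)).
Qed.

Lemma section_smooth (phi : local_section pr) x : sdom phi x -> smap_at phi x.
Proof.
by have /(smooth_mapP hM hE _ (sdom_open phi)) := smap_smooth phi; apply.
Qed.

(** The chain rule for [pr \o phi = id]. *)
Lemma section_tangent (phi : local_section pr) x y : sdom phi x -> phi x = y ->
  tangent phi x *m tangent pr y = 1%:M.
Proof.
move=> sx <-; have mx := chart_at_max hM x; have dx := chart_at_dom hM x.
have my := chart_at_max hE (phi x); have dy := chart_at_dom hE (phi x).
have prx := smapK sx.
have dpx : cdom (chart_at M x) (pr (phi x)) by rewrite prx.
have sp := section_smooth sx.
have -> : tangent pr (phi x) = jac (chart_at E (phi x)) (chart_at M x) pr (phi x).
  by rewrite /tangent prx.
rewrite -[tangent phi x]/(jac (chart_at M x) (chart_at E (phi x)) phi x).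
rewrite -(jac_comp sp (pr_smooth hpr (phi x)) mx my mx dx dy dpx).
rewrite -(jac_id hM mx dx); apply: esym.
apply: (jac_eq mx mx dx dx _ (smap_at_id hM x)).
by apply: near_sub (open_near (sdom_open phi) sx) _ => z sz /=; rewrite smapK.
Qed.

(** Again the chain rule, in adapted charts, where [ver] represents [pr]. *)
Lemma section_jac (phi : local_section pr) x c d : adapted pr c d ->
  sdom phi x -> cdom c (phi x) ->
  jac d c phi x = hor (rsubmx (jac d c phi x)).
Proof.
move=> ad sx cx; have [mc md _] := ad; have sp := section_smooth sx.
have dpx := adapted_dom ad cx; have dx : cdom d x by rewrite -(smapK sx).
have : jac d c phi x *m ver = 1%:M.
  rewrite -(jac_pr ad cx) -(jac_comp sp (pr_smooth hpr (phi x)) md mc md dx cx dpx).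
  rewrite -(jac_id hM md dx); apply: esym.
  apply: (jac_eq md md dx dx _ (smap_at_id hM x)).
  by apply: near_sub (open_near (sdom_open phi) sx) _ => z sz /=; rewrite smapK.
by rewrite mulmx_ver /hor => <-; rewrite hsubmxK.
Qed.

Lemma section_tangent_chart (phi : local_section pr) x c d : adapted pr c d ->
  sdom phi x -> cdom c (phi x) ->
  tangent phi x = tcoord d x *m jac d c phi x *m tframe c (phi x).
Proof.
move=> ad sx cx; have [mc md _] := ad.
have dx : cdom d x by rewrite -(smapK sx); exact: adapted_dom cx.
exact: (tangent_chart hM hE md mc dx cx (section_smooth sx)).
Qed.

Lemma jrep_dom (j : jet1 pr) : sdom (jrep j) (jsource j).
Proof. by rewrite /jrep; case: cid2. Qed.

Lemma jclassE (j : jet1 pr) : jclass j = same_jet (jsource j) (jrep j).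
Proof. by rewrite /jrep; case: cid2. Qed.

Lemma pr_jtarget (j : jet1 pr) : pr (jtarget j) = jsource j.
Proof. exact: smapK (jrep_dom j). Qed.

Lemma jet1_eq (j j' : jet1 pr) :
  jsource j = jsource j' -> jclass j = jclass j' -> j = j'.
Proof.
case: j => x C H; case: j' => x' C' H' /= ex eC; subst x' C'.
by congr Jet1; exact: Prop_irrelevance.
Qed.

Lemma same_jet_eq x (phi psi : local_section pr) :
  same_jet x phi psi -> same_jet x phi = same_jet x psi.
Proof.
move=> [h1 h2 h3 h4]; apply/funext => u; apply/propext; split=> -[_ g2 g3 g4].
  exact: And4 h2 g2 (etrans (esym h3) g3) (etrans (esym h4) g4).
exact: And4 h1 g2 (etrans h3 g3) (etrans h4 g4).
Qed.

(** By [section_span], the span of the tangent gives back the tangent. *)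
Lemma jet_ext (j j' : jet1 pr) : jtarget j = jtarget j' ->
  (tangent (jrep j) (jsource j) <= tangent (jrep j') (jsource j'))%MS -> j = j'.
Proof.
move=> ej; have es : jsource j = jsource j' by rewrite -!pr_jtarget ej.
have sj := jrep_dom j; have sj' := jrep_dom j'.
have T := section_tangent sj (erefl (jtarget j)).
have T' := section_tangent sj' (erefl (jtarget j')); rewrite -ej in T'.
move=> /(section_span T T') eT.
apply: jet1_eq (es) _; rewrite !jclassE -es; apply: same_jet_eq.
rewrite -es in sj' eT; have ev : jrep j (jsource j) = jrep j' (jsource j).
  by rewrite -[LHS]/(jtarget j) ej /jtarget es.
exact: And4 sj sj' ev eT.
Qed.

Lemma jet_of_rep (phi : local_section pr) x (hx : sdom phi x) :
  same_jet x phi (jrep (jet_of hx)).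
Proof.
have : jclass (jet_of hx) (jrep (jet_of hx)).
  by rewrite jclassE; split=> //; exact: jrep_dom.
exact.
Qed.

Section Field.
Variables (Psi : E -> jet1 pr) (hPsi : forall y, jtarget (Psi y) = y).

Lemma jet_source y : jsource (Psi y) = pr y.
Proof. by rewrite -pr_jtarget hPsi. Qed.

Lemma jet_rep_dom y : sdom (jrep (Psi y)) (pr y).
Proof. by rewrite -jet_source; exact: jrep_dom. Qed.

Lemma jet_rep_val y : jrep (Psi y) (pr y) = y.
Proof. by rewrite -jet_source; exact: hPsi. Qed.

Lemma jet_dist_chart c d y : adapted pr c d -> cdom c y ->
  (jet_dist Psi y :=: hor (jet_coord c d (Psi y)) *m tframe c y)%MS.
Proof.
move=> ad cy; have [mc md _] := ad; have sx := jet_rep_dom y.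
have ey := jet_rep_val y; have cy' : cdom c (jrep (Psi y) (pr y)) by rewrite ey.
apply: eqmx_trans (genmxE _) _; rewrite (section_tangent_chart ad sx cy') ey.
have -> : jet_coord c d (Psi y) = rsubmx (jac d c (jrep (Psi y)) (pr y)).
  by rewrite /jet_coord jet_source.
rewrite -(section_jac ad sx cy') -mulmxA; apply: eqmxMfull.
by rewrite row_full_unit; exact: (tcoord_unit hM md (adapted_dom ad cy)).
Qed.

End Field.

Lemma jet_field_eq (Psi Psi' : E -> jet1 pr) : jet_field Psi -> jet_field Psi' ->
  eq_dist (jet_dist Psi) (jet_dist Psi') -> Psi = Psi'.
Proof.
move=> [t _] [t' _] e; apply/funext => y; apply: jet_ext; first by rewrite t t'.
by have /andP[+ _] := e y; rewrite !genmxE !jet_source.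
Qed.

(** A distribution complementary to the vertical bundle and smooth: in adapted
    charts it is the row space of [hor S] for a smooth matrix [S]. Jet fields,
    connections and transverse multivector fields all amount to such
    distributions. *)
Definition horizontal (D : distribution E) :=
  forall c d, adapted pr c d -> exists S : E -> 'M[R]_(m, k),
    (forall y, cdom c y -> sfun_at S y) /\
    (forall y, cdom c y -> (D y :=: hor (S y) *m tframe c y)%MS).

Lemma jet_field_horizontal Psi : jet_field (pr := pr) Psi -> horizontal (jet_dist Psi).
Proof.
move=> [t s] c d ad; have [mc _ _] := ad; have hc := max_chart mc.
exists (fun y => jet_coord c d (Psi y)); split=> y cy; last exact: jet_dist_chart.
have /(smooth_inP _ hc openT) sy := s c d ad.
exact: (sfun_atI hE mc cy (sy y I cy)).
Qed.

(** The section that is affine with slope [S] in adapted charts. *)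
Lemma affine_section c d y (S : 'M[R]_(m, k)) : adapted pr c d -> cdom c y ->
  exists phi : local_section pr,
    [/\ sdom phi (pr y), phi (pr y) = y & jac d c phi (pr y) = hor S].
Proof.
move=> ad cy; have [mc md ac] := ad; have hc := max_chart mc; have hd := max_chart md.
have [dy ey] := ac y cy.
pose u0 := cmap d (pr y); pose w0 := rsubmx (cmap c y).
pose a : 'rV[R]_(m + k) := row_mx 0 (w0 - u0 *m S).
pose L u := a + u *m hor S.
have Ll u : lsubmx (L u) = u.
  by rewrite /L /hor mul_mx_row mulmx1 add_row_mx row_mxKl add0r.
have L0 : L u0 = cmap c y.
  rewrite -[RHS]hsubmxK ey /L /hor mul_mx_row mulmx1 add_row_mx add0r subrK.
  by [].
have sL u : smooth_at u L /\ 'J L u = hor S by exact: jacobian_affine.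
have nL : \forall u \near u0, cdom c (cinv c (L u)) /\ cmap c (cinv c (L u)) = L u.
  have := near_image hc cy; rewrite -L0.
  have C : L @ u0 --> L u0 := smooth_at_continuous (sL u0).1.
  by move=> H; exact: (C _ H).
have := near_and (near_cdom hd dy) (near_cmap hd dy nL).
move=> /near_open[V [oV Vy HV]].
pose f x := cinv c (L (cmap d x)).
have fc x : V x -> cdom c (f x) /\ cmap c (f x) = L (cmap d x) by move=> /HV[].
have near_rep x : V x ->
    \forall v \near cmap d x, L v = (cmap c \o f \o cinv d) v.
  move=> Vx; have dx := (HV x Vx).1.
  apply: near_sub (near_and (near_image hd dx) (near_cinv hd dx (open_near oV Vx))) _.
  by move=> v [[_ Ev] Vv] /=; rewrite (fc _ Vv).2 Ev.
have sf : smooth_map V f.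
  apply/(smooth_mapP hM hE _ oV) => x Vx; have [dx _] := HV x Vx.
  have [cx Ex] := fc x Vx.
  apply: (smap_atI hM hE _ md mc dx cx).
    apply: (@continuous_comp _ _ _ (L \o cmap d) (cinv c)).
      apply: (@continuous_comp _ _ _ (cmap d) L).
        by case: hd => _ _ + _; apply.
      exact: smooth_at_continuous (sL _).1.
    by rewrite /= -Ex; case: hc => _ _ _; apply.
  exact: smooth_at_eq (near_rep x Vx) (sL _).1.
have fK x : V x -> pr (f x) = x.
  move=> Vx; have [dx _] := HV x Vx; have [cx Ex] := fc x Vx.
  have [dfx efx] := ac _ cx.
  by rewrite -(cinvK hd dfx) -efx Ex Ll (cinvK hd dx).
exists (LocalSection oV sf fK); split=> //=.
  by rewrite /f -/u0 L0 (cinvK hc cy).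
rewrite -(sL u0).2; apply: esym; exact: (jacobian_eq (sL u0).1 (near_rep _ Vy)).
Qed.

(** The value at [y] is the jet of an affine section tangent to [D] in some adapted
    charts around [y]. The choice of charts does not matter, for the span of a jet
    determines its coordinates in any adapted charts; these are thus the given
    smooth matrices [S]. *)
Lemma horizontal_jet_field D : horizontal D ->
  exists2 Psi, jet_field (pr := pr) Psi & eq_dist (jet_dist Psi) D.
Proof.
move=> hD.
have H y : exists phi : local_section pr,
    [/\ sdom phi (pr y), phi (pr y) = y & (tangent phi (pr y) :=: D y)%MS].
  have [c [d [ad cy]]] := adapted_chart hpr y; have [mc md _] := ad.
  have [S [_ eS]] := hD c d ad.
  have [phi [sy ey Jy]] := affine_section (S y) ad cy.
  exists phi; split=> //.
  have cy' : cdom c (phi (pr y)) by rewrite ey.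
  apply: eqmx_trans (eqmx_sym (eS y cy)).
  rewrite (section_tangent_chart ad sy cy') Jy ey -mulmxA; apply: eqmxMfull.
  by rewrite row_full_unit; exact: (tcoord_unit hM md (adapted_dom ad cy)).
pose phi y := projT1 (cid (H y)); have phiP y := projT2 (cid (H y)).
have sphi y : sdom (phi y) (pr y) by have [] := phiP y.
pose Psi y : jet1 pr := jet_of (sphi y).
have t y : jtarget (Psi y) = y.
  have [_ _ e _] := jet_of_rep (sphi y); have [_ ey _] := phiP y.
  by rewrite /jtarget -[jsource _]/(pr y) -e.
have eD : eq_dist (jet_dist Psi) D.
  move=> y; apply/eqmxP; apply: eqmx_trans (genmxE _) _.
  by have [_ _ _ <-] := jet_of_rep (sphi y); have [_ _] := phiP y.
exists Psi => //; split=> // c d ad.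
have [mc _ _] := ad; have hc := max_chart mc.
have [S [sS eS]] := hD c d ad.
apply/(smooth_inP _ hc openT) => y _ cy.
apply: (sfun_at_eq _ (sS y cy)) => //.
apply: near_sub (near_cdom hc cy) _ => z cz.
apply: hor_inj.
have fz := tframe_unit hE mc cz.
rewrite -[hor (S z)](mulmxK fz) -[hor (jet_coord _ _ _)](mulmxK fz) submxMr //.
rewrite -(eS z cz) -(jet_dist_chart t ad cz).
by have /andP[_] := eD z.
Qed.

End Jets.

(** * Connections *)

#[local] Opaque tangent tcoord tframe jac jacobian.

Lemma proj_mx_unique (K : fieldType) n (D V A : 'M[K]_n) :
  (A <= D)%MS -> (1%:M - A <= V)%MS -> (D :&: V = 0)%MS -> proj_mx D V = A.
Proof.
move=> AD AV DV0; rewrite -[LHS]mul1mx -[1%:M in LHS](subrK A) mulmxDl.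
by rewrite (proj_mx_0 DV0 AV) (proj_mx_id DV0 AD) add0r.
Qed.

Section Conjugation.
Context {K : fieldType} {n : nat}.
Implicit Types A C N T : 'M[K]_n.

Lemma mulmx_regroup A1 A2 B A3 A4 :
  A1 *m A2 *m B *m (A3 *m A4) = A1 *m (A2 *m B *m A3) *m A4 :> 'M[K]_n.
Proof. by rewrite !mulmxA. Qed.

Lemma conj_right p T C N (P : 'M[K]_(n, p)) : C *m T = 1%:M -> N *m P = P ->
  T *m N *m C *m (T *m P) = T *m P.
Proof. by move=> CT NP; rewrite -!mulmxA (mulmxA C) CT mul1mx NP. Qed.

Lemma conj_left0 p T C N (r : 'M[K]_(p, n)) : r *m T *m N = 0 ->
  r *m (T *m N *m C) = 0.
Proof. by move=> H; rewrite !mulmxA H mul0mx. Qed.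

Lemma conj_change T C T' C' N : C' *m T' = 1%:M ->
  T *m C' *m (T' *m N *m C') *m (T' *m C) = T *m N *m C.
Proof.
move=> CT; rewrite -!mulmxA (mulmxA C' T' (_ *m _)) CT mul1mx.
by rewrite (mulmxA C' T') CT mul1mx.
Qed.

Lemma conj_back T C N : C *m T = 1%:M -> N = C *m (T *m N *m C *m T).
Proof. by move=> CT; rewrite -mulmxA CT mulmx1 mulmxA CT mul1mx. Qed.

End Conjugation.

Section Connections.
Context {R : realType} {m k : nat} {M : manifold R m} {E : manifold R (m + k)}.
Context {F : manifold R k} {pr : E -> M} (hpr : fiber_bundle F pr).
Let hM := manifold_atlas M.
Let hE := manifold_atlas E.

Lemma row_full_ver : row_full (ver : 'M[R]_(m + k, m)).
Proof.
apply/row_fullP; exists (row_mx 1%:M 0).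
by rewrite /ver mul_row_col mulmx1 mulmx0 addr0.
Qed.

Lemma tframe_tangent_pr c d y : adapted pr c d -> cdom c y ->
  tframe c y *m tangent pr y = ver *m tframe d (pr y).
Proof.
move=> ad cy; have [mc md _] := ad.
by rewrite (tangent_pr hpr ad cy) -mulmxA mulmxA (tframe_tcoord hE mc cy) mul1mx.
Qed.

Lemma horizontal_frame D y : horizontal (pr := pr) D ->
  exists e : 'M[R]_(m, m + k), (D y :=: e)%MS /\ e *m tangent pr y = 1%:M.
Proof.
move=> hD; have [c [d [ad cy]]] := adapted_chart hpr y; have [mc md _] := ad.
have [S [_ eS]] := hD c d ad; have dy := adapted_dom ad cy.
exists (tcoord d (pr y) *m (hor (S y) *m tframe c y)); split.
  apply: eqmx_trans (eS y cy) _; apply: eqmx_sym; apply: eqmxMfull.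
  by rewrite row_full_unit; exact: (tcoord_unit hM md dy).
rewrite -!mulmxA (tframe_tangent_pr ad cy) (mulmxA (hor _)) hor_ver mul1mx.
exact: (tcoord_tframe hM md dy).
Qed.

Section OnePoint.
Variables (n : nat) (D : 'M[R]_n) (K : 'M[R]_(n, m)) (e : 'M[R]_(m, n)).
Hypotheses (De : (D :=: e)%MS) (eK : e *m K = 1%:M).

Lemma complement_cap : (D :&: kermx K = 0)%MS.
Proof.
apply/eqP/rowV0P => v; rewrite sub_capmx De sub_kermx => /andP[/submxP[w ->]].
by rewrite -mulmxA eK mulmx1 => /eqP->; rewrite mul0mx.
Qed.

(** The matrix [K *m e] vanishes on [ker K] and is the identity on the span of
    [e]. *)
Lemma complement_proj : proj_mx D (kermx K) = K *m e.
Proof.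
apply: proj_mx_unique complement_cap; first by rewrite De submxMl.
by rewrite sub_kermx mulmxBl mul1mx -mulmxA eK mulmx1 subrr.
Qed.

End OnePoint.

Lemma connection_chart D c d (S : E -> 'M[R]_(m, k)) y : adapted pr c d ->
  cdom c y -> (D y :=: hor (S y) *m tframe c y)%MS ->
  proj_mx (D y) (kermx (tangent pr y)) =
    tcoord c y *m (ver *m hor (S y)) *m tframe c y.
Proof.
move=> ad cy eS; have [mc md _] := ad; have dy := adapted_dom ad cy.
have De : (D y :=: tcoord d (pr y) *m (hor (S y) *m tframe c y))%MS.
  apply: eqmx_trans eS _; apply: eqmx_sym; apply: eqmxMfull.
  by rewrite row_full_unit; exact: (tcoord_unit hM md dy).
have eK : tcoord d (pr y) *m (hor (S y) *m tframe c y) *m tangent pr y = 1%:M.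
  rewrite -!mulmxA (tframe_tangent_pr ad cy) (mulmxA (hor _)) hor_ver mul1mx.
  exact: (tcoord_tframe hM md dy).
rewrite (complement_proj De eK) (tangent_pr hpr ad cy) -!mulmxA.
by rewrite (mulmxA (tframe d (pr y))) (tframe_tcoord hM md dy) mul1mx.
Qed.

Lemma horizontal_proj D y : horizontal (pr := pr) D ->
  (proj_mx (D y) (kermx (tangent pr y)) :=: D y)%MS.
Proof.
move=> /(horizontal_frame y)[e [De eK]]; rewrite (complement_proj De eK).
apply: eqmx_trans _ (eqmx_sym De); apply: eqmxMfull.
by apply/row_fullP; exists e.
Qed.

Lemma horizontal_connection D : horizontal (pr := pr) D ->
  ehresmann_connection pr (fun y => proj_mx (D y) (kermx (tangent pr y))).
Proof.
move=> hD; split.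
- move=> a aa; have ma := atlas_max hE aa; have ha := max_chart ma.
  apply/(smooth_inP _ ha openT) => y _ ay.
  have [c [d [ad cy]]] := adapted_chart hpr y; have [mc md _] := ad.
  have [S [sS eS]] := hD c d ad; have hc := max_chart mc.
  suff : sfun_at (fun x =>
      tframe a x *m proj_mx (D x) (kermx (tangent pr x)) *m tcoord a x) y.
    by apply.
  have sH : sfun_at (fun x : E => ver *m hor (S x) : 'M[R]_(m + k)) y.
    have s1 : sfun_at (fun _ : E => 1%:M : 'M[R]_m) y := sfun_at_cst _.
    have s2 : sfun_at (fun _ : E => ver : 'M[R]_(m + k, m)) y := sfun_at_cst _.
    exact: (sfun_at_mulmx s2 (sfun_at_row_mx s1 (sS y cy))).
  apply: (sfun_at_eq _ (sfun_at_mulmx (sfun_at_mulmx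
    (change_sfun hE ma mc ay cy) sH) (change_sfun hE mc ma cy ay))).
  apply: near_sub (near_cdom hc cy) _ => x cx.
  rewrite (connection_chart ad cx (eS x cx)).
  exact: mulmx_regroup.
- move=> y; have [e [De eK]] := horizontal_frame y hD.
  by rewrite (complement_proj De eK) -mulmxA (mulmxA e) eK mul1mx.
- move=> y; have [e [De eK]] := horizontal_frame y hD.
  rewrite (complement_proj De eK); apply/andP; split; rewrite sub_kermx; apply/eqP.
    have := mulmx_ker (tangent pr y *m e).
    move=> /(congr1 (mulmx^~ (tangent pr y))); rewrite mul0mx.
    by rewrite -!mulmxA eK mulmx1.
  by rewrite mulmxA mulmx_ker mul0mx.
Qed.

(** In adapted charts, a projection with vertical kernel is [ver *m hor S]: it
    kills the vertical vectors, and it preserves the horizontal components because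
    [1 - N] takes vertical values. *)
Lemma connection_horizontal N : ehresmann_connection pr N ->
  horizontal (pr := pr) (N : distribution E).
Proof.
move=> [sN NN kN] c d ad; have [mc md _] := ad; have hc := max_chart mc.
pose Nc y := tframe c y *m N y *m tcoord c y.
have NT y : N y *m tangent pr y = tangent pr y.
  have : (1%:M - N y <= kermx (tangent pr y))%MS.
    have /andP[+ _] := kN y; apply: submx_trans.
    by rewrite sub_kermx mulmxBl mul1mx NN subrr.
  by rewrite sub_kermx mulmxBl mul1mx subr_eq0 => /eqP.
have NcE y : cdom c y -> Nc y = ver *m hor (rsubmx (usubmx (Nc y))).
  move=> cy; have dy := adapted_dom ad cy.
  have l : Nc y *m ver = ver.
    apply: (can_inj (mulmxK (tframe_unit hM md dy))).
    rewrite -mulmxA -(tframe_tangent_pr ad cy).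
    exact: (conj_right (tcoord_tframe hE mc cy) (NT y)).
  have dn : dsubmx (Nc y) = 0.
    have /submxP[B EB] : (row_mx 0 1%:M *m tframe c y <= kermx (N y))%MS.
      have /andP[_] := kN y; apply: submx_trans.
      rewrite sub_kermx -mulmxA (tframe_tangent_pr ad cy) mulmxA.
      by rewrite /ver mul_row_col mul0mx mulmx0 addr0 mul0mx.
    have <- : row_mx 0 1%:M *m Nc y = dsubmx (Nc y).
      by rewrite -[Nc y in LHS]vsubmxK mul_row_col mul0mx mul1mx add0r.
    apply: conj_left0; rewrite EB -mulmxA mulmx_ker; exact: mulmx0.
  rewrite -[LHS]vsubmxK dn /ver mul_col_mx mul0mx mul1mx; congr col_mx.
  rewrite /hor -[LHS]hsubmxK; congr row_mx.
  by rewrite -mulmx_ver (mul_usub_mx (Nc y) ver) l col_mxKu.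
exists (fun y => rsubmx (usubmx (Nc y))); split=> y cy.
  apply: sfun_at_rsubmx.
  have ay := chart_at_dom hE y; have ma := chart_at_max hE y.
  have aa : atlas E (chart_at E y) by case: hE => _ _ /(_ y)[].
  have ha := max_chart ma.
  have sa := (smooth_inP _ ha openT).1 (sN _ aa) y I ay.
  have s := sfun_at_mulmx (sfun_at_mulmx (change_sfun hE mc ma cy ay)
    (sfun_atI hE ma ay sa)) (change_sfun hE ma mc ay cy).
  have s' : sfun_at Nc y.
    apply: (sfun_at_eq _ s).
    apply: near_sub (near_and (near_cdom hc cy) (near_cdom ha ay)) _ => x [cx ax].
    exact: (conj_change _ _ _ (tcoord_tframe hE ma ax)).
  have s2 : sfun_at (fun _ : E => row_mx 1%:M 0 : 'M[R]_(m, m + k)) y := sfun_at_cst _.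
  apply: (sfun_at_eq _ (sfun_at_mulmx s2 s')).
  apply: near_sub (near_cdom hc cy) _ => x cx.
  by rewrite -[Nc x in LHS]vsubmxK mul_row_col mul0mx mul1mx addr0.
have EN : N y = tcoord c y *m (ver *m (hor (rsubmx (usubmx (Nc y))) *m tframe c y)).
  rewrite (mulmxA ver) -(NcE y cy).
  exact: (conj_back _ (tcoord_tframe hE mc cy)).
rewrite [X in (X :=: _)%MS]EN.
apply: eqmx_trans (eqmxMfull _ row_full_ver); apply: eqmxMfull.
by rewrite row_full_unit; exact: (tcoord_unit hE mc cy).
Qed.

Lemma orientable_eq n (A : charted R n) (D D' : distribution A) :
  eq_dist D D' -> orientable m D -> orientable m D'.
Proof.
move=> e [X [sX nX iX]]; exists X; split=> // y.
have [N [a [V [VD HX]]]] := iX y; exists N, a, V; split=> // j.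
by rewrite -(eqmxP (e y)).
Qed.

Lemma connection_of_proj (Psi : E -> jet1 pr) : jet_field Psi ->
  eq_dist (connection_of Psi : distribution E) (jet_dist Psi).
Proof.
move=> jP y; apply/eqmxP.
exact: (horizontal_proj y (jet_field_horizontal hpr jP)).
Qed.

(** Both sides amount to horizontal distributions, a connection being recovered
    from its image because its kernel is prescribed. *)
Lemma connection_of_bij :
  set_bij [set Psi | orientable_jet_field (pr := pr) Psi]
          [set N | orientable_connection pr N]
          (connection_of (pr := pr)).
Proof.
split.
- move=> Psi [jP oP]; split.
    exact: (horizontal_connection (jet_field_horizontal hpr jP)).
  by apply: orientable_eq oP => y; have := connection_of_proj jP y; rewrite andbC.
- move=> Psi Psi' /set_mem[jP _] /set_mem[jP' _] e.
  apply: (jet_field_eq hpr jP jP') => y.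
  have /eqmxP e1 := connection_of_proj jP y; have /eqmxP e2 := connection_of_proj jP' y.
  apply/eqmxP; apply: eqmx_trans (eqmx_sym e1) _.
  by rewrite e.
- move=> N [cN oN].
  have [Psi jP eP] := horizontal_jet_field hpr (connection_horizontal cN).
  exists Psi.
    by split=> //; apply: orientable_eq oN => y; have := eP y; rewrite andbC.
  apply/funext => y; have [_ NN kN] := cN; apply: proj_mx_unique.
  - by have /andP[_] := eP y.
  - have /andP[+ _] := kN y; apply: submx_trans.
    by rewrite sub_kermx mulmxBl mul1mx NN subrr.
  - have [e [De eK]] := horizontal_frame y (jet_field_horizontal hpr jP).
    exact: (complement_cap De eK).
Qed.

End Connections.

(** * Transverse decomposable multivector fields *)

Section Scalars.
Context {R : realType} {n : nat} {A : charted R n} (hA : smooth_atlas A).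

Lemma sfun_at_chart1 c x (f : A -> R^o) :
  max_atlas A c -> cdom c x -> smooth_at (cmap c x) (f \o cinv c) -> sfun_at f x.
Proof.
move=> mc cx sf; apply/sfun_at_scalar; apply: (sfun_atI hA mc cx).
exact: (smooth_at_scalar _ _).1 sf.
Qed.

Lemma sfun_at_entries p q (f : A -> 'M[R]_(p, q)) x :
  (forall i j, sfun_at (fun y => f y i j : R^o) x) -> sfun_at f x.
Proof. by move=> H c mc cx; apply/smooth_at_mx => i j; exact: H. Qed.

Lemma sfun_at_entry p q (f : A -> 'M[R]_(p, q)) x i j :
  sfun_at f x -> sfun_at (fun y => f y i j : R^o) x.
Proof. by move=> H c mc cx; have /smooth_at_mx := H c mc cx; apply. Qed.

Lemma smooth_funP (f : A -> R^o) : smooth_fun setT f <-> forall x, sfun_at f x.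
Proof.
split=> [H x|H c ac]; last first.
  apply/smooth_inP => [||x _ cx]; [exact: max_chart (atlas_max hA ac)|exact: openT|].
  exact: H (atlas_max hA ac) cx.
have ax := chart_at_dom hA x; have ma := chart_at_max hA x.
have aa : atlas A (chart_at A x) by case: hA => _ _ /(_ x)[].
apply: (sfun_at_chart1 ma ax).
exact: ((smooth_inP _ (max_chart ma) openT).1 (H _ aa) x I ax).
Qed.

Lemma smooth_mv_at m (X : A -> mvector R m n) c (b : altform R m n) x :
  smooth_mv X -> atlas A c -> cdom c x ->
  sfun_at (fun y => X y (alt_pull (tcoord c y) b) : R^o) x.
Proof.
move=> sX ac cx; have mc := atlas_max hA ac; apply: (sfun_at_chart1 mc cx).
exact: ((smooth_inP _ (max_chart mc) openT).1 (sX c ac b) x I cx).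
Qed.

Lemma frame_smooth m (U : set A) (Y : 'I_m -> A -> 'rV[R]_n) c x :
  open U -> (forall i, smooth_vf U (Y i)) -> U x -> max_atlas A c -> cdom c x ->
  sfun_at (fun y => (\matrix_i Y i y) *m tcoord c y) x.
Proof.
move=> oU sY Ux mc cx; have ax := chart_at_dom hA x; have ma := chart_at_max hA x.
have aa : atlas A (chart_at A x) by case: hA => _ _ /(_ x)[].
have ha := max_chart ma.
have s i : sfun_at (fun y => Y i y *m tcoord c y) x.
  have si : sfun_at (fun y => Y i y *m tcoord (chart_at A x) y) x.
    apply: (sfun_atI hA ma ax).
    exact: ((smooth_inP _ ha oU).1 (sY i _ aa) x Ux ax).
  apply: (sfun_at_eq _ (sfun_at_mulmx si (change_sfun hA ma mc ax cx))).
  apply: near_sub (near_cdom ha ax) _ => y ay.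
  by rewrite -mulmxA (mulmxA (tcoord _ y)) (tcoord_tframe hA ma ay) mul1mx.
apply: sfun_at_entries => i j; apply: (sfun_at_eq _ (sfun_at_entry 0 j (s i))).
apply: near_sub (near_cdom (max_chart mc) cx) _ => y _.
by rewrite -[Y i y](rowK (fun i => Y i y)) -row_mul mxE.
Qed.

(** Whatever decomposition is picked in the definition of [mv_dist], its span is
    determined by the multivector, by [alt_separate]. *)
Lemma mv_distE m (X : A -> mvector R m n) x V :
  (exists U Y, U x /\ decomposition X U Y) -> row_free V ->
  (forall b : altform R m n, X x b = b V) -> (mv_dist X x :=: V)%MS.
Proof.
move=> [U [Y [Ux dX]]] fV HV; apply: eqmx_trans (genmxE _) _.
set P := (P in xget _ P).
have PV0 : P (xget 0 P).
  by apply: (xgetPex 0 (P := P)); exists (\matrix_(i < m) Y i x), U, Y.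
set V0 := xget 0 P in PV0 *.
have {PV0} HV0 b : X x b = b V0.
  by have [U' [Y' [U'x [_ _ dX'] ->]]] := PV0; exact: dX'.
have fV0 : row_free V0.
  apply: (@alt_row_free _ _ _ (detform (pinvmx V))).
  by rewrite -HV0 HV (detform_inv fV) oner_eq0.
apply/eqmxP/andP; split; apply: alt_separate => // b.
  by rewrite -HV -HV0.
by rewrite -HV -HV0.
Qed.

End Scalars.

Section BumpForm.
Context {R : realType} {m : nat} (M : manifold R m).
Let hM := manifold_atlas M.

(** Transversality is tested on global forms only; a bump function provides one
    that does not vanish at a given point. *)
Lemma bump_form (x0 : M) :
  exists b : M -> altform R m m, smooth_form b /\ b x0 != 0.
Proof.
have [[hausM _] _ _ _] := manifoldP M.
have md := chart_at_max hM x0; have dx0 := chart_at_dom hM x0.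
set d := chart_at M x0 in md dx0; have hd := max_chart md.
have := near_image hd dx0; set c0 := cmap d x0 => nI.
have [rho /= rho0 Hrho] := (nbhs_ballP c0 _).1 nI.
pose r := rho / 2; have r0 : 0 < r by rewrite divr_gt0.
have [beta [sb b0 supp]] := @bump R m c0 r r0.
pose B := [set v : 'rV[R]_m | `|v - c0| <= r].
have BI v : B v -> cdom d (cinv d v) /\ cmap d (cinv d v) = v.
  move=> Bv; apply: Hrho; rewrite -ball_normE /ball_ /= distrC.
  apply: le_lt_trans Bv _; rewrite /r; lra.
have cB : compact B.
  apply: bounded_closed_compact.
    exists (`|c0| + r); split; first exact: num_real.
    move=> s hs v Bv; have := ler_normD (v - c0) c0; rewrite subrK.
    move=> /le_trans; apply; rewrite addrC; apply: le_trans (ltW hs).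
    by rewrite lerD2l.
  have -> : B = closed_ball c0 r; last exact: closed_ball_closed.
  rewrite closed_ballE //; apply/seteqP.
  by split=> v; rewrite /B /closed_ball_ /= distrC.
pose K := cinv d @` B.
have cK : closed K.
  apply: (compact_closed hausM); apply: continuous_compact cB.
  apply: continuous_in_subspaceT => v /set_mem Bv; have [dv Ev] := BI v Bv.
  by case: hd => _ _ _ /(_ _ dv); rewrite Ev.
(* The bump, extended by 0 outside the chart: it is smooth there as well because
   its support lies in [K], which is closed since it is compact. *)
pose g (x : M) : R^o := if `[< cdom d x >] then beta (cmap d x) else 0.
have gK x : ~ K x -> g x = 0.
  rewrite /g; case: asboolP => // dx nK; apply/eqP/negPn/negP => /supp Bx.
  by apply: nK; exists (cmap d x) => //; rewrite (cinvK hd dx).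
pose b (x : M) : altform R m m := g x *: alt_pull (tcoord d x) (detform 1%:M).
have bE x V : b x V = g x * \det (V *m tcoord d x).
  by rewrite -[RHS]/(_ * _) -[in RHS](mulmx1 (V *m tcoord d x)).
exists b; split; last first.
  have : b x0 1%:M != 0.
    rewrite bE mul1mx (tcoord_chart_at hM) det1 mulr1 /g.
    by case: asboolP.
  by apply: contraNneq => ->.
move=> c ac V; have mc := atlas_max hM ac; have hc := max_chart mc.
apply/(smooth_inP _ hc openT) => x _ cx.
suff : sfun_at (fun x => b x (V *m tframe c x) : R^o) x by apply.
have [Kx|nKx] := pselect (K x); last first.
  have s0 : sfun_at (fun _ : M => 0 : R^o) x := sfun_at_cst _.
  apply: (sfun_at_eq _ s0).
  have oK : open (~` K) by exact: closed_openC.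
  apply: near_sub (open_near oK nKx) _ => y /gK gy.
  by rewrite bE gy mul0r.
have dx : cdom d x by case: Kx => v /BI[dv _] <-.
have sg : sfun_at g x.
  apply: (sfun_at_chart1 hM md dx); apply: smooth_at_eq (sb (cmap d x)).
  apply: near_sub (near_image hd dx) _ => v [dv Ev] /=.
  by rewrite /g; case: asboolP => // _; rewrite Ev.
have sV : sfun_at (fun _ : M => V) x := sfun_at_cst _.
have sd := sfun_at_det (sfun_at_mulmx sV (change_sfun hM mc md cx dx)).
apply: (sfun_at_eq _ (sfun_at_mul sg sd)).
by apply: near_sub (near_cdom hd dx) _ => y _; rewrite bE mulmxA.
Qed.

End BumpForm.

(** * Multivector fields and horizontal distributions *)

Section Ldt.
Context {R : realType} {m k : nat} {M : manifold R m} {E : manifold R (m + k)}.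
Context {F : manifold R k} {pr : E -> M} (hpr : fiber_bundle F pr).
Let hM := manifold_atlas M.
Let hE := manifold_atlas E.
Implicit Types (X : E -> mvector R m (m + k)) (V : 'M[R]_(m, m + k)).

Lemma alt1_neq0 (b : altform R m m) : b != 0 -> b 1%:M != 0.
Proof.
apply: contra_neq => b1; apply: val_inj; apply/funext => A.
by rewrite -[LHS]/(b A) alt_det b1 mulr0.
Qed.

(** Pulled back to [E], an m-form [b] takes the value [\det (V *m T) * b 1] on [V],
    where [T] is the derivative of [pr]. *)
Lemma transverse_unit X y V : transverse pr X ->
  (forall b : altform R m (m + k), X y b = b V) -> V *m tangent pr y \in unitmx.
Proof.
move=> tX HV; have [b [sb b0]] := bump_form (pr y).
have := tX y b sb b0; rewrite HV -[alt_pull _ _ V]/(b (pr y) (V *m tangent pr y)).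
by rewrite alt_det mulf_eq0 negb_or unitmxE unitfE => /andP[].
Qed.

Lemma unit_transverse X :
  (forall y, exists V, (forall b : altform R m (m + k), X y b = b V) /\
     V *m tangent pr y \in unitmx) -> transverse pr X.
Proof.
move=> H y b sb /alt1_neq0 b1; have [V [HV uV]] := H y.
rewrite HV -[alt_pull _ _ V]/(b (pr y) (V *m tangent pr y)) alt_det mulf_neq0 //.
by rewrite -unitfE -unitmxE.
Qed.

Lemma unit_row_free n (V : 'M[R]_(m, n)) (K : 'M[R]_(n, m)) :
  V *m K \in unitmx -> row_free V.
Proof.
move=> u; rewrite /row_free eqn_leq rank_leq_row /=.
by rewrite -{1}(mxrank_unit u) mxrankM_maxl.
Qed.

Lemma ldt_point X y : ldt_field pr X -> exists V,
  [/\ (forall b : altform R m (m + k), X y b = b V), V *m tangent pr y \in unitmx &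
      (mv_dist X y :=: V)%MS].
Proof.
move=> [_ dX tX]; have [U Uy [Y dY]] := dX y; have [_ _ HY] := dY.
exists (\matrix_(i < m) Y i y).
have HV := HY y Uy; have uV := transverse_unit tX HV.
split=> //; apply: mv_distE (unit_row_free uV) HV.
by exists U, Y.
Qed.

Lemma hor_slope (W : 'M[R]_(m, m + k)) : lsubmx W \in unitmx ->
  hor (invmx (lsubmx W) *m rsubmx W) = invmx (lsubmx W) *m W.
Proof. by move=> u; rewrite -{4}[W]hsubmxK mul_mx_row mulVmx. Qed.

(** The matrix [S] for which [V] and [hor S] span the same space in the chart
    [c]. *)
Definition slope (c : chart R E (m + k)) (y : E) V : 'M[R]_(m, k) :=
  invmx (lsubmx (V *m tcoord c y)) *m rsubmx (V *m tcoord c y).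

Section Slope.
Variables (c : chart R E (m + k)) (d : chart R M m) (y : E) (V : 'M[R]_(m, m + k)).
Hypotheses (ad : adapted pr c d) (cy : cdom c y) (uV : V *m tangent pr y \in unitmx).

Lemma slope_unit : lsubmx (V *m tcoord c y) \in unitmx.
Proof.
have [mc md _] := ad; have := uV.
rewrite (tangent_pr hpr ad cy) !mulmxA unitmx_mul mulmx_ver.
by case/andP.
Qed.

Lemma slope_span : (V :=: hor (slope c y V) *m tframe c y)%MS.
Proof.
have [mc md _] := ad; have u := slope_unit.
have -> : hor (slope c y V) = invmx (lsubmx (V *m tcoord c y)) *m (V *m tcoord c y).
  exact: hor_slope.
rewrite -!mulmxA (tcoord_tframe hE mc cy) mulmx1; apply: eqmx_sym.
by apply: eqmxMfull; rewrite row_full_unit unitmx_inv.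
Qed.

End Slope.

Lemma slope_eq c d y V (S : 'M[R]_(m, k)) : adapted pr c d -> cdom c y ->
  V *m tangent pr y \in unitmx -> (V <= hor S *m tframe c y)%MS -> S = slope c y V.
Proof.
move=> ad cy uV VS; have [mc _ _] := ad; apply: esym.
apply: hor_inj; have u := tframe_unit hE mc cy.
rewrite -[hor S](mulmxK u) -[hor (slope c y V)](mulmxK u); apply: submxMr.
by rewrite -(slope_span ad cy uV).
Qed.

(** The slope does not depend on the decomposition, and it is smooth since it can
    be computed locally from a smooth one. *)
Lemma ldt_horizontal X : ldt_field pr X -> horizontal (pr := pr) (mv_dist X).
Proof.
move=> lX c d ad; have [mc md _] := ad; have hc := max_chart mc.
pose W y := projT1 (cid (ldt_point y lX)); have HW y := projT2 (cid (ldt_point y lX)).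
exists (fun y => slope c y (W y)); split=> y cy; last first.
  by have [_ u e] := HW y; exact: eqmx_trans e (slope_span ad cy u).
have [_ dX tX] := lX; have [U Uy [Y [oU sY dY]]] := dX y.
pose V x := \matrix_(i < m) Y i x.
have uV x : U x -> V x *m tangent pr x \in unitmx.
  by move=> Ux; exact: transverse_unit tX (dY x Ux).
have sV : sfun_at (fun x => V x *m tcoord c x) y := frame_smooth hE oU sY Uy mc cy.
have u := slope_unit ad cy (uV y Uy).
apply: (sfun_at_eq _ (sfun_at_mulmx (sfun_at_invmx (sfun_at_lsubmx sV) u)
  (sfun_at_rsubmx sV))).
apply: near_sub (near_and (near_cdom hc cy) (open_near oU Uy)) _ => x [cx Ux].
apply: esym; apply: (slope_eq ad cx (uV x Ux)).
have [_ uW eW] := HW x; rewrite -(slope_span ad cx uW) -eW.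
have : (mv_dist X x :=: V x)%MS.
  apply: (mv_distE _ (unit_row_free (uV x Ux)) (dY x Ux)).
  by exists U, Y.
by move=> ->.
Qed.

Lemma ldt_of_frames X D : smooth_mv X -> horizontal (pr := pr) D ->
  (forall y, exists U Y, [/\ U y, decomposition X U Y &
     ((\matrix_(i < m) Y i y) :=: D y)%MS]) ->
  ldt_field pr X /\ eq_dist (mv_dist X) D.
Proof.
move=> sX hD H.
have unitV y V : (V :=: D y)%MS -> V *m tangent pr y \in unitmx.
  move=> VD; have [e [De eK]] := horizontal_frame hpr y hD.
  have : (e <= V)%MS by rewrite VD De.
  move=> /submxP[B eB]; rewrite eB -mulmxA in eK.
  by have [_ u] := mulmx1_unit eK; exact: u.
split.
  split=> // [y|]; first by have [U [Y [Uy dY _]]] := H y; exists U => //; exists Y.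
  apply: unit_transverse => y; have [U [Y [Uy [_ _ dY] VD]]] := H y.
  by exists (\matrix_(i < m) Y i y); split; [exact: dY|exact: unitV].
move=> y; have [U [Y [Uy dY VD]]] := H y; apply/eqmxP; apply: eqmx_trans _ (VD).
apply: (mv_distE _ (unit_row_free (unitV y _ VD))); first by exists U, Y.
by have [_ _] := dY; apply.
Qed.

Lemma eval_linear V :
  linear (fun b : altform R m (m + k) => b V : R^o).
Proof. by []. Qed.

Definition eval_mv V : mvector R m (m + k) :=
  HB.pack (fun b : altform R m (m + k) => b V : R^o)
    (GRing.isLinear.Build R _ _ _ (fun b : altform R m (m + k) => b V : R^o)
       (eval_linear V)).

(** An orientation is locally a multiple of the exterior product of a frame, and
    the factor is absorbed in the first vector. In dimension 0, where there is no
    such vector, the empty exterior product is taken instead. *)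
Lemma orientable_ldt D : horizontal (pr := pr) D -> orientable m D ->
  exists2 X, ldt_field pr X & eq_dist (mv_dist X) D.
Proof.
move=> hD [X0 [sX nX iX]].
have [m0|m_gt0] := posnP m.
  have flat p (V V' : 'M[R]_(m, p)) : V = V'.
    by apply/matrixP => i; have := ltn_ord i; rewrite {2}m0.
  pose X (_ : E) := eval_mv 0.
  have [] := @ldt_of_frames X D => //.
  - move=> c ac b; have mc := atlas_max hE ac; have hc := max_chart mc.
    apply/(smooth_inP _ hc openT) => x _ cx.
    have s0 : sfun_at (fun _ : E => b 0 : R^o) x := sfun_at_cst _.
    apply: smooth_at_eq (s0 c mc cx); near=> v => /=.
    by congr (b _); exact: flat.
  - move=> y; exists setT, (fun _ _ => 0); split=> //.
      split; [exact: openT|move=> i|move=> x _ b].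
        by have := ltn_ord i; rewrite {2}m0.
      by congr (b _); exact: flat.
    have [e [De _]] := horizontal_frame hpr y hD.
    by rewrite (flat _ (\matrix_i _) e); exact: eqmx_sym.
  by move=> lX eX; exists X.
pose i0 := Ordinal m_gt0.
have [] := @ldt_of_frames X0 D => //; last by move=> lX eX; exists X0.
move=> y0; have [c [d [ad cy0]]] := adapted_chart hpr y0; have [mc md _] := ad.
have hc := max_chart mc; have [S [sS eS]] := hD c d ad.
pose e y := hor (S y) *m tframe c y.
pose f y : R^o := X0 y (alt_pull (tcoord c y) (detform ver)).
(* [ver] is chosen so that the form defining [f] takes the value 1 on [e]. *)
have Xe y : cdom c y -> forall b, X0 y b = f y * b (e y).
  move=> cy; have [N [a [V [VD HX]]]] := iX y.
  have HB j : exists B : 'M[R]_m, V j = B *m e y.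
    by apply/submxP; rewrite -(eS y cy).
  pose B j := projT1 (cid (HB j)); have EB j : V j = B j *m e y := projT2 (cid (HB j)).
  have HX' b : X0 y b = (\sum_(j < N) a j * \det (B j)) * b (e y).
    by rewrite HX mulr_suml; apply: eq_bigr => j _; rewrite EB alt_mulmx mulrA.
  have -> : f y = \sum_(j < N) a j * \det (B j).
    rewrite /f HX'.
    rewrite -[alt_pull _ _ (e y)]/(\det (e y *m tcoord c y *m ver)).
    by rewrite /e -(mulmxA (hor _)) (tframe_tcoord hE mc cy) mulmx1 hor_ver det1 mulr1.
  exact: HX'.
have f0 y : cdom c y -> f y != 0.
  move=> cy; have [b] := nX y; rewrite (Xe y cy).
  by apply: contra_neq => ->; rewrite mul0r.
have se a y : max_atlas E a -> cdom a y -> cdom c y ->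
    sfun_at (fun x => e x *m tcoord a x) y.
  move=> ma ay cy.
  have s1 : sfun_at (fun _ : E => 1%:M : 'M[R]_m) y := sfun_at_cst _.
  apply: (sfun_at_eq _ (sfun_at_mulmx (sfun_at_row_mx s1 (sS y cy))
    (change_sfun hE mc ma cy ay))).
  by apply: near_sub (near_cdom hc cy) _ => x _; rewrite /e -mulmxA.
have sf y : cdom c y -> sfun_at f y.
  move=> cy; have ay := chart_at_dom hE y; have ma := chart_at_max hE y.
  have aa : atlas E (chart_at E y) by case: hE => _ _ /(_ y)[].
  set a := chart_at E y in ay ma aa.
  have fe : row_free (e y).
    apply: (@unit_row_free _ _ (tcoord c y *m ver)).
    rewrite mulmxA /e -(mulmxA (hor _)) (tframe_tcoord hE mc cy) mulmx1 hor_ver.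
    exact: unitmx1.
  (* The chart [c] may be outside the atlas, on which the smoothness of [X0] is
     expressed: [f] is recovered as a quotient of values on a form that is constant
     in the chart [a]. *)
  pose P := pinvmx (e y).
  have sP : sfun_at (fun _ : E => P) y := sfun_at_cst _.
  have sq := sfun_at_mulmx (se a y ma ay cy) sP.
  have q1 : e y *m tcoord a y *m P = 1%:M.
    by rewrite (tcoord_chart_at hE) mulmx1 mulmxVp.
  have q0 : \det (e y *m tcoord a y *m P) != 0 by rewrite q1 det1 oner_eq0.
  have uq : e y *m tcoord a y *m P \in unitmx by rewrite q1 unitmx1.
  have sg := smooth_mv_at hE (detform P) sX aa ay.
  apply: (sfun_at_eq _ (sfun_at_mul sg (sfun_at_inv q0 (sfun_at_det sq)))).
  apply: near_sub (near_and (sfun_at_unitmx hE sq uq) (near_cdom hc cy)) _ => x [ux cx].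
  rewrite (Xe x cx) -[alt_pull _ _ (e x)]/(\det (e x *m tcoord a x *m P)).
  by rewrite unitmxE unitfE in ux; exact: (mulfK ux).
(* Multiplication by [Dm] multiplies the first vector of the frame by [f]. *)
pose Dm y : 'M[R]_m := diag_mx (\row_j (if j == i0 then f y else 1)).
have detD y : \det (Dm y) = f y.
  rewrite det_diag (bigD1 i0) //= mxE eqxx big1 ?mulr1 // => j ji.
  by rewrite mxE (negPf ji).
have sD y : cdom c y -> sfun_at Dm y.
  move=> cy; apply: sfun_at_entries => i j.
  have s1 (x : R) : sfun_at (fun _ : E => x : R^o) y := sfun_at_cst _.
  have [->|ij] := eqVneq i j; last first.
    apply: (sfun_at_eq _ (s1 0)).
    by apply: near_sub (near_cdom hc cy) _ => x _; rewrite !mxE (negPf ij).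
  have [->|ji] := eqVneq j i0.
    apply: (sfun_at_eq _ (sf y cy)).
    by apply: near_sub (near_cdom hc cy) _ => x _; rewrite !mxE !eqxx.
  apply: (sfun_at_eq _ (s1 1)).
  by apply: near_sub (near_cdom hc cy) _ => x _; rewrite !mxE (negPf ji) eqxx.
pose Y i y := row i (Dm y *m e y).
have EY y : \matrix_(i < m) Y i y = Dm y *m e y.
  by apply/row_matrixP => i; rewrite rowK.
exists (cdom c), Y; split=> //.
- have oc : open (cdom c) by case: hc => -[].
  split=> // [i a aa|x cx b]; last by rewrite (Xe x cx) EY alt_mulmx detD.
  have ma := atlas_max hE aa; have ha := max_chart ma.
  apply/(smooth_inP _ ha oc) => x cx ax.
  suff : sfun_at (fun x => Y i x *m tcoord a x) x by apply.
  have si : sfun_at (fun _ : E => delta_mx 0 i : 'rV[R]_m) x := sfun_at_cst _.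
  apply: (sfun_at_eq _ (sfun_at_mulmx si (sfun_at_mulmx (sD x cx) (se a x ma ax cx)))).
  by apply: near_sub (near_cdom hc cx) _ => z _; rewrite /Y rowE -!mulmxA.
- rewrite EY; apply: eqmx_trans _ (eqmx_sym (eS y0 cy0)); apply: eqmxMfull.
  by rewrite row_full_unit unitmxE unitfE detD f0.
Unshelve. all: by end_near. Qed.

Lemma ldt_nonvanishing X : ldt_field pr X -> nonvanishing X.
Proof.
move=> lX y; have [V [HV uV _]] := ldt_point y lX; have fV := unit_row_free uV.
by exists (detform (pinvmx V)); rewrite HV (detform_inv fV) oner_eq0.
Qed.

Lemma ldt_orientable X : ldt_field pr X -> orientable m (mv_dist X).
Proof.
move=> lX; have [sX _ _] := lX; exists X; split=> // [|y].
  exact: ldt_nonvanishing.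
have [V [HV _ eV]] := ldt_point y lX.
exists 1, (fun _ => 1), (fun _ => V); split=> [_|b]; first by rewrite eV.
by rewrite big_ord1 mul1r HV.
Qed.

(** Proportional decomposable multivectors have the same span, by [alt_separate].
    Conversely, two frames of one space differ by a matrix whose determinant is
    the ratio [f]; near a point [f] is the quotient of the values on one constant
    form, hence smooth. *)
Lemma ldt_equiv X X' : ldt_field pr X -> ldt_field pr X' ->
  mv_equiv X X' <-> eq_dist (mv_dist X) (mv_dist X').
Proof.
move=> lX lX'; have nX := ldt_nonvanishing lX; have nX' := ldt_nonvanishing lX'.
split=> [[_ _ [f [_ f0 Hf]]] y|eXX'].
  have [V [HV uV eV]] := ldt_point y lX; have [V' [HV' uV' eV']] := ldt_point y lX'.
  apply/eqmxP; apply: eqmx_trans eV _; apply: eqmx_trans _ (eqmx_sym eV').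
  have H (b : altform R m (m + k)) : b V' = f y * b V by have := Hf y b; rewrite HV HV'.
  apply/eqmxP/andP; split.
    apply: (alt_separate (unit_row_free uV)) => b b0.
    by move: (H b); rewrite b0 => /esym/eqP; rewrite mulf_eq0 (negPf (f0 y)) => /eqP.
  by apply: (alt_separate (unit_row_free uV')) => b b0; rewrite H b0 mulr0.
have H y : exists r : R, forall b, X' y b = r * X y b.
  have [V [HV uV eV]] := ldt_point y lX; have [V' [HV' uV' eV']] := ldt_point y lX'.
  have /submxP[B EB] : (V' <= V)%MS by rewrite -eV -eV' (eqmxP (eXX' y)).
  by exists (\det B) => b; rewrite HV HV' EB alt_mulmx.
pose f y : R^o := projT1 (cid (H y)).
have Hf y b : X' y b = f y * X y b := projT2 (cid (H y)) b.
split=> //; exists f; split=> // [|y]; last first.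
  have [b] := nX' y; rewrite Hf; apply: contra_neq => ->; exact: mul0r.
apply/(smooth_funP hE) => y; have ay := chart_at_dom hE y; have ma := chart_at_max hE y.
have aa : atlas E (chart_at E y) by case: hE => _ _ /(_ y)[].
set a := chart_at E y in ay ma aa.
have [b b0] := nX y.
have eb : alt_pull (tcoord a y) b = b.
  apply: val_inj; apply/funext => V; rewrite -[LHS]/(b (V *m tcoord a y)).
  by rewrite (tcoord_chart_at hE) mulmx1.
have [sX _ _] := lX; have [sX' _ _] := lX'.
have s := smooth_mv_at hE b sX aa ay; have s' := smooth_mv_at hE b sX' aa ay.
have nz : X y (alt_pull (tcoord a y) b) != 0 by rewrite eb.
apply: (sfun_at_eq _ (sfun_at_mul s' (sfun_at_inv nz s))).
have cs := sfun_at_continuous hE s.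
have nn : \forall x \near y, X x (alt_pull (tcoord a x) b) != 0.
  exact: (cs _ (open_near (@open_neq R 0) nz)).
by apply: near_sub nn _ => x nzx; rewrite Hf mulfK.
Qed.

End Ldt.

(** * Integrability *)

Section Integrability.
Context {R : realType} {m k : nat} {M : manifold R m} {E : manifold R (m + k)}.
Context {F : manifold R k} {pr : E -> M} (hpr : fiber_bundle F pr).
Let hM := manifold_atlas M.
Let hE := manifold_atlas E.
Let hU := @euclid_atlas R m.

Lemma integrable_dist_eq n (A : charted R n) (D D' : distribution A) :
  eq_dist D D' -> integrable_dist m D -> integrable_dist m D'.
Proof.
move=> e H y; have [V [j [oV ij sj zy tj]]] := H y.
exists V, j; split=> // z Vz; apply/eqmxP.
exact: eqmx_trans (eqmxP (tj z Vz)) (eqmxP (e (j z))).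
Qed.

Let idc : chart R (euclid R m) m := Chart setT id id.

Lemma idc_max : max_atlas (euclid R m) idc.
Proof. exact: (atlas_max hU). Qed.

Lemma cinv_smooth (d : chart R M m) (z : euclid R m) : max_atlas M d ->
  cdom d (cinv d z) -> cmap d (cinv d z) = z ->
  @smap_at R m m (euclid R m) M (cinv d) z.
Proof.
move=> md dz Ez; have hd := max_chart md.
have cz : {for z, continuous (cinv d)}.
  by case: hd => _ _ _ /(_ _ dz); rewrite Ez.
apply: (smap_atI hU hM cz idc_max md I dz).
apply: smooth_at_eq (smooth_at_id z).
have := near_image hd dz; rewrite Ez => H.
by apply: near_sub H _ => v [_ Ev] /=; rewrite Ev.
Qed.

Lemma cmap_smooth (d : chart R M m) (g : 'rV[R]_m -> 'rV[R]_m) x : max_atlas M d ->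
  cdom d x -> smooth_at (cmap d x) g ->
  @smap_at R m m M (euclid R m) (g \o cmap d) x.
Proof.
move=> md dx sg; have hd := max_chart md.
have cg : {for x, continuous (g \o cmap d)}.
  apply: continuous_comp; first by case: hd => _ _ + _; apply.
  exact: smooth_at_continuous sg.
apply: (smap_atI hM hU cg md idc_max dx I).
apply: smooth_at_eq sg.
by apply: near_sub (near_image hd dx) _ => v [_ Ev] /=; rewrite Ev.
Qed.

Lemma tangent_comp n p q (A : charted R n) (B : charted R p) (C : charted R q)
    (hA : smooth_atlas A) (hB : smooth_atlas B) (hC : smooth_atlas C)
    (f : A -> B) (g : B -> C) x : smap_at f x -> smap_at g (f x) ->
  tangent (g \o f) x = tangent f x *m tangent g (f x).
Proof.
move=> sf sg; exact: (jac_comp sf sg (chart_at_max hA x) (chart_at_max hB (f x))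
  (chart_at_max hC (g (f x))) (chart_at_dom hA x) (chart_at_dom hB (f x))
  (chart_at_dom hC (g (f x)))).
Qed.

Lemma tangent_id_of n (A : charted R n) (hA : smooth_atlas A) (f : A -> A) x :
  {near x, f =1 id} -> tangent f x = 1%:M.
Proof.
move=> fid; have ma := chart_at_max hA x; have ax := chart_at_dom hA x.
have fx : f x = x by exact: (nbhs_singleton fid).
have -> : tangent f x = jac (chart_at A x) (chart_at A (f x)) f x by [].
rewrite fx -(jac_id hA ma ax); apply: esym.
apply: (jac_eq ma ma ax ax _ (smap_at_id hA x)).
by apply: near_sub fid _ => y ->.
Qed.

(** If [Psi] is the jet of [phi] along [phi], then [phi] read in a chart of [M] is
    an integral manifold. Conversely let [j] parametrize an integral manifold. As
    the distribution is complementary to the vertical bundle, [pr \o j] has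
    invertible derivative, hence a local right inverse [g] by the inverse function
    theorem. Then [j \o g] is a section whose tangents lie in the distribution,
    and by [jet_ext] its jets are the values of [Psi]. *)
Lemma jet_integrable (Psi : E -> jet1 pr) : jet_field Psi ->
  integrable_jet_field Psi <-> integrable_dist m (jet_dist Psi).
Proof.
move=> jP; have [tP _] := jP; split=> H y.
  have [phi [sy ey Hphi]] := H y.
  have md := chart_at_max hM (pr y); have dy := chart_at_dom hM (pr y).
  set d := chart_at M (pr y) in md dy; have hd := max_chart md.
  pose V : set 'rV[R]_m := cmap d @` (sdom phi `&` cdom d).
  have HV z : V z -> [/\ sdom phi (cinv d z), cdom d (cinv d z) & cmap d (cinv d z) = z].
    by move=> [x [sx dx] <-]; rewrite (cinvK hd dx).
  pose j : euclid R m -> E := phi \o cinv d.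
  have oV : open V by apply: (open_cmap hd); exact: sdom_open.
  have sc z : V z -> @smap_at R m m (euclid R m) M (cinv d) z.
    by move=> /HV[_ dz Ez]; exact: cinv_smooth.
  have sp z : V z -> smap_at phi (cinv d z) by move=> /HV[sz _ _]; exact: section_smooth.
  exists V, j; split=> //.
  - move=> z z' /set_mem/HV[sz dz Ez] /set_mem/HV[sz' dz' Ez'] ejz.
    by rewrite -Ez -Ez' -(smapK sz) -(smapK sz') [phi _]ejz.
  - apply/(smooth_mapP hU hE _ oV) => z Vz.
    exact: (smap_at_comp hM (sc z Vz) (sp z Vz)).
  - exists (cmap d (pr y)); first by exists (pr y).
    by rewrite /j /= (cinvK hd dy).
  - move=> z Vz; have [sz dz Ez] := HV z Vz.
    have hj : tangent j z =
        tangent (cinv d : euclid R m -> M) z *m tangent phi (cinv d z).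
      exact: (tangent_comp hU hM hE (sc z Vz) (sp z Vz)).
    have u : tangent (cinv d : euclid R m -> M) z \in unitmx.
      have sd : @smap_at R m m M (euclid R m) (id \o cmap d) (cinv d z).
        by apply: cmap_smooth => //; exact: smooth_at_id.
      have fid : {near (z : euclid R m), (id \o cmap d) \o cinv d =1 id}.
        have := near_image hd dz; rewrite Ez => nI.
        by apply: near_sub nI _ => v [_ Ev].
      have e1 := tangent_comp hU hM hU (sc z Vz) sd.
      have [u _] := mulmx1_unit (etrans (esym e1) (tangent_id_of hU fid)).
      exact: u.
    apply/eqmxP; rewrite hj.
    apply: eqmx_trans (eqmxMfull _ _) _; first by rewrite row_full_unit.
    apply: eqmx_sym; apply: eqmx_trans (genmxE _) _.
    have [_ _ _ e] := jet_of_rep sz.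
    have ep : pr (j z) = cinv d z := smapK sz.
    have eP : Psi (j z) = jet_of sz := Hphi _ sz.
    have -> : tangent (jrep (Psi (j z))) (pr (j z)) = tangent phi (cinv d z).
      by rewrite eP ep; exact: esym e.
    exact: eqmx_refl.
have [V [j [oV _ sj [z Vz jz] tj]]] := H y.
have {}sj z' : V z' -> smap_at j z'.
  by have /(smooth_mapP hU hE _ oV) := sj; apply.
have md := chart_at_max hM (pr y); have dy := chart_at_dom hM (pr y).
set d := chart_at M (pr y) in md dy; have hd := max_chart md.
have spj z' : V z' -> @smap_at R m m (euclid R m) M (pr \o j) z'.
  by move=> Vz'; apply: (smap_at_comp hE (sj z' Vz')); exact: (pr_smooth hpr).
have dz : cdom d ((pr \o j) z) by rewrite /= jz.
pose f : 'rV[R]_m -> 'rV[R]_m := cmap d \o (pr \o j).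
have sf : smooth_at z f by have [_ sz] := spj z Vz; exact: (sz idc d idc_max md I dz).
have fz : f z = cmap d (pr y) by rewrite /f /= jz.
have uf : 'J f z \in unitmx.
  have -> : 'J f z = tangent (pr \o j : euclid R m -> M) z.
    rewrite -[RHS]/(jac (chart_at (euclid R m) z) (chart_at M (pr (j z))) (pr \o j) z).
    by rewrite jz.
  rewrite (tangent_comp hU hE hM (sj z Vz) (pr_smooth hpr (j z))).
  have [e [De eK]] := horizontal_frame hpr (j z) (jet_field_horizontal hpr jP).
  have /submxP[B eB] : (e <= tangent j z)%MS by rewrite (eqmxP (tj z Vz)) De.
  rewrite eB -mulmxA in eK.
  by have [_ u] := mulmx1_unit eK; exact: u.
have [g [sg gz fg]] := local_right_inverse sf uf.
have cg := smooth_at_continuous sg.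
have cpj : {for z, continuous (pr \o j)} by case: (spj z Vz).
have n1 : \forall v \near z, V v /\ cdom d (pr (j v)).
  exact: (near_and (open_near oV Vz) (cpj _ (near_cdom hd dz))).
rewrite -gz in n1.
have n2 := cg _ n1.
have := near_and (near_and (smooth_at_near sg) fg) n2; rewrite fz => n3.
have := near_and (near_cdom hd dy) (near_cmap hd dy n3).
move=> /near_open[S [oS Sy HS]].
pose phi x := j (g (cmap d x)).
have sphi x : S x -> smap_at phi x /\ (tangent phi x <= tangent j (g (cmap d x)))%MS.
  move=> /HS[dx [[sgx _] [Vx _]]].
  have sgd := cmap_smooth md dx sgx.
  split; first exact: (smap_at_comp hU sgd (sj _ Vx)).
  have -> : tangent phi x =
    tangent (g \o cmap d : M -> euclid R m) x *m tangent j (g (cmap d x)).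
    exact: (tangent_comp hM hU hE sgd (sj _ Vx)).
  exact: submxMl.
have Sphi : smooth_map S phi.
  by apply/(smooth_mapP hM hE _ oS) => x /sphi[].
have phiK x : S x -> pr (phi x) = x.
  move=> /HS[dx [[_ fgx] [_ dpx]]].
  by rewrite -(cinvK hd dpx) -[cmap d (pr _)]/(f (g (cmap d x))) fgx (cinvK hd dx).
exists (LocalSection oS Sphi phiK); split=> //=; first by rewrite /phi -fz gz.
move=> x Sx; apply: esym; apply: (jet_ext hpr).
  rewrite tP; have [_ _ e _] := jet_of_rep (phi := LocalSection oS Sphi phiK) Sx.
  exact: esym e.
have [_ _ _ e] := jet_of_rep (phi := LocalSection oS Sphi phiK) Sx.
rewrite -[X in (X <= _)%MS]e (jet_source tP).
have [_ tphi] := sphi x Sx; apply: submx_trans tphi _.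
have [_ [_ [Vx _]]] := HS x Sx.
rewrite (eqmxP (tj _ Vx)) -[j _]/(phi x).
by rewrite /jet_dist genmxE.
Qed.

End Integrability.

(** * The correspondence *)

Theorem theorem4 (R : realType) (m k : nat)
    (M : manifold R m) (E : manifold R (m + k)) (F : manifold R k)
    (pr : E -> M) (hpr : fiber_bundle F pr) :
  set_bij [set Psi | orientable_jet_field (pr := pr) Psi]
          [set N | orientable_connection pr N]
          (connection_of (pr := pr)) /\
  exists Theta : (E -> jet1 pr) -> set (E -> mvector R m (m + k)),
    [/\ set_bij [set Psi | orientable_jet_field Psi]
                [set C | exists2 X, ldt_field pr X & C = mv_class pr X]
                Theta,
        (forall Psi X, orientable_jet_field Psi -> ldt_field pr X ->
           (Theta Psi X <-> eq_dist (jet_dist Psi) (mv_dist X))) &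
        (forall Psi X, orientable_jet_field Psi -> Theta Psi X ->
           (integrable_jet_field Psi <-> integrable_mv X))].
Proof.
split; first exact: (connection_of_bij hpr).
have eq_sym (D D' : distribution E) : eq_dist D D' -> eq_dist D' D.
  by move=> e y; have := e y; rewrite andbC.
have eq_trans (D1 D2 D3 : distribution E) :
    eq_dist D1 D2 -> eq_dist D2 D3 -> eq_dist D1 D3.
  by move=> e e' y; apply/eqmxP; exact: eqmx_trans (eqmxP (e y)) (eqmxP (e' y)).
pose Theta (Psi : E -> jet1 pr) : set (E -> mvector R m (m + k)) :=
  [set X | ldt_field pr X /\ eq_dist (jet_dist Psi) (mv_dist X)].
have ThetaE Psi X : Theta Psi X -> Theta Psi = mv_class pr X.
  move=> [lX eX]; apply/seteqP; split=> X' [lX' HX']; split=> //.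
    exact: (ldt_equiv lX lX').2 (eq_trans _ _ _ (eq_sym _ _ eX) HX').
  exact: eq_trans eX ((ldt_equiv lX lX').1 HX').
exists Theta; split.
- split.
  + move=> Psi [jP oP].
    have [X lX eX] := orientable_ldt hpr (jet_field_horizontal hpr jP) oP.
    by exists X; [exact: lX|apply: ThetaE; exact: (conj lX (eq_sym _ _ eX))].
  + move=> Psi Psi' /set_mem[jP oP] /set_mem[jP' oP'] eT.
    have [X lX eX] := orientable_ldt hpr (jet_field_horizontal hpr jP) oP.
    have TX : Theta Psi X := conj lX (eq_sym _ _ eX).
    have [_ eX'] : Theta Psi' X by rewrite -eT; exact: TX.
    apply: (jet_field_eq hpr jP jP').
    exact: eq_trans (eq_sym _ _ eX) (eq_sym _ _ eX').
  + move=> _ [X lX ->].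
    have [Psi jP eP] := horizontal_jet_field hpr (ldt_horizontal hpr lX).
    exists Psi; last exact: ThetaE (conj lX eP).
    exact: conj jP (orientable_eq (eq_sym _ _ eP) (ldt_orientable lX)).
- by move=> Psi X _ lX; split=> [[_ eX]|eX]; [exact: eX|exact: conj lX eX].
- move=> Psi X [jP _] [_ eX].
  have [H1 H2] := jet_integrable hpr jP; split=> [/H1|H].
    exact: integrable_dist_eq eX.
  exact: H2 (integrable_dist_eq (eq_sym _ _ eX) H).
Qed.
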